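(* Let $X$ be a unital merge-bicategory. Then: (a) $\mathcal{M}X$ is 1-representable and admits a strictly associative family of tensors; (b) the inclusion $\zeta_X: X \to \mathcal{M}X$ is a strong morphism; (c) if $X$ is representable, $\zeta_X$ is an equivalence.
   Context: Merge-bicategories. A regular 2-polygraph $X$ consists of 0-cells, 1-cells $a: x \to y$, and, for all $n,m\ge 1$, 2-cells $p:(a_1,\ldots,a_n)\to(b_1,\ldots,b_m)$ between non-empty composable sequences of 1-cells with the same initial source and the same final target. Greek capitals denote possibly empty composable sequences; commas denote concatenation. A merge-bicategory is a regular 2-polygraph with operations: given $t:(\Gamma)\to(\Delta_1,\Lambda,\Delta_2)$ and $s:(\Gamma_1,\Lambda,\Gamma_2)\to(\Delta)$ with $\Lambda$ non-empty, occupying outputs $j_1,\ldots,j_2$ of $t$ and inputs $i_1,\ldots,i_2$ of $s$, such that ($\Gamma_1$ or $\Delta_1$ is empty) and ($\Gamma_2$ or $\Delta_2$ is empty), a 2-cell $\mathrm{mrg}_{[j_1,j_2]}^{[i_1,i_2]}(t,s):(\Gamma_1,\Gamma,\Gamma_2)\to(\Delta_1,\Delta,\Delta_2)$; whenever the same pasting diagram of three 2-cells (with the same identifications of output with input 1-cells) can be evaluated by two successive merges in two different orders, the results are equal. No units are part of the structure. Morphisms preserve boundaries and merges. A unit on a non-empty sequence $\Gamma$ is a 2-cell $\mathrm{id}_\Gamma:(\Gamma)\to(\Gamma)$ such that merging any 2-cell with it along $\Gamma$, on either side, returns that 2-cell; $X$ is unital if every non-empty composable sequence has a unit. $t:(\Gamma)\to(\Delta_1,a,\Delta_2)$,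 with $a$ its $j$-th output, is universal at $\partial_j^+$ if for all $\Gamma_1,\Gamma_2$ and non-empty $\Delta$ with ($\Gamma_1$ or $\Delta_1$ empty) and ($\Gamma_2$ or $\Delta_2$ empty), every $s:(\Gamma_1,\Gamma,\Gamma_2)\to(\Delta_1,\Delta,\Delta_2)$ is the merge along $a$ of $t$ and a unique $r:(\Gamma_1,a,\Gamma_2)\to(\Delta)$; universality at $\partial_i^-$ is dual (reversing 2-cells). A 2-cell $t:(\Gamma)\to(\Delta)$ is universal if every $s:(\Gamma_1,\Gamma,\Gamma_2)\to(\Delta')$ is the merge along $\Delta$ of $t$ and a unique $r:(\Gamma_1,\Delta,\Gamma_2)\to(\Delta')$, and dually. A tensor of $a,b$ is a 2-cell $(a,b)\to(c)$ universal at $\partial_1^+$. A tensor unit on $x$ is $1_x:x\to x$ such that for all $a:x\to y$ there is a 2-cell $(1_x,a)\to(a)$ universal at $\partial_1^+$ and $\partial_2^-$, and for all $b:z\to x$ a 2-cell $(b,1_x)\to(b)$ universal at $\partial_1^+$ and $\partial_1^-$. A 1-cell $e:x\to x'$ is tensor universal if for each $a:x\to y$ there is a 2-cell $(e,u)\to(a)$, and for each $a':x'\to y$ a 2-cell $(e,a')\to(v)$, both universal at $\partial_1^+$ and $\partial_2^-$; and for each $b':z\to x'$ there is a 2-cell $(u',e)\to(b')$, and for each $b:z\to x$ a 2-cell $(b,e)\to(v')$, both universal at $\partial_1^+$ and $\partial_1^-$ (for some $u,v,u',v'$). Pars, par units, par universal 1-cells are the duals (reverse all 2-cells). A 1-cell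 is universal if it is tensor and par universal. $X$ is 1-representable if it is unital and every composable pair of 1-cells has a tensor and a par; it is representable if moreover every 0-cell has a tensor unit and a par unit. A morphism is strong if it maps units on 1-cells to units, tensor (par) universal 1-cells to tensor (par) universal 1-cells, tensors to tensors and pars to pars. A family of tensors $\{t_{a,b}:(a,b)\to(a\otimes b)\}$, indexed by all composable pairs of 1-cells, is strictly associative if for all composable triples $a,b,c$ one has $a\otimes(b\otimes c)=(a\otimes b)\otimes c$ and $\mathrm{mrg}_{[1,1]}^{[1,1]}(t_{a,b},t_{a\otimes b,c})=\mathrm{mrg}_{[1,1]}^{[2,2]}(t_{b,c},t_{a,b\otimes c})$. Equivalences. For morphisms $f,g:X\to Y$, an oplax transformation $\sigma:f\to g$ assigns to each 0-cell $x$ of $X$ a 1-cell $\sigma_x:f(x)\to g(x)$ and to each 1-cell $a:x\to y$ a 2-cell $\sigma_a:(f(a),\sigma_y)\to(\sigma_x,g(a))$ of $Y$, such that for all 2-cells $p:(a_1,\ldots,a_n)\to(b_1,\ldots,b_m)$ of $X$, with initial and final 0-cells $x^-$, $x^+$, the two composites $(f(a_1),\ldots,f(a_n),\sigma_{x^+})\to(\sigma_{x^-},g(b_1),\ldots,g(b_m))$ given by $f(p)$ followed by $\sigma_{b_m},\ldots,\sigma_{b_1}$, and by $\sigma_{a_n},\ldots,\sigma_{a_1}$ followed by $g(p)$, are equal. It is a pseudo-natural equivalence if all $\sigma_x$ are universal 1-cells and all $\sigma_a$ are universal 2-cells. A strong morphism $f:X\to Y$ of representable merge-bicategories is an equivalence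 if there exist a strong morphism $g:Y\to X$ and pseudo-natural equivalences $\mathrm{id}_X\to gf$ and $\mathrm{id}_Y\to fg$. The merge-bicategory $\mathcal{M}X$ has the same 0-cells as $X$; a 1-cell $\langle\Gamma\rangle:x\to y$ for each non-empty composable sequence $\Gamma$ of 1-cells of $X$ from $x$ to $y$; and, for each 2-cell $p:(\Gamma)\to(\Delta)$ of $X$ and each pair of partitions $\Gamma=\Gamma_1,\ldots,\Gamma_n$, $\Delta=\Delta_1,\ldots,\Delta_m$ into consecutive non-empty subsequences, a 2-cell $p_{\langle\Gamma_1\rangle\ldots\langle\Gamma_n\rangle}^{\langle\Delta_1\rangle\ldots\langle\Delta_m\rangle}:(\langle\Gamma_1\rangle,\ldots,\langle\Gamma_n\rangle)\to(\langle\Delta_1\rangle,\ldots,\langle\Delta_m\rangle)$. The merge of two such 2-cells along $\langle\Lambda_1\rangle,\ldots,\langle\Lambda_k\rangle$ is the merge in $X$ of the underlying 2-cells along $\Lambda_1,\ldots,\Lambda_k$, with its boundary partitioned as the boundary of the composite prescribes. The inclusion $\zeta_X:X\to\mathcal{M}X$ is the identity on 0-cells, sends $a$ to $\langle a\rangle$ and $p:(a_1,\ldots,a_n)\to(b_1,\ldots,b_m)$ to $p_{\langle a_1\rangle\ldots\langle a_n\rangle}^{\langle b_1\rangle\ldots\langle b_m\rangle}$. *)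

(* Defs.v *)
From Stdlib Require Import ProofIrrelevance.
From mathcomp Require Import all_boot.

Set Implicit Arguments.
Unset Strict Implicit.
Unset Printing Implicit Defensive.

(* Boundaries are stored in the cells, and composability is a proposition about
   plain sequences; so all cells of the same dimension live in one type and
   equations between 2-cells need no transport. *)

Fixpoint chain {C0 C1 : Type} (src tgt : C1 -> C0) (a : C1) (G : seq C1) : Prop :=
  if G is b :: G' then tgt a = src b /\ chain src tgt b G' else True.

(* In particular both sequences are non-empty and composable. *)
Definition parallel {C0 C1 : Type} (src tgt : C1 -> C0) (G D : seq C1) : Prop :=
  match G, D with
  | a :: G', b :: D' =>
      [/\ chain src tgt a G', chain src tgt b D',
          src a = src b & tgt (last a G') = tgt (last b D')]
  | _, _ => False
  end.

Record polygraph : Type := Polygraph {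
  cell0 : Type;
  cell1 : Type;
  src : cell1 -> cell0;
  tgt : cell1 -> cell0;
  cell2 : Type;
  inputs : cell2 -> seq cell1;
  outputs : cell2 -> seq cell1;
  boundary : forall p, parallel src tgt (inputs p) (outputs p)
}.

Definition composable (X : polygraph) (G : seq (cell1 X)) : Prop :=
  if G is a :: G' then chain (@src X) (@tgt X) a G' else True.

(* t : (G) -> (D1, L, D2) and s : (G1, L, G2) -> (D) may be merged along L.
   The lists determine, and are determined by, the positions of L among the
   outputs of t and the inputs of s. *)
Record mergeable (X : polygraph) (D1 L D2 G1 G2 : seq (cell1 X))
    (t s : cell2 X) : Prop := Mergeable {
  mergeable_out : outputs t = D1 ++ L ++ D2;
  mergeable_in : inputs s = G1 ++ L ++ G2;
  mergeable_ne : L <> [::];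
  mergeable_left : G1 = [::] \/ D1 = [::];
  mergeable_right : G2 = [::] \/ D2 = [::]
}.

Definition merge_op (X : polygraph) : Type :=
  forall (D1 L D2 G1 G2 : seq (cell1 X)) (t s : cell2 X),
    mergeable D1 L D2 G1 G2 t s -> cell2 X.

(* A port (n, i) stands for the i-th input, or the i-th output, of the n-th
   cell of a pasting diagram, counting from 0. *)
Definition port : Type := (nat * nat)%type.

(* dlinks lists the pairs (output port, input port) that are identified; dins
   and douts list the ports left on the boundary, in order. *)
Record diagram : Type := Diagram {
  dcells : seq nat;
  dlinks : seq (port * port);
  dins : seq port;
  douts : seq port
}.

Definition single_diagram (n a b : nat) : diagram :=
  Diagram [:: n] [::] [seq (n, i) | i <- iota 0 a] [seq (n, i) | i <- iota 0 b].

(* identify the outputs j, ..., j+k-1 of d with the inputs i, ..., i+k-1 of e *)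
Definition glue_diagram (j i k : nat) (d e : diagram) : diagram :=
  Diagram (dcells d ++ dcells e)
    (dlinks d ++ dlinks e ++
       zip (take k (drop j (douts d))) (take k (drop i (dins e))))
    (take i (dins e) ++ dins d ++ drop (i + k) (dins e))
    (take j (douts d) ++ douts e ++ drop (j + k) (douts d)).

(* For two evaluations of the same cells, equal links already force equal
   boundary ports, by planarity of merges. *)
Definition same_diagram (d e : diagram) : Prop :=
  [/\ perm_eq (dcells d) (dcells e), dlinks d =i dlinks e,
      dins d = dins e & douts d = douts e].

(* [evaluates m c d p]: successive merges evaluate the diagram d, whose n-th
   cell is c n, to p. *)
Inductive evaluates (X : polygraph) (m : merge_op X) (c : nat -> cell2 X) :
    diagram -> cell2 X -> Prop :=
| evaluates_cell n :
    evaluates m c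
      (single_diagram n (size (inputs (c n))) (size (outputs (c n)))) (c n)
| evaluates_merge d e t s D1 L D2 G1 G2 (h : mergeable D1 L D2 G1 G2 t s) :
    evaluates m c d t -> evaluates m c e s ->
    evaluates m c (glue_diagram (size D1) (size G1) (size L) d e) (m _ _ _ _ _ _ _ h).

(* mrg_coherence: any two ways of evaluating the same diagram of three cells, by
   two successive merges, agree. *)
Record merge_bicategory : Type := MergeBicategory {
  poly :> polygraph;
  mrg : merge_op poly;
  inputs_mrg : forall D1 L D2 G1 G2 t s (h : mergeable D1 L D2 G1 G2 t s),
    inputs (mrg h) = G1 ++ inputs t ++ G2;
  outputs_mrg : forall D1 L D2 G1 G2 t s (h : mergeable D1 L D2 G1 G2 t s),
    outputs (mrg h) = D1 ++ outputs s ++ D2;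
  mrg_coherence : forall (c : nat -> cell2 poly) d e p q,
    perm_eq (dcells d) [:: 0; 1; 2] -> same_diagram d e ->
    evaluates mrg c d p -> evaluates mrg c e q -> p = q
}.

Definition is_mrg (X : merge_bicategory) (D1 L D2 G1 G2 : seq (cell1 X))
    (t s r : cell2 X) : Prop :=
  exists h : mergeable D1 L D2 G1 G2 t s, mrg h = r.

Record morphism (X Y : merge_bicategory) : Type := Morphism {
  map0 : cell0 X -> cell0 Y;
  map1 : cell1 X -> cell1 Y;
  map2 : cell2 X -> cell2 Y;
  map_src : forall a, src (map1 a) = map0 (src a);
  map_tgt : forall a, tgt (map1 a) = map0 (tgt a);
  map_inputs : forall p, inputs (map2 p) = map map1 (inputs p);
  map_outputs : forall p, outputs (map2 p) = map map1 (outputs p);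
  map_mrg : forall D1 L D2 G1 G2 t s r, is_mrg D1 L D2 G1 G2 t s r ->
    is_mrg (map map1 D1) (map map1 L) (map map1 D2) (map map1 G1) (map map1 G2)
      (map2 t) (map2 s) (map2 r)
}.

Lemma id_morphism_mrg (X : merge_bicategory) D1 L D2 G1 G2 (t s r : cell2 X) :
  is_mrg D1 L D2 G1 G2 t s r ->
  is_mrg (map id D1) (map id L) (map id D2) (map id G1) (map id G2) t s r.
Proof. by rewrite !map_id. Qed.

Definition id_morphism (X : merge_bicategory) : morphism X X :=
  @Morphism X X id id id (fun=> erefl) (fun=> erefl)
    (fun p => esym (map_id (inputs p))) (fun p => esym (map_id (outputs p)))
    (@id_morphism_mrg X).

Section Composition.
Variables (X Y Z : merge_bicategory) (g : morphism Y Z) (f : morphism X Y).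

Definition comp_morphism : morphism X Z.
Proof.
refine (@Morphism X Z (map0 g \o map0 f) (map1 g \o map1 f) (map2 g \o map2 f)
          _ _ _ _ _).
- by move=> a; rewrite /= !map_src.
- by move=> a; rewrite /= !map_tgt.
- by move=> p; rewrite /= !map_inputs map_comp.
- by move=> p; rewrite /= !map_outputs map_comp.
- by move=> D1 L D2 G1 G2 t s r /(map_mrg f)/(map_mrg g); rewrite -!map_comp.
Defined.
End Composition.

Section Dual.
Variable X : merge_bicategory.

Lemma dual_boundary (p : cell2 X) :
  parallel (@src X) (@tgt X) (outputs p) (inputs p).
Proof.
have := boundary p.
by case: (inputs p) (outputs p) => [|a G] [|b D] //= [].
Qed.

(* The dual has the same cells, with all 2-cells reversed. *)
Definition dual_polygraph : polygraph :=
  @Polygraph (cell0 X) (cell1 X) (@src X) (@tgt X) (cell2 X)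
    (@outputs X) (@inputs X) dual_boundary.

Lemma dual_mergeable D1 L D2 G1 G2 (t s : cell2 dual_polygraph) :
  @mergeable dual_polygraph D1 L D2 G1 G2 t s ->
  @mergeable X G1 L G2 D1 D2 s t.
Proof. by case=> ot is_ nL [] l [] r; split=> //; by [left | right]. Qed.

Definition dual_mrg : merge_op dual_polygraph :=
  fun D1 L D2 G1 G2 t s h => mrg (dual_mergeable h).

Lemma dual_inputs_mrg D1 L D2 G1 G2 (t s : cell2 dual_polygraph)
    (h : mergeable D1 L D2 G1 G2 t s) :
  inputs (dual_mrg h) = G1 ++ inputs t ++ G2.
Proof. exact: outputs_mrg. Qed.

Lemma dual_outputs_mrg D1 L D2 G1 G2 (t s : cell2 dual_polygraph)
    (h : mergeable D1 L D2 G1 G2 t s) :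
  outputs (dual_mrg h) = D1 ++ outputs s ++ D2.
Proof. exact: inputs_mrg. Qed.

Definition flip_link (l : port * port) : port * port := (l.2, l.1).

Lemma zip_flip (u v : seq port) : zip v u = map flip_link (zip u v).
Proof. by elim: u v => [|x u IH] [|y v] //=; rewrite IH. Qed.

Lemma dual_evaluates c d p : evaluates dual_mrg c d p ->
  exists2 d', evaluates (@mrg X) c d' p &
    [/\ perm_eq (dcells d') (dcells d), dlinks d' =i map flip_link (dlinks d),
        dins d' = douts d & douts d' = dins d].
Proof.
elim=> [n|{}d e t s D1 L D2 G1 G2 h _ [d' Hd [cd ld id od]] _ [e' He [ce le ie oe]]].
  by eexists; [apply: (evaluates_cell (@mrg X)) | split].
exists (glue_diagram (size G1) (size D1) (size L) e' d').
  exact: evaluates_merge.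
split=> /=; rewrite ?id ?od ?ie ?oe //.
- by rewrite perm_catC; apply: perm_cat.
- move=> x; rewrite !map_cat !mem_cat ld le -zip_flip.
  by rewrite orbA [(x \in map _ (dlinks e)) || _]orbC -orbA.
Qed.

Lemma dual_coherence (c : nat -> cell2 dual_polygraph) d e p q :
  perm_eq (dcells d) [:: 0; 1; 2] -> same_diagram d e ->
  evaluates dual_mrg c d p -> evaluates dual_mrg c e q -> p = q.
Proof.
move=> d3 [cde lde ide ode].
move=> /dual_evaluates[d' Hd [cd ld id od]] /dual_evaluates[e' He [ce le ie oe]].
apply: mrg_coherence Hd He; first exact: perm_trans cd d3.
split; rewrite ?id ?od ?ie ?oe //.
  by rewrite (perm_trans cd) // (perm_trans cde) // perm_sym.
by move=> x; rewrite ld le; apply: eq_mem_map.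
Qed.

Definition dual : merge_bicategory :=
  @MergeBicategory dual_polygraph dual_mrg dual_inputs_mrg dual_outputs_mrg
    dual_coherence.
End Dual.

Section Universality.
Variable X : merge_bicategory.
Implicit Types (G D : seq (cell1 X)) (a b c e : cell1 X) (t s r : cell2 X).

Definition is_unit G t : Prop :=
  [/\ inputs t = G, outputs t = G,
      forall s D1 D2, outputs s = D1 ++ G ++ D2 ->
        is_mrg D1 G D2 [::] [::] s t s &
      forall s G1 G2, inputs s = G1 ++ G ++ G2 ->
        is_mrg [::] G [::] G1 G2 t s s].

Definition unital : Prop :=
  forall G, G <> [::] -> composable G -> exists t, is_unit G t.

(* t : (G) -> (D1, a, D2) is universal at its output a *)
Definition universal_out t D1 a D2 : Prop :=
  outputs t = D1 ++ a :: D2 /\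
  forall G1 G2 D s, D <> [::] ->
    G1 = [::] \/ D1 = [::] -> G2 = [::] \/ D2 = [::] ->
    inputs s = G1 ++ inputs t ++ G2 -> outputs s = D1 ++ D ++ D2 ->
    exists! r, [/\ inputs r = G1 ++ a :: G2, outputs r = D &
                   is_mrg D1 [:: a] D2 G1 G2 t r s].

(* One half of the universality of a 2-cell; the other half is its dual. *)
Definition universal_from t : Prop :=
  forall G1 G2 s, inputs s = G1 ++ inputs t ++ G2 ->
    exists! r, [/\ inputs r = G1 ++ outputs t ++ G2, outputs r = outputs s &
                   is_mrg [::] (outputs t) [::] G1 G2 t r s].

Definition is_tensor a b c t : Prop :=
  [/\ inputs t = [:: a; b], outputs t = [:: c] & universal_out t [::] c [::]].
End Universality.

(* t : (G1, a, G2) -> (D) is universal at its input a *)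
Definition universal_in (X : merge_bicategory) (t : cell2 X)
    (G1 : seq (cell1 X)) (a : cell1 X) (G2 : seq (cell1 X)) : Prop :=
  @universal_out (dual X) t G1 a G2.

Definition universal2 (X : merge_bicategory) (t : cell2 X) : Prop :=
  @universal_from X t /\ @universal_from (dual X) t.

(* a par of a and b is a 2-cell (c) -> (a, b) *)
Definition is_par (X : merge_bicategory) (a b c : cell1 X) (t : cell2 X) : Prop :=
  @is_tensor (dual X) a b c t.

Section Representability.
Variable X : merge_bicategory.
Implicit Types (a b c e u v : cell1 X) (x : cell0 X).

(* a 2-cell (e, u) -> (a) universal at its output and at its second input *)
Definition left_divides e u a : Prop :=
  exists t : cell2 X,
    [/\ inputs t = [:: e; u], outputs t = [:: a],
        universal_out t [::] a [::] & universal_in t [:: e] u [::]].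

(* a 2-cell (u, e) -> (a) universal at its output and at its first input *)
Definition right_divides e u a : Prop :=
  exists t : cell2 X,
    [/\ inputs t = [:: u; e], outputs t = [:: a],
        universal_out t [::] a [::] & universal_in t [::] u [:: e]].

Definition is_tensor_unit x e : Prop :=
  [/\ src e = x, tgt e = x,
      forall a, src a = x -> left_divides e a a &
      forall b, tgt b = x -> right_divides e b b].

Definition tensor_universal e : Prop :=
  [/\ forall a, src a = src e -> exists u, left_divides e u a,
      forall a', src a' = tgt e -> exists v, left_divides e a' v,
      forall b', tgt b' = tgt e -> exists u', right_divides e u' b' &
      forall b, tgt b = src e -> exists v', right_divides e b v'].
End Representability.

Definition is_par_unit (X : merge_bicategory) (x : cell0 X) (e : cell1 X) : Prop :=
  @is_tensor_unit (dual X) x e.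

Definition par_universal (X : merge_bicategory) (e : cell1 X) : Prop :=
  @tensor_universal (dual X) e.

Definition universal1 (X : merge_bicategory) (e : cell1 X) : Prop :=
  tensor_universal e /\ par_universal e.

Definition one_representable (X : merge_bicategory) : Prop :=
  unital X /\
  forall a b : cell1 X, tgt a = src b ->
    (exists c t, is_tensor a b c t) /\ (exists c t, is_par a b c t).

Definition representable (X : merge_bicategory) : Prop :=
  one_representable X /\
  forall x : cell0 X, (exists e, is_tensor_unit x e) /\ (exists e, is_par_unit x e).

Definition strong (X Y : merge_bicategory) (f : morphism X Y) : Prop :=
  [/\ forall a t, is_unit [:: a] t -> is_unit [:: map1 f a] (map2 f t),
      forall e, tensor_universal e -> tensor_universal (map1 f e),
      forall e, par_universal e -> par_universal (map1 f e),
      forall a b c t, is_tensor a b c t ->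
        is_tensor (map1 f a) (map1 f b) (map1 f c) (map2 f t) &
      forall a b c t, is_par a b c t ->
        is_par (map1 f a) (map1 f b) (map1 f c) (map2 f t)].

Record tensor_family (X : merge_bicategory) : Type := TensorFamily {
  tensor1 : forall a b : cell1 X, tgt a = src b -> cell1 X;
  tensor2 : forall a b : cell1 X, tgt a = src b -> cell2 X;
  tensorP : forall a b (h : tgt a = src b),
    is_tensor a b (tensor1 h) (tensor2 h)
}.

(* [ha_bc] and [hab_c] follow from the boundary conditions on tensors. *)
Definition strictly_associative (X : merge_bicategory) (T : tensor_family X) : Prop :=
  forall (a b c : cell1 X) (hab : tgt a = src b) (hbc : tgt b = src c)
    (ha_bc : tgt a = src (tensor1 T hbc)) (hab_c : tgt (tensor1 T hab) = src c),
    tensor1 T ha_bc = tensor1 T hab_c /\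
    exists r,
      is_mrg [::] [:: tensor1 T hab] [::] [::] [:: c]
        (tensor2 T hab) (tensor2 T hab_c) r /\
      is_mrg [::] [:: tensor1 T hbc] [::] [:: a] [::]
        (tensor2 T hbc) (tensor2 T ha_bc) r.

Section Transformations.
Variables (X Y : merge_bicategory) (f g : morphism X Y).
Variables (s0 : cell0 X -> cell1 Y) (s1 : cell1 X -> cell2 Y).

(* For G = (a_1, ..., a_n) running from x to y, the composite r of s1 a_n, ...,
   s1 a_1, of type (f a_1, ..., f a_n, s0 y) -> (s0 x, g a_1, ..., g a_n). *)
Fixpoint pastes_to (G : seq (cell1 X)) (r : cell2 Y) : Prop :=
  match G with
  | [::] => False
  | [:: a] => r = s1 a
  | a :: G' => exists q, pastes_to G' q /\
      is_mrg [::] [:: s0 (tgt a)] (map (map1 g) G') [:: map1 f a] [::] q (s1 a) r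
  end.

(* f p followed by the composite of s1 b_m, ..., s1 b_1 *)
Definition composite_fs (p : cell2 X) (r : cell2 Y) : Prop :=
  exists b D q, [/\ outputs p = b :: D, pastes_to (b :: D) q &
    is_mrg [::] (map (map1 f) (b :: D)) [::] [::] [:: s0 (tgt (last b D))]
      (map2 f p) q r].

(* the composite of s1 a_n, ..., s1 a_1 followed by g p *)
Definition composite_sg (p : cell2 X) (r : cell2 Y) : Prop :=
  exists a G q, [/\ inputs p = a :: G, pastes_to (a :: G) q &
    is_mrg [:: s0 (src a)] (map (map1 g) (a :: G)) [::] [::] [::]
      q (map2 g p) r].
End Transformations.

Record oplax (X Y : merge_bicategory) (f g : morphism X Y) : Type := Oplax {
  comp0 : cell0 X -> cell1 Y;
  comp1 : cell1 X -> cell2 Y;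
  src_comp0 : forall x, src (comp0 x) = map0 f x;
  tgt_comp0 : forall x, tgt (comp0 x) = map0 g x;
  inputs_comp1 : forall a, inputs (comp1 a) = [:: map1 f a; comp0 (tgt a)];
  outputs_comp1 : forall a, outputs (comp1 a) = [:: comp0 (src a); map1 g a];
  (* both composites exist, uniquely, by the typing conditions above *)
  oplax_natural : forall p, exists r,
    composite_fs f g comp0 comp1 p r /\ composite_sg f g comp0 comp1 p r
}.

Definition pseudonatural_equivalence (X Y : merge_bicategory)
    (f g : morphism X Y) (s : oplax f g) : Prop :=
  (forall x, universal1 (comp0 s x)) /\ (forall a, universal2 (comp1 s a)).

(* Both ends are required to be representable, since being an equivalence is
   defined for strong morphisms of representable merge-bicategories. *)
Definition is_equivalence (X Y : merge_bicategory) (f : morphism X Y) : Prop :=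
  [/\ representable X, representable Y, strong f &
      exists g : morphism Y X,
        [/\ strong g,
            exists s : oplax (id_morphism X) (comp_morphism g f),
              pseudonatural_equivalence s &
            exists s : oplax (id_morphism Y) (comp_morphism f g),
              pseudonatural_equivalence s]].

Section Sequences.
Variable X : merge_bicategory.

Record mcell1 : Type := MCell1 {
  mhead : cell1 X;
  mtail : seq (cell1 X);
  mchain : composable (mhead :: mtail)
}.

Definition mseq (A : mcell1) : seq (cell1 X) := mhead A :: mtail A.

Definition msrc (A : mcell1) : cell0 X := src (mhead A).
Definition mtgt (A : mcell1) : cell0 X := tgt (last (mhead A) (mtail A)).

(* A partition of G into consecutive non-empty subsequences is a sequence As
   of 1-cells such that [unfold As = G]. *)
Definition unfold (As : seq mcell1) : seq (cell1 X) := flatten (map mseq As).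

Record mcell2 : Type := MCell2 {
  munder : cell2 X;
  minputs : seq mcell1;
  moutputs : seq mcell1;
  minputsP : unfold minputs = inputs munder;
  moutputsP : unfold moutputs = outputs munder
}.

Lemma mcell2_eq (p q : mcell2) :
  munder p = munder q -> minputs p = minputs q -> moutputs p = moutputs q -> p = q.
Proof.
case: p q => [p A B HA HB] [q A' B' HA' HB'] /= ? ? ?; subst.
by rewrite (proof_irrelevance _ HA HA') (proof_irrelevance _ HB HB').
Qed.

Lemma unfold_cat As Bs : unfold (As ++ Bs) = unfold As ++ unfold Bs.
Proof. by rewrite /unfold map_cat flatten_cat. Qed.

Lemma unfold_nil As : unfold As = [::] -> As = [::].
Proof. by case: As. Qed.

Lemma chain_cat (a : cell1 X) G b D :
  chain (@src X) (@tgt X) a (G ++ b :: D) ->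
  tgt (last a G) = src b /\ chain (@src X) (@tgt X) b D.
Proof. by elim: G a => [|c G IH] a //= [_ /IH]. Qed.

Lemma unfold_last A As :
  last (mhead A) (mtail A ++ unfold As) =
  last (mhead (last A As)) (mtail (last A As)).
Proof. by elim: As A => [|B As IH] A; rewrite ?cats0 //= last_cat /= IH. Qed.

Lemma unfold_chain A As :
  chain (@src X) (@tgt X) (mhead A) (mtail A ++ unfold As) ->
  chain msrc mtgt A As.
Proof. by elim: As A => [|B As IH] A //= /chain_cat[? /IH]. Qed.

Lemma mboundary (p : mcell2) : parallel msrc mtgt (minputs p) (moutputs p).
Proof.
case: p => p As Bs /= HA HB; have := boundary p; rewrite -HA -HB {HA HB}.
case: As Bs => [|A As] [|B Bs] //= [cA cB eh el].
by split; rewrite ?/mtgt -?unfold_last //; apply: unfold_chain.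
Qed.

Definition mpolygraph : polygraph :=
  @Polygraph (cell0 X) mcell1 msrc mtgt mcell2 minputs moutputs mboundary.

Lemma munder_mergeable D1 L D2 G1 G2 (t s : cell2 mpolygraph) :
  @mergeable mpolygraph D1 L D2 G1 G2 t s ->
  @mergeable X (unfold D1) (unfold L) (unfold D2) (unfold G1) (unfold G2)
    (munder t) (munder s).
Proof.
case=> ot is_ nL l r; split.
- by rewrite -moutputsP [moutputs t]ot !unfold_cat.
- by rewrite -minputsP [minputs s]is_ !unfold_cat.
- by move/unfold_nil.
- by case: l => ->; [left | right].
- by case: r => ->; [left | right].
Qed.

Section Merge.
Variables (D1 L D2 G1 G2 : seq mcell1) (t s : mcell2).
Hypothesis h : @mergeable mpolygraph D1 L D2 G1 G2 t s.

Lemma mmrg_inputsP :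
  unfold (G1 ++ minputs t ++ G2) = inputs (mrg (munder_mergeable h)).
Proof. by rewrite inputs_mrg !unfold_cat minputsP. Qed.

Lemma mmrg_outputsP :
  unfold (D1 ++ moutputs s ++ D2) = outputs (mrg (munder_mergeable h)).
Proof. by rewrite outputs_mrg !unfold_cat moutputsP. Qed.
End Merge.

Definition mmrg : merge_op mpolygraph :=
  fun D1 L D2 G1 G2 t s h => MCell2 (mmrg_inputsP h) (mmrg_outputsP h).

(* A diagram of cells of sequences expands into one of the underlying cells:
   the port (n, i) becomes the ports of the members of the i-th sequence of the
   boundary B n. *)

Definition block (B : nat -> seq mcell1) (x : port) : seq (cell1 X) :=
  nth [::] (map mseq (B x.1)) x.2.

Definition expand (B : nat -> seq mcell1) (x : port) : seq port :=
  [seq (x.1, size (unfold (take x.2 (B x.1))) + r)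
     | r <- iota 0 (size (block B x))].

Lemma expand_flatten (n k : nat) (ss : seq (seq (cell1 X))) :
  flatten [seq [seq (n, k + size (flatten (take i ss)) + r)
    | r <- iota 0 (size (nth [::] ss i))] | i <- iota 0 (size ss)] =
  [seq (n, k + i) | i <- iota 0 (size (flatten ss))].
Proof.
elim: ss k => [|G ss IH] k //=.
rewrite size_cat iotaD map_cat; congr (_ ++ _).
  by apply: eq_map => r; rewrite addn0.
rewrite (iotaDl 1 0) -map_comp -[0 + _]addnC iotaDl -map_comp.
transitivity [seq (n, k + size G + i) | i <- iota 0 (size (flatten ss))].
  rewrite -IH; congr flatten; apply: eq_map => i /=.
  by apply: eq_map => r; rewrite size_cat addnA.
by apply: eq_map => j /=; rewrite addnA.
Qed.

Lemma expand_cell B n :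
  flatten (map (expand B) [seq (n, i) | i <- iota 0 (size (B n))]) =
  [seq (n, i) | i <- iota 0 (size (unfold (B n)))].
Proof.
have := expand_flatten n 0 (map mseq (B n)); rewrite size_map -map_comp.
move=> <-; congr flatten; apply: eq_map => i.
by apply: eq_map => r; rewrite /unfold /= map_take.
Qed.

Lemma size_expand B u As : map (block B) u = map mseq As ->
  size (flatten (map (expand B) u)) = size (unfold As).
Proof.
elim: u As => [|x u IH] [|A As] //= [eA eAs].
rewrite size_cat (IH As) // size_map size_iota eA.
by rewrite /= size_cat.
Qed.

Variable c : nat -> mcell2.
Let BI n := minputs (c n).
Let BO n := moutputs (c n).

Definition expand_link (l : port * port) : seq (port * port) :=
  zip (expand BO l.1) (expand BI l.2).

Definition expand_diagram (d : diagram) : diagram :=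
  Diagram (dcells d) (flatten (map expand_link (dlinks d)))
    (flatten (map (expand BI) (dins d))) (flatten (map (expand BO) (douts d))).

Lemma expand_zip u v : map (block BO) u = map (block BI) v ->
  zip (flatten (map (expand BO) u)) (flatten (map (expand BI) v)) =
  flatten (map expand_link (zip u v)).
Proof.
elim: u v => [|x u IH] [|y v] //= [exy euv].
by rewrite zip_cat ?IH // !size_map !size_iota exy.
Qed.

Lemma split_ports B u (As Bs Cs : seq mcell1) :
  map (block B) u = map mseq (As ++ Bs ++ Cs) ->
  exists u1 u2 u3, [/\ u = u1 ++ u2 ++ u3, map (block B) u1 = map mseq As,
    map (block B) u2 = map mseq Bs & map (block B) u3 = map mseq Cs].
Proof.
move=> e; exists (take (size As) u), (take (size Bs) (drop (size As) u)),
  (drop (size Bs) (drop (size As) u)).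
rewrite !cat_take_drop !map_take !map_drop e !map_cat -!(size_map mseq).
by rewrite take_size_cat // !drop_size_cat // take_size_cat.
Qed.

Lemma munder_evaluates d p : evaluates mmrg c d p ->
  [/\ map (block BI) (dins d) = map mseq (minputs p),
      map (block BO) (douts d) = map mseq (moutputs p) &
      evaluates (@mrg X) (munder \o c) (expand_diagram d) (munder p)].
Proof.
have cellE B n : map (block B) [seq (n, i) | i <- iota 0 (size (B n))] =
    map mseq (B n).
  rewrite -map_comp /block -[RHS](mkseq_nth [::]) size_map.
  exact: eq_map.
elim=> [n|{}d e t s D1 L D2 G1 G2 h _ [id od Hd] _ [ie oe He]].
  split; [exact: (cellE BI) | exact: (cellE BO) |].
  rewrite /expand_diagram /= (expand_cell BO) (expand_cell BI).
  rewrite /BO /BI minputsP moutputsP.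
  exact: (evaluates_cell (@mrg X) (munder \o c)).
have [ot is_ nL _ _] := h.
have := od; rewrite [moutputs t]ot => /split_ports[o1 [o2 [o3 [eo o1E o2E o3E]]]].
have := ie; rewrite [minputs s]is_ => /split_ports[i1 [i2 [i3 [ei i1E i2E i3E]]]].
have so1 : size o1 = size D1 by rewrite -(size_map (block BO)) o1E size_map.
have so2 : size o2 = size L by rewrite -(size_map (block BO)) o2E size_map.
have si1 : size i1 = size G1 by rewrite -(size_map (block BI)) i1E size_map.
have si2 : size i2 = size L by rewrite -(size_map (block BI)) i2E size_map.
have gd : glue_diagram (size D1) (size G1) (size L) d e =
    Diagram (dcells d ++ dcells e) (dlinks d ++ dlinks e ++ zip o2 i2)
      (i1 ++ dins d ++ i3) (o1 ++ douts e ++ o3).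
  rewrite /glue_diagram eo ei; congr Diagram.
  - rewrite !drop_size_cat // -{1}so2 -si2 !take_size_cat //.
  - by rewrite take_size_cat // addnC -drop_drop !drop_size_cat.
  - by rewrite take_size_cat // addnC -drop_drop !drop_size_cat.
rewrite gd /=; split.
- by rewrite !map_cat id i1E i3E.
- by rewrite !map_cat oe o1E o3E.
have := evaluates_merge (munder_mergeable h) Hd He.
congr evaluates; rewrite /glue_diagram /expand_diagram /= eo ei.
rewrite !map_cat !flatten_cat.
have zo1 := size_expand o1E; have zo2 := size_expand o2E.
have zi1 := size_expand i1E; have zi2 := size_expand i2E.
congr Diagram.
- rewrite !drop_size_cat // !take_size_cat // expand_zip //.
  by rewrite o2E i2E.
- by rewrite take_size_cat // addnC -drop_drop !drop_size_cat.
- by rewrite take_size_cat // addnC -drop_drop !drop_size_cat.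
Qed.

Lemma mseq_inj : injective mseq.
Proof.
move=> [a G cG] [b D cD] [] ea eG; subst b D.
by rewrite (proof_irrelevance _ cG cD).
Qed.

Lemma mmrg_coherence d e (p q : mcell2) :
  perm_eq (dcells d) [:: 0; 1; 2] -> same_diagram d e ->
  evaluates mmrg c d p -> evaluates mmrg c e q -> p = q.
Proof.
move=> d3 [cde lde ide ode].
move=> /munder_evaluates[id od Hd] /munder_evaluates[ie oe He].
apply: mcell2_eq.
- apply: mrg_coherence Hd He; first exact: d3.
  split=> //=; rewrite ?ide ?ode // => x.
  by apply/flatten_mapP/flatten_mapP => -[l lL xl]; exists l; rewrite // ?lde // -lde.
- by apply: (inj_map mseq_inj); rewrite -id -ie ide.
- by apply: (inj_map mseq_inj); rewrite -od -oe ode.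
Qed.
End Sequences.

Definition MM (X : merge_bicategory) : merge_bicategory :=
  @MergeBicategory (mpolygraph X) (@mmrg X)
    (fun _ _ _ _ _ _ _ _ => erefl) (fun _ _ _ _ _ _ _ _ => erefl)
    (@mmrg_coherence X).

Section Inclusion.
Variable X : merge_bicategory.

Definition zeta1 (a : cell1 X) : mcell1 X := @MCell1 X a [::] I.

Lemma unfold_zeta1 G : unfold (map zeta1 G) = G.
Proof. by elim: G => [|a G IH] //=; rewrite -{2}IH. Qed.

Definition zeta2 (p : cell2 X) : mcell2 X :=
  @MCell2 X p (map zeta1 (inputs p)) (map zeta1 (outputs p))
    (unfold_zeta1 (inputs p)) (unfold_zeta1 (outputs p)).

Lemma zeta_mrg D1 L D2 G1 G2 (t s r : cell2 X) : is_mrg D1 L D2 G1 G2 t s r ->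
  @is_mrg (MM X) (map zeta1 D1) (map zeta1 L) (map zeta1 D2)
    (map zeta1 G1) (map zeta1 G2) (zeta2 t) (zeta2 s) (zeta2 r).
Proof.
case=> h <-; have [ot is_ nL l r'] := h.
have h' : @mergeable (MM X) (map zeta1 D1) (map zeta1 L) (map zeta1 D2)
    (map zeta1 G1) (map zeta1 G2) (zeta2 t) (zeta2 s).
  split; rewrite /= ?ot ?is_ ?map_cat //.
  - by case: (L) nL.
  - by case: l => ->; [left | right].
  - by case: r' => ->; [left | right].
exists h'; apply: mcell2_eq => /=.
- move: (munder_mergeable h'); rewrite !unfold_zeta1 => h''.
  by rewrite (proof_irrelevance _ h'' h).
- by rewrite inputs_mrg !map_cat.
- by rewrite outputs_mrg !map_cat.
Qed.

Definition zeta : morphism X (MM X) :=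
  @Morphism X (MM X) id zeta1 zeta2 (fun=> erefl) (fun=> erefl)
    (fun=> erefl) (fun=> erefl) zeta_mrg.
End Inclusion.

(* Main.v *)
Require Import Defs.
From Stdlib Require Import ProofIrrelevance ClassicalEpsilon.
From mathcomp Require Import all_boot.

Set Implicit Arguments.
Unset Strict Implicit.
Unset Printing Implicit Defensive.

(** A merge-bicategory with units can be read as a strict 2-category without
    identity 1-cells, whose 1-cells are the non-empty composable sequences: two
    cells compose vertically by merging along a full boundary, a cell is whiskered
    by merging it with a unit, and conversely the merge of [t] and [s] is
    (G1 t G2) followed by (D1 s D2), a composite of whiskerings ([mrg_vcomp]).
    The axioms of a 2-category, interchange included, are instances of the
    coherence of three-cell diagrams.  All later arguments are calculations with
    [vcomp] and [whisk].

    In these terms universality becomes elementary.  A cell with one output is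
    universal there iff it is invertible ([universal_out_iso]), so tensors and
    pars are invertible cells (a, b) -> (c) and (c) -> (a, b).  A 1-cell [e] is
    tensor universal iff whiskering by [e] is bijective on cells, on both sides,
    and some 1-cells [u], [v] are related to [e] by invertible cells
    (e, u) -> (a), (e, a) -> (v), and symmetrically ([divisible]).  This
    condition is self-dual, so tensor and par universal 1-cells coincide, as do
    tensor and par units.

    A cell of [MM X] is a cell of [X] with both boundaries cut into pieces, and
    composition, whiskering and invertibility ignore the cuts ([under]).  Hence a
    unit of [X] on (A, B), with its input cut into A, B and its output left in
    one piece, is a tensor of A and B, and strict associativity is that of
    concatenation.  The inclusion preserves tensors and pars because it preserves
    invertible cells, and universal 1-cells because dividing a sequence by [e]
    amounts to dividing its first or last member.

    If [X] is representable, choose an invertible [tau A] from each sequence A to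
    an iterated tensor of its members.  Conjugation by these cells defines a
    strong morphism [collapse] from [MM X] to [X], which can be arranged to be a
    strict retraction of [zeta X].  The pseudo-natural equivalences have the
    chosen units [e] as components on 0-cells.  Their components on 1-cells come
    from invertible cells [swap] : (G, e) -> (e, G), natural in G and compatible
    with concatenation.  These exist because an invertible cell u : (e, e) -> (e)
    determines coherent unitors: whiskering by [e] being bijective, there is just
    one l : (e, G) -> (G) with (e l) = (u G) and one r : (G, e) -> (G) with
    (r e) = (G u).  Both are natural and invertible, because they are so after
    whiskering by [e], and the triangle identity follows from interchange. *)

(** * Coherence for three shapes of diagrams *)

Definition ports (n k m : nat) : seq port := [seq (n, i) | i <- iota k m].

Lemma size_ports n k m : size (ports n k m) = m.
Proof. by rewrite size_map size_iota. Qed.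

Lemma portsD n k a b : ports n k (a + b) = ports n k a ++ ports n (k + a) b.
Proof. by rewrite /ports iotaD map_cat. Qed.

Lemma cat_nested (T : Type) (k1 a b c k2 : seq T) :
  k1 ++ (a ++ b ++ c) ++ k2 = (k1 ++ a) ++ b ++ (c ++ k2).
Proof. by rewrite -!catA. Qed.

Section Coherence.
Variable X : merge_bicategory.
Implicit Types (t u v p q r : cell2 X).

Definition triple t u v (n : nat) : cell2 X :=
  if n is n'.+1 then if n' is 0 then u else v else t.

Lemma evaluates_ports c n :
  evaluates (@mrg X) c (Diagram [:: n] [::] (ports n 0 (size (inputs (c n))))
    (ports n 0 (size (outputs (c n))))) (c n).
Proof. exact: evaluates_cell. Qed.

(** The merged ports appear as explicit segments, so that no [take] or [drop]
    is left in the resulting diagram. *)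
Lemma evaluates_glue c D1 L D2 G1 G2 t s r d e o1 o2 o3 i1 i2 i3 :
  is_mrg D1 L D2 G1 G2 t s r ->
  evaluates (@mrg X) c d t -> evaluates (@mrg X) c e s ->
  douts d = o1 ++ o2 ++ o3 -> dins e = i1 ++ i2 ++ i3 ->
  [/\ size o1 = size D1, size o2 = size L, size i1 = size G1 &
      size i2 = size L] ->
  evaluates (@mrg X) c
    (Diagram (dcells d ++ dcells e) (dlinks d ++ dlinks e ++ zip o2 i2)
      (i1 ++ dins d ++ i3) (o1 ++ douts e ++ o3)) r.
Proof.
move=> [h <-] Ht Hs od ie [so1 so2 si1 si2].
have := evaluates_merge h Ht Hs; congr evaluates.
rewrite /glue_diagram od ie /=; congr Diagram.
- by rewrite !drop_size_cat // -{1}so2 -si2 !take_size_cat.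
- by rewrite take_size_cat // addnC -drop_drop !drop_size_cat.
- by rewrite take_size_cat // addnC -drop_drop !drop_size_cat.
Qed.

Lemma coherence_of_ports t u v d e p q :
  evaluates (@mrg X) (triple t u v) d p -> evaluates (@mrg X) (triple t u v) e q ->
  perm_eq (dcells d) [:: 0; 1; 2] -> perm_eq (dcells e) [:: 0; 1; 2] ->
  dins d = dins e -> douts d = douts e -> dlinks d =i dlinks e -> p = q.
Proof.
move=> Hp Hq d3 e3 ie oe le; apply: mrg_coherence Hp Hq => //; split=> //.
by apply: perm_trans d3 _; rewrite perm_sym.
Qed.

Ltac ports_of t u v Et Eu Ev :=
  have Et := evaluates_ports (triple t u v) 0;
  have Eu := evaluates_ports (triple t u v) 1;
  have Ev := evaluates_ports (triple t u v) 2;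
  rewrite /= in Et Eu Ev.

Ltac fill_sizes E := rewrite ?size_cat !size_ports /= in E;
  have {}E := E (And4 erefl erefl erefl erefl).

(* Once the links are split into matching segments, both sides are unions of the
   same segments in different orders. *)
Ltac same_links := let x := fresh in
  move=> x; rewrite ?zip_cat ?mem_cat ?in_nil ?orbF ?size_ports //;
  repeat match goal with |- context [x \in ?s] => case: (x \in s) => //= end;
  try done.

Let nilr (u : seq port) : u = u ++ [::] := esym (cats0 u).

(** Associativity of merges in which each cell is plugged whole into the next. *)
Lemma coherence_nested L G1 G2 M K1 K2 t u v tu uv r r' :
  outputs u = M ->
  is_mrg [::] L [::] G1 G2 t u tu -> is_mrg [::] M [::] K1 K2 tu v r ->
  is_mrg [::] M [::] K1 K2 u v uv ->
  is_mrg [::] L [::] (K1 ++ G1) (G2 ++ K2) t uv r' -> r = r'.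
Proof.
move=> ou H1 H2 H3 H4; have [[ot iu _ _ _] _] := H1.
have [[_ iv _ _ _] _] := H2.
ports_of t u v Et Eu Ev.
rewrite /= cats0 in ot.
rewrite ot iu ou iv !size_cat !portsD in Et Eu Ev.
have Etu := evaluates_glue (o1 := [::]) (o3 := [::]) H1 Et Eu (nilr _) erefl.
fill_sizes Etu.
have Er := evaluates_glue (o1 := [::]) (o3 := [::]) H2 Etu Ev erefl erefl.
fill_sizes Er.
have Euv := evaluates_glue (o1 := [::]) (o3 := [::]) H3 Eu Ev (nilr _) erefl.
fill_sizes Euv.
have Er' := evaluates_glue (o1 := [::]) (o3 := [::])
  H4 Et Euv (nilr _) (cat_nested _ _ _ _ _).
fill_sizes Er'.
apply: coherence_of_ports Er Er' _ _ _ _ _ => //=; rewrite ?cats0 -?catA //.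
same_links.
Qed.

(** Here [v] also receives the outputs [D1], [D2] of [t] that [u] leaves out.
    When [v] is a unit, this extends a merge to the full boundary of [t]. *)
Lemma coherence_triangle D1 L D2 G1 G2 M t u v tu uv r r' :
  outputs u = M ->
  is_mrg D1 L D2 G1 G2 t u tu ->
  is_mrg [::] (D1 ++ M ++ D2) [::] [::] [::] tu v r ->
  is_mrg [::] M [::] D1 D2 u v uv ->
  is_mrg [::] (D1 ++ L ++ D2) [::] G1 G2 t uv r' -> r = r'.
Proof.
move=> ou H1 H2 H3 H4; have [[ot iu _ l1 l2] _] := H1.
have [[_ iv _ _ _] _] := H3.
ports_of t u v Et Eu Ev.
rewrite ot iu ou iv !size_cat !portsD in Et Eu Ev.
have Etu := evaluates_glue H1 Et Eu erefl erefl.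
fill_sizes Etu.
have Er := evaluates_glue (o1 := [::]) (o3 := [::]) (i1 := [::]) (i3 := [::])
  H2 Etu Ev (nilr _) (nilr _).
fill_sizes Er.
have Euv := evaluates_glue (o1 := [::]) (o3 := [::]) H3 Eu Ev (nilr _) erefl.
fill_sizes Euv.
set d1 := ports 2 0 _ in Er Euv.
set l := ports 1 (_ + _) (size L) in Er Euv.
set d2 := ports 2 _ (size D2) in Er Euv.
set g1 := ports 1 _ (size G1) in Er Euv.
set g2 := ports 1 _ (size G2) in Er Euv.
have Er' := evaluates_glue (o1 := [::]) (o3 := [::]) (i1 := g1)
  (i2 := d1 ++ l ++ d2) (i3 := g2) H4 Et Euv (nilr _).
have e : d1 ++ (g1 ++ l ++ g2) ++ d2 = g1 ++ (d1 ++ l ++ d2) ++ g2.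
  rewrite /d1 /g1 /d2 /g2.
  by case: l1 l2 => -> [] -> /=; rewrite ?cats0 -?catA ?cats0.
rewrite /= ?size_cat !size_ports in Er'.
have {}Er' := Er' e (And4 erefl erefl erefl erefl).
apply: coherence_of_ports Er Er' _ _ _ _ _ => //=; rewrite ?cats0 -?catA //.
rewrite /d1 /d2 /l; same_links.
Qed.

(** Two cells plugged into disjoint inputs of a third: the source of the
    interchange law. *)
Lemma coherence_parallel D D' G G' p q v qv pv r r' :
  inputs p = G -> inputs q = G' ->
  is_mrg [::] D' [::] D [::] q v qv -> is_mrg [::] D [::] [::] G' p qv r ->
  is_mrg [::] D [::] [::] D' p v pv -> is_mrg [::] D' [::] G [::] q pv r' -> r = r'.
Proof.
move=> ip iq H1 H2 H3 H4; have [[oq iv _ _ _] _] := H1.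
have [[op _ _ _ _] _] := H2.
rewrite /= ?cats0 in oq op iv.
ports_of p q v Ep Ek Ev.
rewrite op oq ip iq iv !size_cat !portsD in Ep Ek Ev.
have Eqv := evaluates_glue (o1 := [::]) (o3 := [::]) (i3 := [::])
  H1 Ek Ev (nilr _) (congr1 _ (nilr _)).
fill_sizes Eqv.
have Epv := evaluates_glue (o1 := [::]) (o3 := [::]) (i1 := [::])
  H3 Ep Ev (nilr _) erefl.
fill_sizes Epv.
have Er := evaluates_glue (o1 := [::]) (o3 := [::]) (i1 := [::])
  H2 Ep Eqv (nilr _) erefl.
fill_sizes Er.
have Er' := evaluates_glue (o1 := [::]) (o3 := [::]) (i3 := [::])
  H4 Ek Epv (nilr _) (congr1 _ (nilr _)).
fill_sizes Er'.
apply: coherence_of_ports Er Er' _ _ _ _ _ => //=; rewrite ?cats0 -?catA //.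
same_links.
Qed.
End Coherence.

(** * Composable sequences *)

Section Composable.
Variable X : polygraph.
Implicit Types (G D K : seq (cell1 X)).

Lemma chain_catE (a b : cell1 X) G D :
  chain (@src X) (@tgt X) a (G ++ b :: D) <->
  [/\ chain (@src X) (@tgt X) a G, tgt (last a G) = src b &
      chain (@src X) (@tgt X) b D].
Proof.
elim: G a => [|c G IH] a /=; first by split=> [[]|[]].
by split=> [[? /IH[]]|[[? ?] ? ?]]; split=> //; apply/IH.
Qed.

Lemma composable_catE G D : composable (G ++ D) <->
  [/\ composable G, composable D &
    forall a b, G = a.1 :: a.2 -> D = b.1 :: b.2 -> tgt (last a.1 a.2) = src b.1].
Proof.
case: G D => [|a G] [|b D]; rewrite ?cats0 /=.
- by split.
- by split=> [?|[]] //; split.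
- by split=> [?|[]] //; split.
rewrite chain_catE; split=> [[? ? ?]|[? ? H]]; split=> //.
  by move=> [? ?] [? ?] /= [<- <-] [<- _].
exact: (H (a, G) (b, D)).
Qed.

Lemma composable_catl G D : composable (G ++ D) -> composable G.
Proof. by case/composable_catE. Qed.

Lemma composable_catr G D : composable (G ++ D) -> composable D.
Proof. by case/composable_catE. Qed.

Lemma composable_glue G D K : D <> [::] ->
  composable (G ++ D) -> composable (D ++ K) -> composable (G ++ D ++ K).
Proof.
case: D => // d D _ /composable_catE[cG _ HGD] cDK; apply/composable_catE; split=> //.
by move=> a [b1 b2] eG [<- _]; apply: (HGD a (d, D)).
Qed.

Lemma parallel_sym G D : parallel (@src X) (@tgt X) G D ->
  parallel (@src X) (@tgt X) D G.
Proof. by case: G D => [|a G] [|b D] //= []. Qed.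

Lemma composable_parallel K1 G D K2 : parallel (@src X) (@tgt X) G D ->
  composable (K1 ++ G ++ K2) -> composable (K1 ++ D ++ K2).
Proof.
case: G D => [|a G] [|b D] // [cG cD sG tG].
case/composable_catE => [cK1 /composable_catE[_ cK2 HK2] HK1].
apply/composable_catE; split=> //.
  apply/composable_catE; split=> // -[x1 x2] y [<- <-] eK2.
  by rewrite /= -tG; apply: (HK2 (a, G) y).
move=> x [y Y] eK1 [<- _]; rewrite /= -sG.
exact: (HK1 x (a, G ++ K2)).
Qed.

Lemma boundary_ne (p : cell2 X) : inputs p <> [::] /\ outputs p <> [::].
Proof. by have := boundary p; case: (inputs p) (outputs p) => [|a G] [|b D]. Qed.

Lemma composable_inputs (p : cell2 X) : composable (inputs p).
Proof.
by have := boundary p; case: (inputs p) (outputs p) => [|a G] [|b D] //= [].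
Qed.

Lemma composable_outputs (p : cell2 X) : composable (outputs p).
Proof.
by have := boundary p; case: (inputs p) (outputs p) => [|a G] [|b D] //= [].
Qed.

End Composable.

(** * Vertical composition and whiskering *)

Section ExtendedCells.
Variable X : merge_bicategory.
Implicit Types (G D K : seq (cell1 X)) (r s t u v : cell2 X).

(** 2-cells completed by an identity [Empty] on the empty sequence and an error
    value [Undef].  The first spares a case distinction on empty contexts; the
    second makes the operations total, so that most laws need no typing
    hypothesis. *)
Inductive xcell : Type := Undef | Empty | Cell of cell2 X.
Implicit Types (p q w : xcell).

Definition the (P : cell2 X -> Prop) : xcell :=
  if excluded_middle_informative (exists r, P r) is left h
  then Cell (proj1_sig (constructive_indefinite_description P h)) else Undef.

Definition idc G : xcell := if G is [::] then Empty else the (is_unit G).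

Definition vcomp p q : xcell :=
  match p, q with
  | Cell t, Cell s => the (is_mrg [::] (outputs t) [::] [::] [::] t s)
  | Empty, Empty => Empty
  | _, _ => Undef
  end.

(** In the absence of identity 1-cells, the whiskering of [t] is its merge into
    the unit on the whiskered output. *)
Definition whisk K1 p K2 : xcell :=
  match p with
  | Cell t => if idc (K1 ++ outputs t ++ K2) is Cell u
              then the (is_mrg [::] (outputs t) [::] K1 K2 t u) else Undef
  | Empty => idc (K1 ++ K2)
  | Undef => Undef
  end.

Definition mor p G D : Prop :=
  match p with
  | Cell t => inputs t = G /\ outputs t = D
  | Empty => G = [::] /\ D = [::]
  | Undef => False
  end.

Lemma the_eq (P : cell2 X -> Prop) t : P t -> (forall s, P s -> s = t) ->
  the P = Cell t.
Proof.
rewrite /the => Pt uP; case: excluded_middle_informative => [h|[]]; last by exists t.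
by case: constructive_indefinite_description => s Ps /=; rewrite (uP s Ps).
Qed.

Lemma the_undef (P : cell2 X -> Prop) : (forall t, ~ P t) -> the P = Undef.
Proof.
rewrite /the => nP; case: excluded_middle_informative => // h.
by exfalso; case: h => t; exact: nP.
Qed.

Lemma is_mrg_uniq D1 L D2 G1 G2 t s r r' :
  is_mrg D1 L D2 G1 G2 t s r -> is_mrg D1 L D2 G1 G2 t s r' -> r = r'.
Proof. by move=> [h <-] [h' <-]; rewrite (proof_irrelevance _ h h'). Qed.

Lemma the_mrg D1 L D2 G1 G2 t s r :
  is_mrg D1 L D2 G1 G2 t s r -> the (is_mrg D1 L D2 G1 G2 t s) = Cell r.
Proof. by move=> H; apply: the_eq => // r' /is_mrg_uniq; apply. Qed.

Lemma is_unit_uniq G t s : is_unit G t -> is_unit G s -> t = s.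
Proof.
move=> [it ot mt _] [is_ os _ ms].
have H1 := mt s [::] [::]; rewrite /= cats0 in H1.
have H2 := ms t [::] [::]; rewrite /= cats0 in H2.
exact: is_mrg_uniq (H2 it) (H1 os).
Qed.

Lemma idc_unit G u : is_unit G u -> idc G = Cell u.
Proof.
move=> Hu; case: G Hu => [|a G] Hu.
  by case: Hu => /(proj1 (boundary_ne u)).
by apply: the_eq => // s /is_unit_uniq; apply.
Qed.

Hypothesis hX : unital X.

Lemma idcP G : G <> [::] -> composable G -> exists2 u, is_unit G u & idc G = Cell u.
Proof.
case: G => // a G ne /(hX ne)[u Hu]; exists u => //.
exact: idc_unit.
Qed.

Lemma idc_undef G : ~ composable G -> idc G = Undef.
Proof.
case: G => [[]//|a G] nG /=; apply: the_undef => t [it _ _ _]; apply: nG.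
by rewrite -it; apply: composable_inputs.
Qed.

Lemma mor_idc G : composable G -> mor (idc G) G G.
Proof. by case: G => // a G cG; have [//|u [? ? _ _] ->] := @idcP (a :: G) _ cG. Qed.

Lemma vcompP s t : outputs s = inputs t ->
  exists2 r, is_mrg [::] (outputs s) [::] [::] [::] s t r &
    vcomp (Cell s) (Cell t) = Cell r.
Proof.
move=> e; have h : mergeable [::] (outputs s) [::] [::] [::] s t.
  by split; rewrite ?cats0 //; [case: (boundary_ne s) | left | left].
have H : is_mrg [::] (outputs s) [::] [::] [::] s t (mrg h) by exists h.
by exists (mrg h) => //; apply: the_mrg.
Qed.

Lemma vcomp_undef s t : outputs s <> inputs t -> vcomp (Cell s) (Cell t) = Undef.
Proof.
by move=> ne; apply: the_undef => r [[_ is_ _ _ _] _]; case: ne; rewrite is_ cats0.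
Qed.

Lemma composable_io t K1 K2 :
  composable (K1 ++ inputs t ++ K2) <-> composable (K1 ++ outputs t ++ K2).
Proof.
by split; apply: composable_parallel; rewrite ?[X in X _ _]/parallel;
   [exact: boundary | apply: parallel_sym; exact: boundary].
Qed.

Lemma cat_ne K1 G K2 : G <> [::] -> K1 ++ G ++ K2 <> [::].
Proof. by case: K1 => //; case: G. Qed.

Lemma whiskP K1 t K2 : composable (K1 ++ inputs t ++ K2) -> exists u r,
  [/\ is_unit (K1 ++ outputs t ++ K2) u, is_mrg [::] (outputs t) [::] K1 K2 t u r &
      whisk K1 (Cell t) K2 = Cell r].
Proof.
move/composable_io => cK; have [_ ne] := boundary_ne t.
have [u Hu uE] := idcP (cat_ne (K1 := K1) (K2 := K2) ne) cK.
have h : mergeable [::] (outputs t) [::] K1 K2 t u.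
  by case: Hu => iu _ _ _; split; rewrite ?cats0 //; right.
have H : is_mrg [::] (outputs t) [::] K1 K2 t u (mrg h) by exists h.
by exists u, (mrg h); split=> //=; rewrite uE; apply: the_mrg.
Qed.

Lemma whisk_undef K1 t K2 : ~ composable (K1 ++ inputs t ++ K2) ->
  whisk K1 (Cell t) K2 = Undef.
Proof. by move=> nK /=; rewrite idc_undef // -composable_io. Qed.

Lemma is_mrg_boundary D1 L D2 G1 G2 t s r : is_mrg D1 L D2 G1 G2 t s r ->
  inputs r = G1 ++ inputs t ++ G2 /\ outputs r = D1 ++ outputs s ++ D2.
Proof. by case=> h <-; rewrite inputs_mrg outputs_mrg. Qed.

Lemma mor_vcomp p q G D E : mor p G D -> mor q D E -> mor (vcomp p q) G E.
Proof.
case: p q => [||t] [||s] //=.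
- by move=> [-> ->] [_ ->].
- by move=> [_ ->] [/(proj1 (boundary_ne s))].
- by move=> [_ <-] [/(proj2 (boundary_ne t))].
move=> [it ot] [is_ os].
have [|r /is_mrg_boundary[ir or] rE] := @vcompP t s; first by rewrite ot.
by move: rE; rewrite /= => ->; rewrite /= ir or /= !cats0.
Qed.

Lemma mor_whisk K1 p K2 G D G' D' : mor p G D -> composable G' ->
  G' = K1 ++ G ++ K2 -> D' = K1 ++ D ++ K2 -> mor (whisk K1 p K2) G' D'.
Proof.
move=> Hp cG' eG' eD'; subst; case: p Hp cG' => [[]|[-> ->]|t [<- <-]] // cG'.
  exact: mor_idc.
have [u [r [[_ ou _ _] /is_mrg_boundary[ir or] ->]]] := whiskP cG'.
by rewrite /= ir or ou /= cats0.
Qed.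

Lemma vcomp_idl p G D : mor p G D -> vcomp (idc G) p = p.
Proof.
case: p => [[]|[-> _]|t [<- _]] //.
have [u [_ ou _ H] ->] := idcP (proj1 (boundary_ne t)) (composable_inputs t).
by apply: the_mrg; rewrite ou; apply: H; rewrite cats0.
Qed.

Lemma vcomp_idr p G D : mor p G D -> vcomp p (idc D) = p.
Proof.
case: p => [[]|[_ ->]|t [_ <-]] //.
have [u [_ _ H _] ->] := idcP (proj2 (boundary_ne t)) (composable_outputs t).
by apply: the_mrg; apply: H; rewrite cats0.
Qed.

(** Inserting the unit on the inputs of [s] between [t] and [s] turns a merge
    along part of these inputs into a vertical composition. *)
Lemma vcomp_whisk_mrg G K1 K2 t s r : is_mrg [::] G [::] K1 K2 t s r ->
  vcomp (whisk K1 (Cell t) K2) (Cell s) = Cell r.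
Proof.
move=> H; have [[ot is_ _ _ _] _] := H; rewrite cats0 in ot.
have cK : composable (K1 ++ inputs t ++ K2).
  by rewrite composable_io ot -is_; apply: composable_inputs.
have [u [tu [Hu Htu ->]]] := whiskP cK.
have [iu ou _ Hu'] := Hu; rewrite ot in Htu iu ou Hu'.
have [_ otu] := is_mrg_boundary Htu; rewrite /= cats0 ou -is_ in otu.
have [r' Hr' ->] := vcompP otu; congr Cell.
rewrite otu is_ in Hr'.
apply: (coherence_nested (K1 := [::]) (K2 := [::]) ou Htu Hr' (Hu' s [::] [::] _)).
  by rewrite /= cats0.
by rewrite /= cats0.
Qed.

(** Composing with the unit on the outputs of the merge does not change it; by
    [coherence_triangle] this unit can be absorbed by [s], which becomes its
    whiskering by [D1] and [D2] and receives all the outputs of [t]. *)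
Lemma mrg_vcomp D1 L D2 G1 G2 t s r : is_mrg D1 L D2 G1 G2 t s r ->
  vcomp (whisk G1 (Cell t) G2) (whisk D1 (Cell s) D2) = Cell r.
Proof.
move=> H; have [[ot is_ neL l1 l2] _] := H.
have [ir or] := is_mrg_boundary H.
have e : D1 ++ inputs s ++ D2 = G1 ++ outputs t ++ G2.
  by rewrite ot is_; case: l1 l2 => -> [] ->; rewrite /= ?cats0 -?catA ?cats0.
have cK : composable (D1 ++ inputs s ++ D2).
  by rewrite e -composable_io -ir; apply: composable_inputs.
have [u [sw [Hu Hsw ->]]] := whiskP cK.
have [isw osw] := is_mrg_boundary Hsw.
have h : mergeable [::] (D1 ++ L ++ D2) [::] G1 G2 t sw.
  by split; rewrite ?cats0 ?isw ?e ?ot //; [exact: cat_ne | right | right].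
have H4 : is_mrg [::] (D1 ++ L ++ D2) [::] G1 G2 t sw (mrg h) by exists h.
rewrite (vcomp_whisk_mrg H4); congr Cell; apply/esym.
case: Hu => iu _ Hu _; apply: (coherence_triangle erefl H _ Hsw H4).
by apply: Hu; rewrite /= cats0.
Qed.

Lemma mrg_vcompE D1 L D2 G1 G2 t s r : mergeable D1 L D2 G1 G2 t s ->
  is_mrg D1 L D2 G1 G2 t s r <->
  vcomp (whisk G1 (Cell t) G2) (whisk D1 (Cell s) D2) = Cell r.
Proof.
move=> h; split=> [/mrg_vcomp //|].
have H : is_mrg D1 L D2 G1 G2 t s (mrg h) by exists h.
by rewrite (mrg_vcomp H) => -[<-].
Qed.

(** * The laws of a strict 2-category *)

Lemma whisk_empty K1 K2 : whisk K1 Empty K2 = idc (K1 ++ K2). Proof. by []. Qed.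

Lemma vcomp_undef_r p : vcomp p Undef = Undef. Proof. by case: p. Qed.

Lemma xcellP p : p = Undef \/ exists G D, mor p G D.
Proof.
case: p => [||t]; [by left| |] ; right; first by exists [::], [::].
by exists (inputs t), (outputs t).
Qed.

Lemma vcomp_mismatch p q G D D' E : mor p G D -> mor q D' E -> D <> D' ->
  vcomp p q = Undef.
Proof.
case: p q => [||t] [||s] //=; first by move=> [_ ->] [->].
by move=> [_ <-] [<- _] /vcomp_undef.
Qed.

Lemma whisk_misfit K1 p K2 G D : mor p G D -> ~ composable (K1 ++ G ++ K2) ->
  whisk K1 p K2 = Undef.
Proof.
case: p => [[]|[-> _] nK|t [<- _]]; last exact: whisk_undef.
exact: (@idc_undef (K1 ++ K2)).
Qed.

(** When some boundary does not match, both sides are [Undef]. *)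
Lemma vcompA p q w : vcomp p (vcomp q w) = vcomp (vcomp p q) w.
Proof.
have [->//|[G [D Hp]]] := xcellP p.
have [->|[D' [E Hq]]] := xcellP q; first by rewrite vcomp_undef_r.
have [->|[E' [F Hw]]] := xcellP w; first by rewrite !vcomp_undef_r.
have [eD|nD] := classic (D = D'); last first.
  rewrite (vcomp_mismatch Hp Hq nD) /=.
  have [eE|nE] := classic (E = E').
    by subst E'; apply: vcomp_mismatch Hp (mor_vcomp Hq Hw) nD.
  by rewrite (vcomp_mismatch Hq Hw nE) vcomp_undef_r.
subst D'; have [eE|nE] := classic (E = E'); last first.
  rewrite (vcomp_mismatch Hq Hw nE) vcomp_undef_r.
  by rewrite (vcomp_mismatch (mor_vcomp Hp Hq) Hw nE).
subst E'.
case: p q w Hp Hq Hw => [||t] [||u] [||v] //=.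
- by move=> [_ ->] [/(proj1 (boundary_ne u))].
- by move=> _ [_ <-] [/(proj2 (boundary_ne u))].
move=> [_ ot] [iu ou] [iv _]; rewrite -!/(vcomp (Cell _) (Cell _)).
have [|r Hr rE] := @vcompP t u; first by rewrite ot iu.
have [|r' Hr' rE'] := @vcompP u v; first by rewrite ou iv.
have [_ or] := is_mrg_boundary Hr; have [ir' _] := is_mrg_boundary Hr'.
rewrite /= cats0 in or; rewrite /= cats0 in ir'.
have [|l Hl lE] := @vcompP t r'; first by rewrite ot ir' iu.
have [|l' Hl' lE'] := @vcompP r v; first by rewrite or ou iv.
move: rE rE' lE lE'; rewrite /= => -> -> /= -> ->; congr Cell; apply/esym.
rewrite or in Hl'.
exact: (coherence_nested (K1 := [::]) (K2 := [::]) erefl Hr Hl' Hr' Hl).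
Qed.

Lemma cat_inj K1 G D K2 : K1 ++ G ++ K2 = K1 ++ D ++ K2 -> G = D.
Proof.
elim: K1 => [|k K1 IH] /=; last by case=> /IH.
elim: G D => [|a G IH] [|b D] //=; last by case=> -> /IH ->.
  by move/(congr1 size)/eqP; rewrite /= size_cat -addSn -{1}[size K2]add0n eqn_add2r.
by move/(congr1 size)/eqP; rewrite /= size_cat -addSn -{2}[size K2]add0n eqn_add2r.
Qed.

Lemma whisk_mor K1 p K2 G D : mor p G D -> composable (K1 ++ G ++ K2) ->
  mor (whisk K1 p K2) (K1 ++ G ++ K2) (K1 ++ D ++ K2).
Proof. by move=> Hp cG; apply: mor_whisk Hp cG _ _. Qed.

Lemma composable_mor K1 p K2 G D : mor p G D ->
  composable (K1 ++ G ++ K2) <-> composable (K1 ++ D ++ K2).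
Proof. by case: p => [[]|[-> ->]|t [<- <-]] //; apply: composable_io. Qed.

Lemma whisk_vcomp K1 p q K2 :
  whisk K1 (vcomp p q) K2 = vcomp (whisk K1 p K2) (whisk K1 q K2).
Proof.
have [->//|[G [D Hp]]] := xcellP p.
have [->|[D' [E Hq]]] := xcellP q; first by rewrite !vcomp_undef_r.
have [cG|nG] := classic (composable (K1 ++ G ++ K2)); last first.
  rewrite (whisk_misfit Hp nG) /=.
  have [eD|nD] := classic (D = D'); last by rewrite (vcomp_mismatch Hp Hq nD).
  by subst D'; rewrite (whisk_misfit (mor_vcomp Hp Hq) nG).
have [eD|nD] := classic (D = D'); last first.
  rewrite (vcomp_mismatch Hp Hq nD).
  have [cD|nD'] := classic (composable (K1 ++ D' ++ K2)).
    by rewrite (vcomp_mismatch (whisk_mor Hp cG) (whisk_mor Hq cD)) // => /cat_inj.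
  by rewrite (whisk_misfit Hq nD') vcomp_undef_r.
subst D'; case: p q Hp Hq => [||t] [||s] //.
- move=> [eG _] _; rewrite {1}/vcomp /whisk.
  by rewrite (vcomp_idl (G := K1 ++ K2) (mor_idc _)) //; rewrite eG in cG.
- by move=> [_ ->] [/(proj1 (boundary_ne s))].
- by move=> [_ <-] [/(proj2 (boundary_ne t))].
move=> [it ot] [is_ _].
have [|r Hr ->] := @vcompP t s; first by rewrite ot is_.
have [_ or] := is_mrg_boundary Hr; rewrite /= cats0 in or.
have [ir _] := is_mrg_boundary Hr; rewrite /= cats0 in ir.
have [|u [w [Hu Hw ->]]] := @whiskP K1 r K2; first by rewrite ir it.
have [|u' [w' [Hu' Hw' ->]]] := @whiskP K1 s K2;
  first by rewrite is_ -(composable_mor K1 K2 (p := Cell t) (conj it ot)).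
rewrite or in Hu Hw; have eu := is_unit_uniq Hu Hu'; subst u'.
have [iw' _] := is_mrg_boundary Hw'.
have h : mergeable [::] (outputs t) [::] K1 K2 t w'.
  by split; rewrite ?cats0 ?iw' ?ot ?is_ //; [rewrite -ot;
    case: (boundary_ne t) | right | right].
have H : is_mrg [::] (outputs t) [::] K1 K2 t w' (mrg h) by exists h.
rewrite (vcomp_whisk_mrg H); congr Cell.
apply: (coherence_nested erefl Hr Hw Hw'); rewrite cats0; exact: H.
Qed.

Lemma whisk_idc K1 G K2 : whisk K1 (idc G) K2 = idc (K1 ++ G ++ K2).
Proof.
have [cG|nG] := classic (composable (K1 ++ G ++ K2)); last first.
  have [cG|nG'] := classic (composable G).
    by rewrite (whisk_misfit (mor_idc cG) nG) idc_undef.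
  by rewrite !idc_undef.
have [->//|neG] : G = [::] \/ G <> [::] by case: (G) => [|? ?]; [left|right].
have [u Hu ->] := idcP neG (composable_catl (composable_catr cG)).
have [v Hv vE] := idcP (cat_ne (K1 := K1) (K2 := K2) neG) cG.
have [iu ou _ mu] := Hu; rewrite vE /= ou vE.
by apply: the_mrg; apply: mu; case: Hv.
Qed.

Lemma whisk_nil p : whisk [::] p [::] = p.
Proof.
case: p => [||t] //=; rewrite cats0.
have [u Hu ->] := idcP (proj2 (boundary_ne t)) (composable_outputs t).
by apply: the_mrg; case: Hu => _ _ H _; apply: H; rewrite cats0.
Qed.

Lemma whisk_whisk K1 G1 p G2 K2 :
  whisk K1 (whisk G1 p G2) K2 = whisk (K1 ++ G1) p (G2 ++ K2).
Proof.
have [->//|[G [D Hp]]] := xcellP p.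
have eG A : K1 ++ (G1 ++ A ++ G2) ++ K2 = (K1 ++ G1) ++ A ++ (G2 ++ K2).
  by rewrite -!catA.
have [cG|nG] := classic (composable (G1 ++ G ++ G2)); last first.
  rewrite (whisk_misfit Hp nG) (whisk_misfit Hp) // -eG => H; apply: nG.
  exact: composable_catl (composable_catr H).
have [cG'|nG] := classic (composable (K1 ++ (G1 ++ G ++ G2) ++ K2)); last first.
  by rewrite (whisk_misfit (whisk_mor Hp cG) nG) (whisk_misfit Hp) // -eG.
case: p Hp => [//|_|t [it ot]].
  by rewrite /= whisk_idc -!catA.
rewrite -it in cG cG'.
have [u [r [Hu Hr rE]]] := whiskP cG; rewrite rE.
have [ir or] := is_mrg_boundary Hr.
have [|v [w [Hv Hw ->]]] := @whiskP K1 r K2; first by rewrite ir.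
have [|v' [w' [Hv' Hw' ->]]] := @whiskP (K1 ++ G1) t (G2 ++ K2); first by rewrite -eG.
congr Cell; have [iu ou _ mu] := Hu; rewrite /= cats0 in or.
have ev : v = v'.
  by apply: is_unit_uniq Hv _; rewrite or ou eG.
subst v'; rewrite or in Hw.
apply: coherence_nested erefl Hr Hw _ Hw'.
by rewrite ou; apply: mu; rewrite -ou -or; case: Hv.
Qed.

(** Both sides are the merge of [p] and [q] into the unit on (D, D'). *)
Lemma interchange p q G D G' D' : mor p G D -> mor q G' D' ->
  vcomp (whisk [::] p G') (whisk D q [::]) = vcomp (whisk G q [::]) (whisk [::] p D').
Proof.
case: p => [//|[-> ->]|t].
  by move=> Hq; rewrite !whisk_nil /= (vcomp_idl Hq) (vcomp_idr Hq).
move=> Hp; have [it ot] := Hp; case: q => [//|[-> ->]|s [is_ os]].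
  by rewrite !whisk_empty !cats0 !whisk_nil (vcomp_idl Hp) (vcomp_idr Hp).
have eC : composable (G ++ G') <-> composable (D ++ D').
  rewrite -it -ot -is_ -os; rewrite (composable_io t [::] (inputs s)).
  by have := composable_io s (outputs t) [::]; rewrite !cats0.
have eC' : composable (G ++ G') <-> composable (D ++ G').
  by rewrite -it -ot; apply: (composable_io t [::] G').
have eC'' : composable (G ++ G') <-> composable (G ++ D').
  by rewrite -is_ -os; have := composable_io s G [::]; rewrite !cats0.
have [cG|nG] := classic (composable (G ++ G')); last first.
  rewrite [whisk [::] _ _]whisk_undef ?it //; rewrite [whisk G _ _]whisk_undef //
    ?is_ ?cats0 //.
have [|u [qv [Hu Hqv ->]]] := @whiskP D s [::]; first by rewrite is_ cats0 -eC'.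
have [|u' [pv [Hu' Hpv ->]]] := @whiskP [::] t D'; first by rewrite it -eC''.
have [iqv oqv] := is_mrg_boundary Hqv; have [ipv opv] := is_mrg_boundary Hpv.
have eu : u = u'.
  by apply: is_unit_uniq Hu _; rewrite os cats0 -ot.
subst u'.
have h : mergeable [::] D [::] [::] G' t qv.
  split; rewrite ?cats0 ?iqv ?is_ ?cats0 //; [|by left | by right].
  by rewrite -ot; case: (boundary_ne t).
have h' : mergeable [::] D' [::] G [::] s pv.
  split; rewrite ?cats0 ?ipv ?it ?cats0 //; [|by right | by left].
  by rewrite -os; case: (boundary_ne s).
have H : is_mrg [::] D [::] [::] G' t qv (mrg h) by exists h.
have H' : is_mrg [::] D' [::] G [::] s pv (mrg h') by exists h'.
rewrite (vcomp_whisk_mrg H) (vcomp_whisk_mrg H'); congr Cell.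
rewrite ot in Hpv; rewrite os in Hqv.
exact: (coherence_parallel it is_ Hqv H Hpv H').
Qed.
End ExtendedCells.

Arguments Undef {X}.
Arguments Empty {X}.

(** * Invertible cells and universality *)

Section Universal.
Variable X : merge_bicategory.
Hypothesis hX : unital X.
Implicit Types (G D K E : seq (cell1 X)) (p q w : xcell X) (r s t u v : cell2 X).

Lemma mor_cell p G D : mor p G D -> G <> [::] -> exists t, p = Cell t.
Proof. by case: p => [||t] //; [case | exists t]. Qed.

Lemma mor_composable p G D : mor p G D -> composable G.
Proof. by case: p => [[]|[-> _]|t [<- _]] //; apply: composable_inputs. Qed.

Lemma mor_sym_composable p G D : mor p G D -> composable D.
Proof. by case: p => [[]|[_ ->]|t [_ <-]] //; apply: composable_outputs. Qed.

Lemma mor_ne p G D : mor p G D -> G <> [::] <-> D <> [::].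
Proof.
by case: p => [[]|[-> ->]|t [<- <-]] //; have [? ?] := boundary_ne t.
Qed.

Definition inverse p q G D : Prop :=
  [/\ mor p G D, mor q D G, vcomp p q = idc G & vcomp q p = idc D].

Lemma inverse_sym p q G D : inverse p q G D -> inverse q p D G.
Proof. by case. Qed.

Lemma inverse_vcomp p p' q q' G D E : inverse p p' G D -> inverse q q' D E ->
  inverse (vcomp p q) (vcomp q' p') G E.
Proof.
move=> [Hp Hp' pp' p'p] [Hq Hq' qq' q'q]; split.
- exact: mor_vcomp Hp Hq.
- exact: mor_vcomp Hq' Hp'.
- by rewrite -vcompA // [vcomp q _]vcompA // qq' (vcomp_idl hX Hp').
- by rewrite -vcompA // [vcomp p' _]vcompA // p'p (vcomp_idl hX Hq).
Qed.

Lemma inverse_whisk p p' G D K1 K2 : inverse p p' G D ->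
  composable (K1 ++ G ++ K2) ->
  inverse (whisk K1 p K2) (whisk K1 p' K2) (K1 ++ G ++ K2) (K1 ++ D ++ K2).
Proof.
move=> [Hp Hp' pp' p'p] cG; have cD : composable (K1 ++ D ++ K2).
  by rewrite -(composable_mor K1 K2 Hp).
split.
- exact: whisk_mor.
- exact: whisk_mor.
- by rewrite -whisk_vcomp // pp' whisk_idc.
- by rewrite -whisk_vcomp // p'p whisk_idc.
Qed.

Lemma inverse_idc G : composable G -> inverse (idc G) (idc G) G G.
Proof.
by move=> cG; have H := mor_idc hX cG; split; rewrite // (vcomp_idl hX H).
Qed.

Lemma vcomp_invl p p' q G D E : inverse p p' G D -> mor q D E ->
  vcomp p' (vcomp p q) = q.
Proof. by move=> [_ _ _ e] Hq; rewrite vcompA // e (vcomp_idl hX Hq). Qed.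

Lemma vcomp_invr p p' q G D E : inverse p p' G D -> mor q E G ->
  vcomp (vcomp q p) p' = q.
Proof. by move=> [_ _ e _] Hq; rewrite -vcompA // e (vcomp_idr hX Hq). Qed.

Definition isomorphic G D : Prop := exists p q, inverse p q G D.

Lemma isomorphic_sym G D : isomorphic G D -> isomorphic D G.
Proof. by move=> [p [q /inverse_sym H]]; exists q, p. Qed.

Lemma isomorphic_trans G D E : isomorphic G D -> isomorphic D E -> isomorphic G E.
Proof.
move=> [p [p' H]] [q [q' H']]; exists (vcomp p q), (vcomp q' p').
exact: inverse_vcomp H H'.
Qed.

Lemma isomorphic_whisk G D K1 K2 : isomorphic G D -> composable (K1 ++ G ++ K2) ->
  isomorphic (K1 ++ G ++ K2) (K1 ++ D ++ K2).
Proof.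
by move=> [p [q H]] cG; exists (whisk K1 p K2), (whisk K1 q K2); apply: inverse_whisk.
Qed.

Lemma dual_is_mrg D1 L D2 G1 G2 t s r :
  @is_mrg (dual X) D1 L D2 G1 G2 t s r <-> @is_mrg X G1 L G2 D1 D2 s t r.
Proof.
split=> [[h <-]|[h <-]]; first by exists (dual_mergeable h).
have h' : @mergeable (dual X) D1 L D2 G1 G2 t s.
  by case: h => ot is_ neL [] l1 [] l2; split=> //; by [left | right].
by exists h'; rewrite /= /dual_mrg (proof_irrelevance _ (dual_mergeable h') h).
Qed.

Lemma ex_unique_cell (P : cell2 X -> Prop) (Q : xcell X -> Prop) :
  (forall r, P r <-> Q (Cell r)) -> (forall p, Q p -> exists r, p = Cell r) ->
  (exists! r, P r) <-> (exists! p, Q p).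
Proof.
move=> PQ Qc; split=> [[r [/PQ Hr ur]]|[p [Hp up]]].
  exists (Cell r); split=> // p Qp; have [s ep] := Qc p Qp; subst p.
  by rewrite (ur s) //; apply/PQ.
have [r er] := Qc p Hp; subst p; exists r; split; first exact/PQ.
by move=> s /PQ /up[].
Qed.

(** The merge of the definition is spelled out as a composite of whiskerings. *)
Lemma universal_outE t D1 a D2 : universal_out t D1 a D2 <->
  outputs t = D1 ++ a :: D2 /\
  forall G1 G2 D p, D <> [::] ->
    G1 = [::] \/ D1 = [::] -> G2 = [::] \/ D2 = [::] ->
    mor p (G1 ++ inputs t ++ G2) (D1 ++ D ++ D2) ->
    exists! q, mor q (G1 ++ a :: G2) D /\
               vcomp (whisk G1 (Cell t) G2) (whisk D1 q D2) = p.
Proof.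
split=> -[ot H]; split=> // G1 G2 D.
  move=> p neD l1 l2 Hp; have [|s es] := mor_cell Hp.
    by apply: cat_ne; case: (boundary_ne t).
  subst p; case: Hp => is_ os.
  apply/(ex_unique_cell (P := fun r => [/\ inputs r = G1 ++ a :: G2, outputs r = D &
    is_mrg D1 [:: a] D2 G1 G2 t r s])).
  - move=> r; split=> [[ir or /(mrg_vcomp hX)]|[[ir or] e]] //; split=> //.
    by apply/mrg_vcompE => //; split.
  - by move=> q [Hq _]; apply: mor_cell Hq _; case: (G1).
  exact: H.
move=> s neD l1 l2 is_ os.
apply/(ex_unique_cell (Q := fun q => mor q (G1 ++ a :: G2) D /\
               vcomp (whisk G1 (Cell t) G2) (whisk D1 q D2) = Cell s)).
- move=> r; split=> [[ir or /(mrg_vcomp hX)]|[[ir or] e]] //; split=> //.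
  by apply/mrg_vcompE => //; split.
- by move=> q [Hq _]; apply: mor_cell Hq _; case: (G1).
exact: H.
Qed.

Lemma universal_inE t D1 a D2 : universal_in t D1 a D2 <->
  inputs t = D1 ++ a :: D2 /\
  forall G1 G2 D p, D <> [::] ->
    G1 = [::] \/ D1 = [::] -> G2 = [::] \/ D2 = [::] ->
    mor p (D1 ++ D ++ D2) (G1 ++ outputs t ++ G2) ->
    exists! q, mor q D (G1 ++ a :: G2) /\
               vcomp (whisk D1 q D2) (whisk G1 (Cell t) G2) = p.
Proof.
have mE D1' D2' G1 G2 r (s : cell2 X) : inputs t = D1' ++ a :: D2' ->
    G1 = [::] \/ D1' = [::] -> G2 = [::] \/ D2' = [::] -> outputs r = G1 ++ a :: G2 ->
    @is_mrg (dual X) D1' [:: a] D2' G1 G2 t r s <->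
    vcomp (whisk D1' (Cell r) D2') (whisk G1 (Cell t) G2) = Cell s.
  move=> it l1 l2 or; rewrite dual_is_mrg; apply: mrg_vcompE => //; split=> //.
    by case: l1; [right | left].
  by case: l2; [right | left].
split=> -[it H]; split=> // G1 G2 D.
  move=> p neD l1 l2 Hp; have [|s es] := mor_cell Hp.
    exact: cat_ne.
  subst p; case: Hp => is_ os.
  apply/(ex_unique_cell (P := fun r => [/\ outputs r = G1 ++ a :: G2, inputs r = D &
    @is_mrg (dual X) D1 [:: a] D2 G1 G2 t r s])).
  - move=> r; split=> [[or ir /mE]|[[ir or] e]]; first by move=> ->.
    by split=> //; apply/mE.
  - by move=> q [Hq _]; apply: mor_cell Hq neD.
  exact: H.
move: G1 G2 D; suff: forall (G1 G2 D : seq (cell1 X)) (s : cell2 X), D <> [::] ->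
    G1 = [::] \/ D1 = [::] -> G2 = [::] \/ D2 = [::] ->
    outputs s = G1 ++ outputs t ++ G2 -> inputs s = D1 ++ D ++ D2 ->
    exists! r : cell2 X, [/\ outputs r = G1 ++ a :: G2, inputs r = D &
      @is_mrg (dual X) D1 [:: a] D2 G1 G2 t r s] by [].
move=> G1 G2 D s neD l1 l2 os is_.
apply/(ex_unique_cell (Q := fun q => mor q D (G1 ++ a :: G2) /\
               vcomp (whisk D1 q D2) (whisk G1 (Cell t) G2) = Cell s)).
- move=> r; split=> [[or ir /mE]|[[ir or] e]]; first by move=> ->.
  by split=> //; apply/mE.
- by move=> q [Hq _]; apply: mor_cell Hq neD.
exact: H.
Qed.

(** The double dual differs from the original by the proofs of the boundary
    conditions, hence is not convertible to it. *)
Lemma universal_dual_in t D1 a D2 :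
  @universal_in (dual X) t D1 a D2 <-> @universal_out X t D1 a D2.
Proof.
have E D1' L D2' G1 G2 s r (w : cell2 X) :
    @is_mrg (dual (dual X)) D1' L D2' G1 G2 s r w <-> @is_mrg X D1' L D2' G1 G2 s r w.
  split=> [[h <-]|[h <-]].
    by exists (dual_mergeable (dual_mergeable h)).
  have h' : @mergeable (dual (dual X)) D1' L D2' G1 G2 s r by case: h.
  by exists h'; rewrite /= /dual_mrg /= /dual_mrg; congr mrg;
    apply: proof_irrelevance.
split=> -[ot H]; split=> // G1 G2 D s neD l1 l2 is_ os.
  have [r [[ir or /E mr] ur]] := H G1 G2 D s neD l1 l2 is_ os; exists r; split=> //.
  by move=> r' [ir' or' mr']; apply: ur; split=> //; apply/E.
have [r [[ir or mr] ur]] := H G1 G2 D s neD l1 l2 is_ os; exists r; split.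
  by split=> //; apply/E.
by move=> r' [ir' or' /E mr']; apply: ur.
Qed.

Lemma inverse_universal_from t q : inverse (Cell t) q (inputs t) (outputs t) ->
  universal_from t.
Proof.
move=> iT G1 G2 s is_.
have cG : composable (G1 ++ inputs t ++ G2) by rewrite -is_; apply: composable_inputs.
have iW := inverse_whisk iT cG.
apply/(ex_unique_cell (Q := fun p => mor p (G1 ++ outputs t ++ G2) (outputs s) /\
  vcomp (whisk G1 (Cell t) G2) p = Cell s)).
- move=> r; split=> [[ir or /(mrg_vcomp hX)]|[[ir or] e]] //.
    by rewrite whisk_nil.
  split=> //; apply/mrg_vcompE; rewrite ?whisk_nil //.
  by split; rewrite ?cats0 //; [case: (boundary_ne t) | right | right].
- by move=> p [Hp _]; apply: mor_cell Hp _; apply: cat_ne; case: (boundary_ne t).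
have Hs : mor (Cell s) (G1 ++ inputs t ++ G2) (outputs s) by [].
exists (vcomp (whisk G1 q G2) (Cell s)); split.
  split; first by apply: mor_vcomp Hs => //; case: iW.
  exact: vcomp_invl (inverse_sym iW) Hs.
by move=> p [Hp <-]; apply: vcomp_invl iW Hp.
Qed.

Lemma inverse_universal_to t q : inverse (Cell t) q (inputs t) (outputs t) ->
  @universal_from (dual X) t.
Proof.
move=> iT; suff: forall (G1 G2 : seq (cell1 X)) (s : cell2 X),
    outputs s = G1 ++ outputs t ++ G2 ->
    exists! r : cell2 X, [/\ outputs r = G1 ++ inputs t ++ G2,
      inputs r = inputs s &
      @is_mrg (dual X) [::] (inputs t) [::] G1 G2 t r s] by [].
move=> G1 G2 s os.
have cG : composable (G1 ++ inputs t ++ G2).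
  by rewrite composable_io -os; apply: composable_outputs.
have iW := inverse_whisk iT cG.
apply/(ex_unique_cell (Q := fun p => mor p (inputs s) (G1 ++ inputs t ++ G2) /\
  vcomp p (whisk G1 (Cell t) G2) = Cell s)).
- move=> r; split=> [[or ir /dual_is_mrg/(mrg_vcomp hX)]|[[ir or] e]] //.
    by rewrite whisk_nil.
  split=> //; apply/dual_is_mrg/mrg_vcompE; rewrite ?whisk_nil //.
  by split; rewrite ?cats0 //; [case: (boundary_ne t) | left | left].
- by move=> p [Hp _]; apply: mor_cell Hp _; case: (boundary_ne s).
have Hs : mor (Cell s) (inputs s) (G1 ++ outputs t ++ G2) by [].
exists (vcomp (Cell s) (whisk G1 q G2)); split.
  split; first by apply: (mor_vcomp Hs); case: iW.
  exact: vcomp_invr (inverse_sym iW) Hs.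
by move=> p [Hp <-]; apply: vcomp_invr iW Hp.
Qed.

Lemma inverse_universal2 t q G D : inverse (Cell t) q G D -> universal2 t.
Proof.
move=> iT; have [[it ot] _ _ _] := iT; subst G D.
by split; [apply: inverse_universal_from iT | apply: inverse_universal_to iT].
Qed.

(** Factoring the unit on the inputs through [t] gives a right inverse [q] of
    [t]; it is a left inverse because [t] factors through itself in just one
    way, and both the unit on [c] and [q] followed by [t] do it. *)
Lemma universal_out_iso t c : universal_out t [::] c [::] <->
  exists q, inverse (Cell t) q (inputs t) [:: c].
Proof.
rewrite universal_outE; split=> [[ot H]|[q iT]].
  have Ht : mor (Cell t) (inputs t) [:: c] by [].
  have Hi : mor (idc (inputs t)) (inputs t) (inputs t).
    exact/mor_idc/composable_inputs.
  have [] := H [::] [::] (inputs t) (idc (inputs t)).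
  - by case: (boundary_ne t).
  - by left.
  - by left.
  - by rewrite /= !cats0.
  move=> q [[Hq e] _]; exists q; rewrite !whisk_nil // in e; split=> //.
  have [] := H [::] [::] [:: c] (Cell t).
  - by [].
  - by left.
  - by left.
  - by rewrite /= !cats0.
  move=> w [_ uw]; transitivity w; first apply/esym; apply: uw; split.
  - exact: mor_vcomp Hq Ht.
  - by rewrite !whisk_nil // vcompA // e (vcomp_idl hX Ht).
  - by apply: mor_idc => //; rewrite -ot; apply: composable_outputs.
  - by rewrite !whisk_nil // (vcomp_idr hX Ht).
have [[_ ot] _ _ _] := iT; split=> // G1 G2 D p neD _ _; rewrite /= cats0 => Hp.
have iW := inverse_whisk iT (mor_composable Hp).
exists (vcomp (whisk G1 q G2) p); split.
  split; first by apply: mor_vcomp Hp => //; case: iW.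
  by rewrite whisk_nil //; apply: vcomp_invl (inverse_sym iW) Hp.
by move=> w [Hw <-]; rewrite whisk_nil //; apply: vcomp_invl iW Hw.
Qed.

Lemma universal_in_iso t c : universal_in t [::] c [::] <->
  exists q, inverse (Cell t) q [:: c] (outputs t).
Proof.
rewrite universal_inE; split=> [[ot H]|[q iT]].
  have Ht : mor (Cell t) [:: c] (outputs t) by [].
  have Hi : mor (idc (outputs t)) (outputs t) (outputs t).
    exact/mor_idc/composable_outputs.
  have [] := H [::] [::] (outputs t) (idc (outputs t)).
  - by case: (boundary_ne t).
  - by left.
  - by left.
  - by rewrite /= !cats0.
  move=> q [[Hq e] _]; exists q; rewrite !whisk_nil // in e; split=> //.
  have [] := H [::] [::] [:: c] (Cell t).
  - by [].
  - by left.
  - by left.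
  - by rewrite /= !cats0.
  move=> w [_ uw]; transitivity w; first apply/esym; apply: uw; split.
  - exact: mor_vcomp Ht Hq.
  - by rewrite !whisk_nil // -vcompA // e (vcomp_idr hX Ht).
  - by apply: mor_idc => //; rewrite -ot; apply: composable_inputs.
  - by rewrite !whisk_nil // (vcomp_idl hX Ht).
have [[it _] _ _ _] := iT; split=> // G1 G2 D p neD _ _; rewrite /= cats0 => Hp.
have iW : inverse (whisk G1 (Cell t) G2) (whisk G1 q G2) (G1 ++ c :: G2)
    (G1 ++ outputs t ++ G2).
  apply: (inverse_whisk iT).
  by have /(composable_mor G1 G2)-> : mor (Cell t) [:: c] (outputs t) by [];
    apply: mor_sym_composable Hp.
exists (vcomp p (whisk G1 q G2)); split.
  split; first by apply: (mor_vcomp Hp); case: iW.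
  by rewrite whisk_nil //; apply: vcomp_invr (inverse_sym iW) Hp.
by move=> w [Hw <-]; rewrite whisk_nil //; apply: vcomp_invr iW Hw.
Qed.

Lemma is_tensorP a b c t : is_tensor a b c t <->
  exists q, inverse (Cell t) q [:: a; b] [:: c].
Proof.
split=> [[it ot]|[q iT]].
  by rewrite universal_out_iso it.
have [[it ot] _ _ _] := iT; split=> //; apply/universal_out_iso.
by exists q; rewrite it.
Qed.

Lemma is_parP a b c t : is_par a b c t <->
  exists q, inverse (Cell t) q [:: c] [:: a; b].
Proof.
split=> [[/= it ot]|[q iT]].
  by move/universal_in_iso; rewrite it.
have [[it ot] _ _ _] := iT; split=> //; apply/universal_in_iso.
by exists q; rewrite ot.
Qed.

End Universal.

(** * Tensor and par universal 1-cells *)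

Section Divisible.
Variable X : merge_bicategory.
Hypothesis hX : unital X.
Implicit Types (G D K E F : seq (cell1 X)) (a b e u v : cell1 X)
  (p q r s w : xcell X) (t : cell2 X).

(** Under the typing hypotheses met below, [phi] is a bijection from the cells
    (G) -> (D) to the cells (G') -> (D'). *)
Definition factors (phi : xcell X -> xcell X) G D G' D' : Prop :=
  forall s, mor s G' D' -> exists! r, mor r G D /\ phi r = s.

(** Used to add an invertible cell to a universal property, or to remove it. *)
Lemma factors_vcomp phi G D G' D' p q F : inverse p q D' F ->
  (composable G' -> forall r, mor r G D -> mor (phi r) G' D') ->
  factors phi G D G' D' <-> factors (fun r => vcomp (phi r) p) G D G' F.
Proof.
move=> pq Hphi; split=> H s Hs; have Hphi' := Hphi (mor_composable Hs).
  have [r [[Hr er] ur]] : exists! r, mor r G D /\ phi r = vcomp s q.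
    by apply: H; apply: mor_vcomp Hs _; case: pq.
  exists r; split; first by split=> //;
    rewrite er (vcomp_invr hX (inverse_sym pq) Hs).
  move=> r' [Hr' er']; apply: ur; split=> //.
  by rewrite -er' (vcomp_invr hX pq (Hphi' _ Hr')).
have [r [[Hr er] ur]] : exists! r, mor r G D /\ vcomp (phi r) p = vcomp s p.
  by apply: H; apply: mor_vcomp Hs _; case: pq.
exists r; split.
  by split=> //; rewrite -(vcomp_invr hX pq (Hphi' _ Hr)) er (vcomp_invr hX pq Hs).
by move=> r' [Hr' er']; apply: ur; split; rewrite ?er'.
Qed.

Lemma vcomp_factors phi G D G' D' p q F : inverse p q F G' ->
  (composable G' -> forall r, mor r G D -> mor (phi r) G' D') ->
  factors phi G D G' D' <-> factors (fun r => vcomp p (phi r)) G D F D'.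
Proof.
move=> pq Hphi.
have Hphi' s : mor s F D' -> forall r, mor r G D -> mor (phi r) G' D'.
  by move=> Hs; apply: Hphi; case: pq => /mor_sym_composable.
split=> H s Hs.
  have [r [[Hr er] ur]] : exists! r, mor r G D /\ phi r = vcomp q s.
    by apply: H; apply: mor_vcomp Hs; case: pq.
  exists r; split; first by split=> //;
    rewrite er (vcomp_invl hX (inverse_sym pq) Hs).
  move=> r' [Hr' er']; apply: ur; split=> //.
  by rewrite -er' (vcomp_invl hX pq (Hphi' _ Hs _ Hr')).
have Hphi'' := Hphi (mor_composable Hs).
have [r [[Hr er] ur]] : exists! r, mor r G D /\ vcomp p (phi r) = vcomp p s.
  by apply: H; apply: mor_vcomp Hs; case: pq.
exists r; split.
  by split=> //; rewrite -(vcomp_invl hX pq (Hphi'' _ Hr)) er (vcomp_invl hX pq Hs).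
by move=> r' [Hr' er']; apply: ur; split; rewrite ?er'.
Qed.

(** Whiskering by [E] on the left is full and faithful on non-empty sequences. *)
Definition cancel_l E : Prop := forall G D, G <> [::] -> D <> [::] ->
  factors (fun r => whisk E r [::]) G D (E ++ G) (E ++ D).

Definition cancel_r E : Prop := forall G D, G <> [::] -> D <> [::] ->
  factors (fun r => whisk [::] r E) G D (G ++ E) (D ++ E).

Lemma mor_whisk_l E G D : composable (E ++ G) ->
  forall r, mor r G D -> mor (whisk E r [::]) (E ++ G) (E ++ D).
Proof. by move=> cG p Hp; apply: (mor_whisk hX Hp cG); rewrite cats0. Qed.

Lemma mor_whisk_r E G D : composable (G ++ E) ->
  forall r, mor r G D -> mor (whisk [::] r E) (G ++ E) (D ++ E).
Proof. by move=> cG p Hp; apply: (mor_whisk hX Hp cG). Qed.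

Lemma cancel_l_inj E G D p q : cancel_l E -> G <> [::] -> composable (E ++ G) ->
  mor p G D -> mor q G D -> whisk E p [::] = whisk E q [::] -> p = q.
Proof.
move=> cE neG cG Hp Hq e; have neD : D <> [::] by apply/(mor_ne Hp).
have [r [_ ur]] := cE G D neG neD _ (mor_whisk_l cG Hp).
by rewrite -(ur p) // -(ur q).
Qed.

Lemma cancel_r_inj E G D p q : cancel_r E -> G <> [::] -> composable (G ++ E) ->
  mor p G D -> mor q G D -> whisk [::] p E = whisk [::] q E -> p = q.
Proof.
move=> cE neG cG Hp Hq e; have neD : D <> [::] by apply/(mor_ne Hp).
have [r [_ ur]] := cE G D neG neD _ (mor_whisk_r cG Hp).
by rewrite -(ur p) // -(ur q).
Qed.

Lemma isomorphic_composable G D : isomorphic G D -> composable G.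
Proof. by move=> [p [q [/mor_composable]]]. Qed.

(** Universality at the output is invertibility; what remains is the universal
    property at the second input. *)
Lemma left_dividesE e u a : left_divides e u a <->
  exists t q, inverse (Cell t) q [:: e; u] [:: a] /\
    forall G D, G <> [::] ->
      factors (fun r => vcomp (whisk [:: e] r [::]) (whisk [::] (Cell t) D))
        G (u :: D) (e :: G) (a :: D).
Proof.
split=> [[t [it ot /(universal_out_iso hX)[q iT] /(universal_inE hX)[_ H]]]|].
  exists t, q; rewrite -it; split=> // G D neG p Hp.
  apply: (H [::] D G p neG); [by left | by right |].
  by rewrite cats0 ot.
move=> [t [q [iT H]]]; have [[it ot] _ _ _] := iT; exists t; split=> //.
  by apply/(universal_out_iso hX); exists q; rewrite it.
apply/(universal_inE hX); split=> // G1 G2 G p neG l _ Hp.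
case: l => // eG1; subst G1; rewrite cats0 ot in Hp.
exact: H.
Qed.

Lemma right_dividesE e u a : right_divides e u a <->
  exists t q, inverse (Cell t) q [:: u; e] [:: a] /\
    forall G D, G <> [::] ->
      factors (fun r => vcomp (whisk [::] r [:: e]) (whisk D (Cell t) [::]))
        G (D ++ [:: u]) (G ++ [:: e]) (D ++ [:: a]).
Proof.
split=> [[t [it ot /(universal_out_iso hX)[q iT] /(universal_inE hX)[_ H]]]|].
  exists t, q; rewrite -it; split=> // G D neG p Hp.
  apply: (H D [::] G p neG); [by right | by left |].
  by rewrite cats0 ot.
move=> [t [q [iT H]]]; have [[it ot] _ _ _] := iT; exists t; split=> //.
  by apply/(universal_out_iso hX); exists q; rewrite it.
apply/(universal_inE hX); split=> // G1 G2 G p neG _ l Hp.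
case: l => // eG2; subst G2; rewrite cats0 ot in Hp.
exact: H.
Qed.

Lemma par_left_dividesE e u a : @left_divides (dual X) e u a <->
  exists t q, inverse (Cell t) q [:: a] [:: e; u] /\
    forall G D, D <> [::] ->
      factors (fun r => vcomp (whisk [::] (Cell t) G) (whisk [:: e] r [::]))
        (u :: G) D (a :: G) (e :: D).
Proof.
split=> [[t [/= it ot /(universal_in_iso hX)[q iT] Ht]]|].
  have [_ H] := proj1 (@universal_outE X hX t [:: e] u [::])
    (proj1 (@universal_dual_in X t [:: e] u [::]) Ht).
  exists t, q; rewrite -it; split=> // G D neD p Hp.
  apply: (H [::] G D p neD); [by left | by right |].
  by rewrite cats0 ot.
move=> [t [q [iT H]]]; have [[it ot] _ _ _] := iT; exists t; split=> //.
  by apply/(universal_in_iso hX); exists q; rewrite ot.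
apply: (proj2 (@universal_dual_in X t [:: e] u [::])); apply/(universal_outE hX);
  split=> // G1 G2 D p neD l _ Hp.
case: l => // eG1; subst G1; rewrite cats0 it in Hp.
exact: H.
Qed.

Lemma par_right_dividesE e u a : @right_divides (dual X) e u a <->
  exists t q, inverse (Cell t) q [:: a] [:: u; e] /\
    forall G D, D <> [::] ->
      factors (fun r => vcomp (whisk G (Cell t) [::]) (whisk [::] r [:: e]))
        (G ++ [:: u]) D (G ++ [:: a]) (D ++ [:: e]).
Proof.
split=> [[t [/= it ot /(universal_in_iso hX)[q iT] Ht]]|].
  have [_ H] := proj1 (@universal_outE X hX t [::] u [:: e])
    (proj1 (@universal_dual_in X t [::] u [:: e]) Ht).
  exists t, q; rewrite -it; split=> // G D neD p Hp.
  apply: (H G [::] D p neD); [by right | by left |].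
  by rewrite cats0 ot.
move=> [t [q [iT H]]]; have [[it ot] _ _ _] := iT; exists t; split=> //.
  by apply/(universal_in_iso hX); exists q; rewrite ot.
apply: (proj2 (@universal_dual_in X t [::] u [:: e])); apply/(universal_outE hX);
  split=> // G1 G2 D p neD _ l Hp.
case: l => // eG2; subst G2; rewrite cats0 it in Hp.
exact: H.
Qed.

Lemma inverse_cell p q G D : inverse p q G D -> G <> [::] ->
  exists2 t, p = Cell t & inverse (Cell t) q G D.
Proof.
by move=> H neG; have [/mor_cell/(_ neG)[t et] _ _ _] := H; subst p; exists t.
Qed.

Lemma left_divides_iso e u a : left_divides e u a -> isomorphic [:: e; u] [:: a].
Proof. by move=> /left_dividesE[t [q [H _]]]; exists (Cell t), q. Qed.

Lemma right_divides_iso e u a : right_divides e u a -> isomorphic [:: u; e] [:: a].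
Proof. by move=> /right_dividesE[t [q [H _]]]; exists (Cell t), q. Qed.

Lemma par_left_divides_iso e u a : @left_divides (dual X) e u a ->
  isomorphic [:: e; u] [:: a].
Proof.
move=> /par_left_dividesE[t [q [H _]]]; exists q, (Cell t); exact: inverse_sym.
Qed.

Lemma par_right_divides_iso e u a : @right_divides (dual X) e u a ->
  isomorphic [:: u; e] [:: a].
Proof.
move=> /par_right_dividesE[t [q [H _]]]; exists q, (Cell t); exact: inverse_sym.
Qed.

Lemma iso_left_divides e u a : cancel_l [:: e] -> isomorphic [:: e; u] [:: a] ->
  left_divides e u a.
Proof.
move=> ce [p [q /inverse_cell[] // t _ iT]]; apply/left_dividesE; exists t, q.
split=> // G D neG s Hs.
have cD : composable ([::] ++ [:: e; u] ++ D).
  by case: iT => Ht _ _ _; rewrite (composable_mor [::] D Ht);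
    apply: mor_sym_composable Hs.
have iW := inverse_whisk hX iT cD.
by apply: (proj1 (factors_vcomp iW _) (ce _ _ neG _)) => // *; apply: mor_whisk_l.
Qed.

Lemma iso_right_divides e u a : cancel_r [:: e] -> isomorphic [:: u; e] [:: a] ->
  right_divides e u a.
Proof.
move=> ce [p [q /inverse_cell[] // t _ iT]]; apply/right_dividesE; exists t, q.
split=> // G D neG s Hs.
have cD : composable (D ++ [:: u; e] ++ [::]).
  by case: iT => Ht _ _ _; rewrite (composable_mor D [::] Ht);
    apply: mor_sym_composable Hs.
have iW := inverse_whisk hX iT cD; rewrite !cats0 in iW.
have neD : D ++ [:: u] <> [::] by case: (D).
rewrite -[[:: u; e]]/([:: u] ++ [:: e]) catA in iW.
by apply: (proj1 (factors_vcomp iW _) (ce _ _ neG neD)) => // *; apply: mor_whisk_r.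
Qed.

Lemma iso_par_left_divides e u a : cancel_l [:: e] -> isomorphic [:: e; u] [:: a] ->
  @left_divides (dual X) e u a.
Proof.
move=> ce [q [p /inverse_sym/inverse_cell[] // t _ iT]]; apply/par_left_dividesE;
  exists t, q.
split=> // G D neD s Hs.
have iW := inverse_whisk (K1 := [::]) hX iT (mor_composable Hs).
have neG : u :: G <> [::] by [].
by apply: (proj1 (vcomp_factors iW _) (ce _ _ neG neD)) => // *; apply: mor_whisk_l.
Qed.

Lemma iso_par_right_divides e u a : cancel_r [:: e] -> isomorphic [:: u; e] [:: a] ->
  @right_divides (dual X) e u a.
Proof.
move=> ce [q [p /inverse_sym/inverse_cell[] // t _ iT]]; apply/par_right_dividesE;
  exists t, q.
split=> // G D neD s Hs.
have iW := inverse_whisk (K2 := [::]) hX iT (mor_composable Hs).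
have neG : G ++ [:: u] <> [::] by case: (G).
rewrite !cats0 -[[:: u; e]]/([:: u] ++ [:: e]) catA in iW.
by apply: (proj1 (vcomp_factors iW _) (ce _ _ neG neD)) => // *; apply: mor_whisk_r.
Qed.

(** An invertible cell (e, d) -> (v), universal at [d], changes the target of a
    cell (e, G) -> (e, d, D) to (v, D), and factoring the result through it
    undoes the whiskering by [e]. *)
Lemma divides_cancel_l e :
  (forall a, src a = tgt e -> exists v, left_divides e a v) -> cancel_l [:: e].
Proof.
move=> H G [//|d D] neG _ s Hs.
have /= [ed cD] := mor_sym_composable Hs.
have [v /left_dividesE[t [q [iT Ht]]]] := H d (esym ed).
have iW := inverse_whisk (K1 := [::]) (K2 := D) hX iT (conj ed cD).
by apply: (proj2 (factors_vcomp iW _) (Ht G D neG)) => // *; apply: mor_whisk_l.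
Qed.

Lemma par_divides_cancel_l e :
  (forall a, src a = tgt e -> exists v, @left_divides (dual X) e a v) ->
  cancel_l [:: e].
Proof.
move=> H [//|d G] D _ neD s Hs.
have /= [ed cD] := mor_composable Hs.
have [v /par_left_dividesE[t [q [iT Ht]]]] := H d (esym ed).
have iW := inverse_sym (inverse_whisk (K1 := [::]) (K2 := G)
  hX (inverse_sym iT) (conj ed cD)).
by apply: (proj2 (vcomp_factors iW _) (Ht G D neD)) => // *; apply: mor_whisk_l.
Qed.

Lemma divides_cancel_r e :
  (forall b, tgt b = src e -> exists v, right_divides e b v) -> cancel_r [:: e].
Proof.
move=> H G D neG; case/lastP: D => [//|D d] _ s Hs.
have := mor_sym_composable Hs.
rewrite -cats1 -catA => cD; have /= [ed _] := composable_catr cD.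
have [v /right_dividesE[t [q [iT Ht]]]] := H d ed.
have iW := inverse_whisk (K1 := D) (K2 := [::]) hX iT cD.
rewrite !cats0 -[[:: d; e]]/([:: d] ++ [:: e]) catA in iW.
rewrite -cats1 in Hs.
by apply: (proj2 (factors_vcomp iW _) (Ht G D neG)) => // *; apply: mor_whisk_r.
Qed.

Lemma par_divides_cancel_r e :
  (forall b, tgt b = src e -> exists v, @right_divides (dual X) e b v) ->
  cancel_r [:: e].
Proof.
move=> H G D; case/lastP: G => [//|G d] _ neD s Hs.
have := mor_composable Hs.
rewrite -cats1 -catA => cD; have /= [ed _] := composable_catr cD.
have [v /par_right_dividesE[t [q [iT Ht]]]] := H d ed.
have iW := inverse_sym (inverse_whisk (K1 := G) (K2 := [::]) hX (inverse_sym iT) cD).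
rewrite !cats0 -[[:: d; e]]/([:: d] ++ [:: e]) catA in iW.
rewrite -cats1 in Hs.
by apply: (proj2 (vcomp_factors iW _) (Ht G D neD)) => // *; apply: mor_whisk_r.
Qed.

(** The cells that relate [e] to the other 1-cells are invertible, so their
    direction does not matter: the notion is its own dual. *)
Record divisible e : Prop := Divisible {
  divisible_l : cancel_l [:: e];
  divisible_r : cancel_r [:: e];
  divisible_quo_l : forall a, src a = src e -> exists u, isomorphic [:: e; u] [:: a];
  divisible_mul_l : forall a, src a = tgt e -> exists v, isomorphic [:: e; a] [:: v];
  divisible_quo_r : forall b, tgt b = tgt e -> exists u, isomorphic [:: u; e] [:: b];
  divisible_mul_r : forall b, tgt b = src e -> exists v, isomorphic [:: b; e] [:: v]
}.

Lemma tensor_universalP e : tensor_universal e <-> divisible e.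
Proof.
split=> [[H1 H2 H3 H4]|[cl cr H1 H2 H3 H4]]; split.
- exact: divides_cancel_l.
- exact: divides_cancel_r.
- by move=> a /H1[u /left_divides_iso]; exists u.
- by move=> a /H2[u /left_divides_iso]; exists u.
- by move=> a /H3[u /right_divides_iso]; exists u.
- by move=> a /H4[u /right_divides_iso]; exists u.
- by move=> a /H1[u /(iso_left_divides cl)]; exists u.
- by move=> a /H2[u /(iso_left_divides cl)]; exists u.
- by move=> a /H3[u /(iso_right_divides cr)]; exists u.
- by move=> a /H4[u /(iso_right_divides cr)]; exists u.
Qed.

Lemma par_universalP e : par_universal e <-> divisible e.
Proof.
split=> [[H1 H2 H3 H4]|[cl cr H1 H2 H3 H4]]; split.
- exact: par_divides_cancel_l.
- exact: par_divides_cancel_r.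
- by move=> a /H1[u /par_left_divides_iso]; exists u.
- by move=> a /H2[u /par_left_divides_iso]; exists u.
- by move=> a /H3[u /par_right_divides_iso]; exists u.
- by move=> a /H4[u /par_right_divides_iso]; exists u.
- by move=> a /H1[u /(iso_par_left_divides cl)]; exists u.
- by move=> a /H2[u /(iso_par_left_divides cl)]; exists u.
- by move=> a /H3[u /(iso_par_right_divides cr)]; exists u.
- by move=> a /H4[u /(iso_par_right_divides cr)]; exists u.
Qed.

Lemma universal1P e : universal1 e <-> divisible e.
Proof.
by split=> [[/tensor_universalP]|H] //; split;
  [apply/tensor_universalP | apply/par_universalP].
Qed.

(** The self-dual notion underlying tensor and par units. *)
Definition weak_unit x e : Prop :=
  [/\ src e = x, tgt e = x, divisible e,
      forall a, src a = x -> isomorphic [:: e; a] [:: a] &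
      forall b, tgt b = x -> isomorphic [:: b; e] [:: b]].

Lemma tensor_unitP x e : is_tensor_unit x e <-> weak_unit x e.
Proof.
split=> [[se te H1 H2]|[se te [cl cr _ _ _ _] H1 H2]]; split=> //.
- split.
  + by apply: divides_cancel_l => a; rewrite te => /H1; exists a.
  + by apply: divides_cancel_r => a; rewrite se => /H2; exists a.
  + by move=> a; rewrite se => /H1/left_divides_iso; exists a.
  + by move=> a; rewrite te => /H1/left_divides_iso; exists a.
  + by move=> a; rewrite te => /H2/right_divides_iso; exists a.
  + by move=> a; rewrite se => /H2/right_divides_iso; exists a.
- by move=> a /H1/left_divides_iso.
- by move=> a /H2/right_divides_iso.
- by move=> a /H1/(iso_left_divides cl).
- by move=> a /H2/(iso_right_divides cr).
Qed.

Lemma par_unitP x e : is_par_unit x e <-> weak_unit x e.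
Proof.
split=> [[se te H1 H2]|[se te [cl cr _ _ _ _] H1 H2]]; split=> //.
- split.
  + by apply: par_divides_cancel_l => a; rewrite te => /H1; exists a.
  + by apply: par_divides_cancel_r => a; rewrite se => /H2; exists a.
  + by move=> a; rewrite se => /H1/par_left_divides_iso; exists a.
  + by move=> a; rewrite te => /H1/par_left_divides_iso; exists a.
  + by move=> a; rewrite te => /H2/par_right_divides_iso; exists a.
  + by move=> a; rewrite se => /H2/par_right_divides_iso; exists a.
- by move=> a /H1/par_left_divides_iso.
- by move=> a /H2/par_right_divides_iso.
- by move=> a /H1/(iso_par_left_divides cl).
- by move=> a /H2/(iso_par_right_divides cr).
Qed.

Lemma eq_factors (phi psi : xcell X -> xcell X) G D G' D' :
  (forall r, mor r G D -> phi r = psi r) ->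
  factors phi G D G' D' -> factors psi G D G' D'.
Proof.
move=> e H s /H[r [[Hr er] ur]]; exists r; split; first by rewrite -e.
by move=> r' [Hr' er']; apply: ur; rewrite e.
Qed.

(** By interchange, whiskering by [F] is conjugate to whiskering by [E]. *)
Lemma cancel_l_iso E F : isomorphic E F -> cancel_l E -> cancel_l F.
Proof.
move=> [p [q ip]] cE G D neG neD s Hs; have cFG := mor_composable Hs.
have iG := inverse_whisk (K1 := [::]) (K2 := G) hX (inverse_sym ip) cFG.
have iD := inverse_sym (inverse_whisk (K1 := [::]) (K2 := D) hX (inverse_sym ip)
  (mor_sym_composable Hs)).
have cEG : composable (E ++ G) by case: iG => /mor_sym_composable.
have Hphi r : mor r G D -> mor (whisk E r [::]) (E ++ G) (E ++ D).
  exact: mor_whisk_l.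
have H1 := proj1 (factors_vcomp iD (fun _ => Hphi)) (cE G D neG neD).
have HpD : mor (whisk [::] p D) (E ++ D) (F ++ D) by case: iD.
have H2 := proj1 (vcomp_factors iG (fun _ r Hr => mor_vcomp (Hphi r Hr) HpD)) H1.
apply: (eq_factors _ H2) Hs => r Hr; have [Hp _ _ _] := ip.
rewrite -(interchange hX Hp Hr); apply: (vcomp_invl hX (inverse_sym iG)).
exact: (mor_whisk_l cFG Hr).
Qed.

Lemma cancel_r_iso E F : isomorphic E F -> cancel_r E -> cancel_r F.
Proof.
move=> [p [q ip]] cE G D neG neD s Hs.
have cFG := mor_composable Hs; have cFD := mor_sym_composable Hs.
have iG := inverse_whisk (K1 := G) (K2 := [::]) hX (inverse_sym ip).
have iD := inverse_whisk (K1 := D) (K2 := [::]) hX (inverse_sym ip).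
rewrite !cats0 in iG iD; have {}iG := iG cFG; have {}iD := inverse_sym (iD cFD).
have cEG : composable (G ++ E) by case: iG => /mor_sym_composable.
have Hphi r : mor r G D -> mor (whisk [::] r E) (G ++ E) (D ++ E).
  exact: mor_whisk_r.
have H1 := proj1 (factors_vcomp iD (fun _ => Hphi)) (cE G D neG neD).
have HpD : mor (whisk D p [::]) (D ++ E) (D ++ F) by case: iD.
have H2 := proj1 (vcomp_factors iG (fun _ r Hr => mor_vcomp (Hphi r Hr) HpD)) H1.
apply: (eq_factors _ H2) Hs => r Hr; have [Hp _ _ _] := ip.
rewrite (interchange hX Hr Hp); apply: (vcomp_invl hX (inverse_sym iG)).
exact: (mor_whisk_r cFG Hr).
Qed.
End Divisible.

(** * The merge-bicategory of sequences *)

Section Strictification.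
Variable X : merge_bicategory.
Hypothesis hX : unital X.
Local Notation MX := (MM X).
Implicit Types (A B C : mcell1 X) (As Bs Cs Ks : seq (mcell1 X)) (P Q : xcell MX).

(** The lemmas below make this a fully faithful strict functor, through which all
    questions about [MM X] are reduced to [X]. *)
Definition under P : xcell X :=
  match P with Undef => Undef | Empty => Empty | Cell t => Cell (munder t) end.

Lemma unfold_eq0 As : unfold As = [::] <-> As = [::].
Proof. by split=> [/unfold_nil|->]. Qed.

Lemma composable_unfold As : @composable MX As <-> composable (unfold As).
Proof.
elim: As => [|A [|B As] IH] //=.
  by split=> // _; rewrite cats0; apply: mchain.
have eU : mtail A ++ unfold (B :: As) =
  mtail A ++ mhead B :: (mtail B ++ unfold As) by [].
split=> [[tA /IH cB]|].
  rewrite eU; apply/chain_catE; split=> //.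
  exact: mchain.
by rewrite eU => /chain_catE[_ tA cB]; split=> //; apply/IH.
Qed.

Lemma MM_is_mrg D1 L D2 G1 G2 (t s r : mcell2 X) :
  @mergeable MX D1 L D2 G1 G2 t s ->
  minputs r = G1 ++ minputs t ++ G2 -> moutputs r = D1 ++ moutputs s ++ D2 ->
  @is_mrg MX D1 L D2 G1 G2 t s r <->
  is_mrg (unfold D1) (unfold L) (unfold D2) (unfold G1) (unfold G2)
    (munder t) (munder s) (munder r).
Proof.
move=> h ir or; split=> [[h' <-]|[h' er]]; first by exists (munder_mergeable h').
exists h; apply: mcell2_eq => //=.
by rewrite -er (proof_irrelevance _ (munder_mergeable h) h').
Qed.

Lemma MM_is_unit As (t : mcell2 X) : As <> [::] -> is_unit (unfold As) (munder t) ->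
  minputs t = As -> moutputs t = As -> @is_unit MX As t.
Proof.
move=> neA [_ _ H1 H2] it ot; split=> // s.
  move=> D1 D2 os; apply/MM_is_mrg.
  + by split; rewrite //= ?cats0 //; left.
  + by rewrite /= cats0.
  + by rewrite ot.
  by apply: H1; rewrite -moutputsP -!unfold_cat; congr unfold.
move=> G1 G2 is_; apply/MM_is_mrg.
+ by split; rewrite //= ?cats0 //; right.
+ by rewrite it.
+ by rewrite /= cats0.
by apply: H2; rewrite -minputsP -!unfold_cat; congr unfold.
Qed.

Lemma MM_unital : unital MX.
Proof.
move=> As neA /composable_unfold cA.
have neU : unfold As <> [::] by move/unfold_eq0.
have [t Ht] := hX neU cA; have [it ot _ _] := Ht.
exists (MCell2 (esym it) (esym ot)); exact: MM_is_unit.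
Qed.
Local Notation hM := MM_unital.

Lemma under_mor P As Bs : mor P As Bs -> mor (under P) (unfold As) (unfold Bs).
Proof.
case: P => [||t] //=; first by move=> [-> ->].
by move=> [<- <-]; rewrite [unfold (inputs t)]minputsP [unfold (outputs t)]moutputsP.
Qed.

Lemma under_inj P Q As Bs : mor P As Bs -> mor Q As Bs -> under P = under Q -> P = Q.
Proof.
case: P Q => [||t] [||s] //= [it ot] [is_ os] [e]; congr Cell.
by apply: mcell2_eq; rewrite // ?[minputs _]it ?[moutputs _]ot ?[minputs _]is_
  ?[moutputs _]os.
Qed.

Lemma under_lift q As Bs : mor q (unfold As) (unfold Bs) ->
  exists2 P : xcell MX, mor P As Bs & under P = q.
Proof.
case: q => [||t] //=.
  by move=> [/unfold_nil-> /unfold_nil->]; exists Empty.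
by move=> [it ot]; exists (Cell (MCell2 (esym it) (esym ot) : cell2 MX)).
Qed.

Lemma under_idc As : @composable MX As -> under (@idc MX As) = idc (unfold As).
Proof.
move=> cA; case: As cA => // A As cA.
have neA : A :: As <> [::] by [].
have neU : unfold (A :: As) <> [::] by [].
have cU := proj1 (composable_unfold _) cA.
have [u Hu ->] := idcP hX neU cU; have [iu ou _ _] := Hu.
have Ht : @is_unit MX (A :: As) (MCell2 (esym iu) (esym ou)) by apply: MM_is_unit.
have [t /is_unit_uniq/(_ Ht)-> ->] := idcP hM neA cA.
by [].
Qed.

Lemma under_vcomp P Q As Bs Cs : mor P As Bs -> mor Q Bs Cs ->
  under (vcomp P Q) = vcomp (under P) (under Q).
Proof.
case: P Q => [||t] [||s] //= [it ot] [is_ os]; rewrite -!/(vcomp (Cell _) (Cell _)).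
have [|r Hr rE] := @vcompP MX t s; first exact: etrans ot (esym is_).
move: rE; rewrite /= => ->; apply/esym/the_mrg.
have [h _] := Hr; have [ir or] := is_mrg_boundary Hr.
by move/MM_is_mrg: Hr => /(_ h ir or); rewrite /= -moutputsP.
Qed.

Lemma under_whisk K1 P K2 As Bs : mor P As Bs -> @composable MX (K1 ++ As ++ K2) ->
  under (@whisk MX K1 P K2) = whisk (unfold K1) (under P) (unfold K2).
Proof.
case: P => [||t] //.
  move=> [-> _] cK; rewrite whisk_empty under_idc // unfold_cat.
  by [].
move=> [it ot] cK.
have [|U [r [HU Hr ->]]] := @whiskP MX hM K1 t K2; first by rewrite it.
have [h _] := Hr; have [ir or] := is_mrg_boundary Hr.
move/MM_is_mrg: Hr => /(_ h ir or) /=; rewrite [unfold (outputs t)]moutputsP => Hr.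
have e : unfold K1 ++ outputs (munder t) ++ unfold K2 =
  unfold (K1 ++ outputs t ++ K2).
  by rewrite !unfold_cat -moutputsP.
have cU : @composable MX (K1 ++ outputs t ++ K2) by rewrite -composable_io it.
have := under_idc cU.
have neU : K1 ++ outputs t ++ K2 <> [::].
  exact: (@cat_ne MX K1 (outputs t) K2 (proj2 (boundary_ne t))).
have [V /is_unit_uniq/(_ HU)-> ->] := idcP hM neU cU.
by rewrite e => <- /=; apply/esym/the_mrg.
Qed.

Lemma MM_inverse P Q As Bs : mor P As Bs -> mor Q Bs As ->
  inverse P Q As Bs <-> inverse (under P) (under Q) (unfold As) (unfold Bs).
Proof.
move=> HP HQ; have cA := mor_composable HP; have cB := mor_composable HQ.
split=> [[_ _ e1 e2]|[_ _ e1 e2]]; split=> //.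
- exact: under_mor.
- exact: under_mor.
- by rewrite -(under_vcomp HP HQ) e1 under_idc.
- by rewrite -(under_vcomp HQ HP) e2 under_idc.
- apply: under_inj (mor_vcomp HP HQ) (mor_idc hM cA) _.
  by rewrite (under_vcomp HP HQ) e1 under_idc.
- apply: under_inj (mor_vcomp HQ HP) (mor_idc hM cB) _.
  by rewrite (under_vcomp HQ HP) e2 under_idc.
Qed.

Lemma inverse_lift P q As Bs : mor P As Bs ->
  inverse (under P) q (unfold As) (unfold Bs) ->
  exists2 Q, inverse P Q As Bs & under Q = q.
Proof.
move=> HP iP; have [_ Hq _ _] := iP; have [Q HQ eQ] := under_lift Hq.
by exists Q => //; apply/MM_inverse => //; rewrite eQ.
Qed.

Lemma MM_isomorphic As Bs :
  isomorphic (X := MX) As Bs <-> isomorphic (unfold As) (unfold Bs).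
Proof.
split=> [[P [Q iP]]|[p [q ip]]].
  by exists (under P), (under Q); apply/MM_inverse => //; case: iP.
have [Hp _ _ _] := ip; have [P HP eP] := under_lift Hp.
by have [|Q iP _] := @inverse_lift P q As Bs HP; rewrite ?eP //; exists P, Q.
Qed.

Lemma mcell1_exists (G : seq (cell1 X)) : G <> [::] -> composable G ->
  exists A, mseq A = G.
Proof. by case: G => // a G _ cG; exists (MCell1 cG). Qed.

Lemma unfold1 A : unfold [:: A] = mseq A.
Proof. by rewrite /unfold /= cats0. Qed.

Lemma unfold2 A B : unfold [:: A; B] = mseq A ++ mseq B.
Proof. by rewrite /unfold /= cats0. Qed.

(** Universal properties transfer along [under], since it is bijective on the
    cells of a given type. *)
Lemma factors_under (phi : xcell X -> xcell X) (Phi : xcell MX -> xcell MX)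
    As Bs As' Bs' :
  (forall P, mor P As Bs -> @composable MX As' ->
     mor (Phi P) As' Bs' /\ under (Phi P) = phi (under P)) ->
  factors (X := MX) Phi As Bs As' Bs' <->
  factors phi (unfold As) (unfold Bs) (unfold As') (unfold Bs').
Proof.
move=> HPhi; split=> H s Hs.
  have [S HS eS] := under_lift Hs.
  have [R [[HR eR] uR]] := H S HS.
  have cA := mor_composable HS.
  exists (under R); split.
    by split; [exact: under_mor | rewrite -(proj2 (HPhi R HR cA)) eR].
  move=> q [Hq eq]; have [Q HQ eQ] := under_lift Hq.
  have [HPQ ePQ] := HPhi Q HQ cA.
  rewrite -eQ (uR Q) //; split=> //; apply: under_inj HPQ HS _.
  by rewrite ePQ eQ eq eS.
have cA := mor_composable Hs.
have [r [[Hr er] ur]] := H (under s) (under_mor Hs).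
have [R HR eR] := under_lift Hr; have [HPR ePR] := HPhi R HR cA.
exists R; split.
  by split=> //; apply: under_inj HPR Hs _; rewrite ePR eR.
move=> Q [HQ eQ]; apply: (under_inj HR HQ); rewrite eR; apply: ur.
by split; [exact: under_mor | rewrite -(proj2 (HPhi Q HQ cA)) eQ].
Qed.

Lemma MM_cancel_l As : cancel_l (X := MX) As <-> cancel_l (unfold As).
Proof.
have HPhi As' Bs' P : mor P As' Bs' -> @composable MX (As ++ As') ->
     mor (@whisk MX As P [::]) (As ++ As') (As ++ Bs') /\
     under (@whisk MX As P [::]) = whisk (unfold As) (under P) [::].
  move=> HP cA; split; first exact: (mor_whisk_l hM cA HP).
  by rewrite (under_whisk (K2 := [::]) HP) // cats0.
split=> H G D neG neD; last first.
  by apply/(factors_under (phi := fun r => whisk (unfold As) r [::]) (HPhi _ _));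
    rewrite !unfold_cat; apply: H => /unfold_eq0.
move=> s Hs.
have cG := composable_catr (mor_composable Hs).
have cD := composable_catr (mor_sym_composable Hs).
have [A eA] := mcell1_exists neG cG; have [B eB] := mcell1_exists neD cD.
move: s Hs; rewrite -eA -eB -!unfold1 -!unfold_cat.
by apply/(factors_under (phi := fun r => whisk (unfold As) r [::]) (HPhi _ _));
  apply: H.
Qed.

Lemma MM_cancel_r As : cancel_r (X := MX) As <-> cancel_r (unfold As).
Proof.
have HPhi As' Bs' P : mor P As' Bs' -> @composable MX (As' ++ As) ->
     mor (@whisk MX [::] P As) (As' ++ As) (Bs' ++ As) /\
     under (@whisk MX [::] P As) = whisk [::] (under P) (unfold As).
  move=> HP cA; split; first exact: (mor_whisk_r hM cA HP).
  by rewrite (under_whisk (K1 := [::]) HP).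
split=> H G D neG neD; last first.
  by apply/(factors_under (phi := fun r => whisk [::] r (unfold As)) (HPhi _ _));
    rewrite !unfold_cat; apply: H => /unfold_eq0.
move=> s Hs.
have cG := composable_catl (mor_composable Hs).
have cD := composable_catl (mor_sym_composable Hs).
have [A eA] := mcell1_exists neG cG; have [B eB] := mcell1_exists neD cD.
move: s Hs; rewrite -eA -eB -!unfold1 -!unfold_cat.
by apply/(factors_under (phi := fun r => whisk [::] r (unfold As)) (HPhi _ _));
  apply: H.
Qed.

Lemma mcat_composable A B : mtgt A = msrc B ->
  composable (mhead A :: mtail A ++ mseq B).
Proof.
move=> h; have := proj1 (composable_unfold [:: A; B]).
rewrite /unfold /= cats0; apply.
by split.
Qed.

Definition mcat A B (h : mtgt A = msrc B) : mcell1 X := MCell1 (mcat_composable h).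

Lemma mseq_mcat A B (h : mtgt A = msrc B) : mseq (mcat h) = mseq A ++ mseq B.
Proof. by []. Qed.

Lemma mcat_exists A B (h : mtgt A = msrc B) : exists t : mcell2 X,
  [/\ is_unit (mseq A ++ mseq B) (munder t), minputs t = [:: A; B] &
      moutputs t = [:: mcat h]].
Proof.
have ne : mseq A ++ mseq B <> [::] by [].
have [u Hu] := hX ne (mcat_composable h).
have [iu ou _ _] := Hu.
have iu' : unfold [:: A; B] = inputs u by rewrite iu /unfold /= cats0.
have ou' : unfold [:: mcat h] = outputs u by rewrite unfold1 ou.
by exists (MCell2 iu' ou').
Qed.

(** The unit on (A, B), seen as a cell from A, B to their concatenation. *)
Definition mcat2 A B (h : mtgt A = msrc B) : mcell2 X :=
  proj1_sig (constructive_indefinite_description _ (mcat_exists h)).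

Lemma mcat2P A B (h : mtgt A = msrc B) :
  [/\ is_unit (mseq A ++ mseq B) (munder (mcat2 h)), minputs (mcat2 h) = [:: A; B] &
      moutputs (mcat2 h) = [:: mcat h]].
Proof. exact: proj2_sig (constructive_indefinite_description _ (mcat_exists h)). Qed.

Lemma mcat_inverse A B (h : mtgt A = msrc B) : exists Q,
  inverse (Cell (mcat2 h : cell2 MX)) Q [:: A; B] [:: mcat h].
Proof.
have [Hu im om] := mcat2P h.
have [||Q iQ _] := @inverse_lift (Cell (mcat2 h : cell2 MX))
  (idc (mseq A ++ mseq B)) [:: A; B] [:: mcat h].
- by [].
- rewrite /= -(idc_unit Hu) unfold1 /unfold /= cats0; apply: inverse_idc => //.
  exact: mcat_composable.
by exists Q.
Qed.

Lemma mcat_tensor A B (h : mtgt A = msrc B) :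
  @is_tensor MX A B (mcat h) (mcat2 h).
Proof. exact/(is_tensorP hM)/mcat_inverse. Qed.

Lemma MM_one_representable : one_representable MX.
Proof.
split=> [|A B h]; first exact: MM_unital.
split; first by exists (mcat h), (mcat2 h); apply: mcat_tensor.
have [Q /inverse_sym/inverse_cell[] // t _ it] := mcat_inverse h.
exists (mcat h), t; apply/(is_parP hM).
by exists (Cell (mcat2 h : cell2 MX)).
Qed.

Definition mcat_family : tensor_family MX :=
  TensorFamily (X := MX) mcat_tensor.

(** Both composites have the unit on (A, B, C) as underlying cell. *)
Lemma mcat_family_assoc : strictly_associative mcat_family.
Proof.
move=> A B C hab hbc ha_bc hab_c /=; have eABC : mcat ha_bc = mcat hab_c.
  by apply: mseq_inj; rewrite /mseq /= -catA.
split=> //.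
have [Hab iab oab] := mcat2P hab; have [Hbc ibc obc] := mcat2P hbc.
have [Habc iabc oabc] := mcat2P hab_c; have [Habc' iabc' oabc'] := mcat2P ha_bc.
rewrite !mseq_mcat in Habc Habc'.
have eu : munder (mcat2 hab_c) = munder (mcat2 ha_bc).
  by apply: is_unit_uniq Habc _; rewrite -catA.
have [iu ou _ _] := Habc.
have iu' : unfold [:: A; B; C] = inputs (munder (mcat2 hab_c)).
  by rewrite iu /unfold /= cats0 -catA.
have ou' : unfold [:: mcat hab_c] = outputs (munder (mcat2 hab_c)).
  by rewrite ou unfold1.
exists (MCell2 iu' ou'); split; apply/MM_is_mrg.
- by split=> //; rewrite /= ?oab ?iabc //; right.
- by rewrite /= iab.
- by rewrite /= oabc.
- rewrite /= !unfold1 -[X in is_mrg _ _ _ X]/(@nil (cell1 X)).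
  by have [_ _ _ H] := Hab; apply: (H _ [::]); rewrite iu.
- by split=> //; rewrite /= ?obc ?iabc' //; right.
- by rewrite /= ibc.
- by rewrite /= oabc' eABC.
rewrite /= !unfold1 eu.
by have [_ _ _ H] := Hbc; apply: (H _ _ [::]); case: Habc' => ->; rewrite cats0.
Qed.

End Strictification.

(** * The inclusion *)

Section Inclusion.
Variable X : merge_bicategory.
Hypothesis hX : unital X.
Local Notation MX := (MM X).
Local Notation hM := (MM_unital hX).
Implicit Types (A B C : mcell1 X).

Lemma mcell1_lastP A : exists G a, mseq A = G ++ [:: a] /\ mtgt A = tgt a.
Proof.
exists (belast (mhead A) (mtail A)), (last (mhead A) (mtail A)).
by rewrite /mseq lastI cats1.
Qed.

Lemma isomorphic_l (a b : cell1 X) (e : cell1 X) (G : seq (cell1 X)) :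
  isomorphic [:: e; a] [:: b] -> composable (b :: G) \/ composable [:: e, a & G] ->
  isomorphic [:: e, a & G] (b :: G).
Proof.
move=> i c; apply: (isomorphic_whisk (K1 := [::]) (K2 := G) hX i).
case: c => //; case: i => p [q [Hp _ _ _]].
exact: (proj2 (composable_mor [::] G Hp)).
Qed.

Lemma isomorphic_r (a b : cell1 X) (e : cell1 X) (G : seq (cell1 X)) :
  isomorphic [:: a; e] [:: b] ->
  composable (G ++ [:: b]) \/ composable (G ++ [:: a; e]) ->
  isomorphic (G ++ [:: a; e]) (G ++ [:: b]).
Proof.
move=> i c; have := isomorphic_whisk (K1 := G) (K2 := [::]) hX i.
rewrite !cats0; apply.
case: c => //; case: i => p [q [Hp _ _ _]].
by have := proj2 (composable_mor G [::] Hp); rewrite !cats0.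
Qed.

Lemma composable_rcons (G : seq (cell1 X)) a e : composable (G ++ [:: a]) ->
  tgt a = src e -> composable (G ++ [:: a; e]).
Proof.
case: G => [|g G] /= => [_ -> //|]; rewrite chain_catE => -[? ? _] ?.
by rewrite chain_catE; split.
Qed.

Lemma mcomposable A : composable (mseq A).
Proof. exact: mchain. Qed.

Lemma cat_ne1 (G : seq (cell1 X)) a : G ++ [:: a] <> [::]. Proof. by case: G. Qed.

(** Only the first or last member of a sequence is divided or multiplied by [e];
    the other members are added by whiskering. *)
Lemma zeta_divisible e : divisible e -> divisible (X := MX) (zeta1 e).
Proof.
case=> cl cr H1 H2 H3 H4; split.
- exact/(MM_cancel_l hX).
- exact/(MM_cancel_r hX).
- move=> A /= sA; have [u i] := H1 (mhead A) sA.
  have iA := isomorphic_l i (or_introl (mchain A)).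
  have /= [_ cU] := isomorphic_composable iA.
  exists (MCell1 (mhead := u) cU); apply/(MM_isomorphic hX).
  by rewrite /unfold /= !cats0.
- move=> A /= sA; have [v i] := H2 (mhead A) sA.
  have cA : composable [:: e, mhead A & mtail A].
    by split; [exact: esym sA | exact: mchain].
  have iA := isomorphic_l i (or_intror cA).
  have cV := isomorphic_composable (isomorphic_sym iA).
  exists (MCell1 (mhead := v) cV); apply/(MM_isomorphic hX).
  by rewrite /unfold /= !cats0.
- move=> A /= tA; have [G [a [eA ta]]] := mcell1_lastP A;
    have {}tA := etrans (esym ta) tA.
  have [u i] := H3 a tA.
  have cA := mcomposable A; rewrite eA in cA.
  have iA := isomorphic_r i (or_introl cA).
  have cU := isomorphic_composable iA.
  rewrite -[[:: u; e]]/([:: u] ++ [:: e]) catA in iA cU.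
  have [U eU] := mcell1_exists (@cat_ne1 G u) (composable_catl cU).
  exists U; apply/(MM_isomorphic hX).
  by rewrite unfold1 eA unfold2 eU.
- move=> A /= tA; have [G [a [eA ta]]] := mcell1_lastP A;
    have {}tA := etrans (esym ta) tA.
  have [v i] := H4 a tA.
  have cA := mcomposable A; rewrite eA in cA.
  have iA := isomorphic_r i (or_intror (composable_rcons cA tA)).
  have cV := isomorphic_composable (isomorphic_sym iA).
  have [V eV] := mcell1_exists (@cat_ne1 G v) cV.
  exists V; apply/(MM_isomorphic hX).
  by rewrite unfold1 eV unfold2 eA -catA.
Qed.

Lemma zeta_inverse t q (G D : seq (cell1 X)) : inverse (Cell t) q G D ->
  exists Q, inverse (Cell (zeta2 t : cell2 MX)) Q
    (map (@zeta1 X) G) (map (@zeta1 X) D).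
Proof.
move=> it; have [[ir or] _ _ _] := it.
have [||Q iQ _] := @inverse_lift X hX (Cell (zeta2 t : cell2 MX)) q
  (map (@zeta1 X) G) (map (@zeta1 X) D).
- by rewrite /= ir or.
- by rewrite !unfold_zeta1.
by exists Q.
Qed.

Lemma zeta_strong : strong (zeta X).
Proof.
split.
- move=> a t Hu; apply: MM_is_unit => //=; case: Hu => it ot _ _; rewrite ?it ?ot //.
- by move=> e /(tensor_universalP hX)/zeta_divisible/(tensor_universalP hM).
- by move=> e /(par_universalP hX)/zeta_divisible/(par_universalP hM).
- move=> a b c t /(is_tensorP hX)[q /zeta_inverse[Q iQ]].
  by apply/(is_tensorP hM); exists Q.
- move=> a b c t /(is_parP hX)[q /zeta_inverse[Q iQ]].
  by apply/(is_parP hM); exists Q.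
Qed.

Lemma zeta_weak_unit (x : cell0 X) (e : cell1 X) : weak_unit x e ->
  weak_unit (X := MX) x (zeta1 e).
Proof.
move=> [se te de H1 H2]; split=> //; first exact: zeta_divisible.
  move=> A sA; apply/(MM_isomorphic hX); rewrite /unfold /= !cats0.
  by apply: isomorphic_l; [apply: H1 | left; apply: mchain].
move=> A tA; apply/(MM_isomorphic hX).
have [G [a [eA ta]]] := mcell1_lastP A; rewrite /= [LHS]ta in tA.
rewrite unfold2 unfold1 eA -catA.
apply: isomorphic_r; first exact: H2.
by left; rewrite -eA; apply: mcomposable.
Qed.

Lemma MM_representable : representable X -> representable MX.
Proof.
move=> [_ H]; split; first exact: MM_one_representable.
move=> x; have [[e /(tensor_unitP hX)/zeta_weak_unit He] _] := H x.
by split; exists (zeta1 e : cell1 MX);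
  [apply/(tensor_unitP hM) | apply/(par_unitP hM)].
Qed.
End Inclusion.

Arguments idc : simpl never.
Arguments whisk : simpl never.
Arguments vcomp : simpl never.

(** * Collapsing sequences to iterated tensors *)

Section Collapse.
Variable X : merge_bicategory.
Hypothesis hR : one_representable X.
Local Notation MX := (MM X).
Local Notation hX := (proj1 hR).
Local Notation hM := (MM_unital hX).
Implicit Types (A B C : mcell1 X) (As Bs Cs Ks : seq (mcell1 X)) (t s r : mcell2 X).

(** The clause on one-member sequences makes the collapse a strict retraction of
    the inclusion. *)
Lemma collapse_seq (G : seq (cell1 X)) a : composable (a :: G) -> exists c p q,
  inverse p q (a :: G) [:: c] /\ (G = [::] -> c = a /\ p = idc [:: a]).
Proof.
elim: G a => [|b G IH] a cG.
  exists a, (idc [:: a]), (idc [:: a]); split=> //; exact: (inverse_idc hX).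
have [c [p [q [ip _]]]] := IH b (proj2 cG).
have cG' : composable ([:: a] ++ (b :: G) ++ [::]) by rewrite cats0.
have := inverse_whisk hX ip cG'; rewrite /= cats0 => iW.
have /= [ac _] : composable [:: a; c] by case: iW => /mor_sym_composable.
have [[d [t /(is_tensorP hX)[u it]]] _] := proj2 hR a c ac.
exists d, (vcomp (whisk [:: a] p [::]) (Cell t)), (vcomp u (whisk [:: a] q [::]));
  split=> //; exact: (inverse_vcomp hX iW it).
Qed.

Lemma collapse_exists A : exists d : cell1 X * (xcell X * xcell X),
  inverse d.2.1 d.2.2 (mseq A) [:: d.1] /\
  (mtail A = [::] -> d.1 = mhead A /\ d.2.1 = idc [:: mhead A]).
Proof.
by have [c [p [q H]]] := collapse_seq (mchain A); exists (c, (p, q)).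
Qed.

Definition collapse_data A :=
  constructive_indefinite_description _ (collapse_exists A).
Definition collapse1 A : cell1 X := (proj1_sig (collapse_data A)).1.
Definition tau A : xcell X := (proj1_sig (collapse_data A)).2.1.
Definition tau' A : xcell X := (proj1_sig (collapse_data A)).2.2.

Lemma inverse_tau A : inverse (tau A) (tau' A) (mseq A) [:: collapse1 A].
Proof. by have [] := proj2_sig (collapse_data A). Qed.

Lemma collapse1_zeta a : collapse1 (zeta1 a) = a.
Proof. by have [_ /(_ erefl)[]] := proj2_sig (collapse_data (zeta1 a)). Qed.

Lemma tau_zeta a : tau (zeta1 a) = idc [:: a].
Proof. by have [_ /(_ erefl)[]] := proj2_sig (collapse_data (zeta1 a)). Qed.

Local Notation gs := (map collapse1).

(** The horizontal composite of the cells [tau A], written with whiskerings. *)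
Fixpoint Tau As : xcell X :=
  if As is A :: As' then
    vcomp (whisk [::] (tau A) (unfold As')) (whisk [:: collapse1 A] (Tau As') [::])
  else Empty.

Fixpoint Tau' As : xcell X :=
  if As is A :: As' then
    vcomp (whisk [:: collapse1 A] (Tau' As') [::]) (whisk [::] (tau' A) (unfold As'))
  else Empty.

Lemma inverse_Tau As : composable (unfold As) ->
  inverse (Tau As) (Tau' As) (unfold As) (gs As).
Proof.
elim: As => [|A As IH] cA //=.
have i1 := inverse_whisk (K1 := [::]) hX (inverse_tau A) cA.
have cgA : composable ([:: collapse1 A] ++ unfold As ++ [::]).
  by rewrite cats0; case: i1 => /mor_sym_composable.
have i2 := inverse_whisk hX (IH (composable_catr (G := mseq A) cA)) cgA.
by rewrite !cats0 in i2; exact: (inverse_vcomp hX i1 i2).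
Qed.

Lemma mor_Tau As : composable (unfold As) -> mor (Tau As) (unfold As) (gs As).
Proof. by case/inverse_Tau. Qed.

Lemma Tau_cat As Bs : composable (unfold (As ++ Bs)) ->
  Tau (As ++ Bs) =
  vcomp (whisk [::] (Tau As) (unfold Bs)) (whisk (gs As) (Tau Bs) [::]).
Proof.
elim: As => [|A As IH] cAB.
  by rewrite whisk_nil //= ?(vcomp_idl hX (mor_Tau cAB)) //; apply: hX.
rewrite /= IH; last exact: (composable_catr (G := mseq A) cAB).
rewrite !(whisk_vcomp hX) !(whisk_whisk hX) /= unfold_cat -!vcompA ?cats0 //.
Qed.

Lemma collapse2_exists t : exists r : cell2 X, Cell r =
  vcomp (vcomp (Tau' (minputs t)) (Cell (munder t))) (Tau (moutputs t)).
Proof.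
have ci : composable (unfold (minputs t)).
  by rewrite minputsP; apply: composable_inputs.
have co : composable (unfold (moutputs t)).
  by rewrite moutputsP; apply: composable_outputs.
have [_ Hi _ _] := inverse_Tau ci.
have Ht : mor (Cell (munder t)) (unfold (minputs t)) (unfold (moutputs t)).
  by rewrite minputsP moutputsP.
have H := mor_vcomp (mor_vcomp Hi Ht) (mor_Tau co).
have [|r ->] := mor_cell H; last by exists r.
by have [+ _] := @boundary_ne MX t; rewrite /=; case: (minputs t).
Qed.

Definition collapse2 t : cell2 X :=
  proj1_sig (constructive_indefinite_description _ (collapse2_exists t)).

Lemma collapse2E t : Cell (collapse2 t) =
  vcomp (vcomp (Tau' (minputs t)) (Cell (munder t))) (Tau (moutputs t)).
Proof.
exact: proj2_sig (constructive_indefinite_description _ (collapse2_exists t)).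
Qed.

Lemma mor_under t : mor (Cell (munder t)) (unfold (minputs t)) (unfold (moutputs t)).
Proof. by rewrite minputsP moutputsP. Qed.

Lemma composable_minputs t : composable (unfold (minputs t)).
Proof. exact: mor_composable (mor_under t). Qed.
Lemma composable_moutputs t : composable (unfold (moutputs t)).
Proof. exact: mor_sym_composable (mor_under t). Qed.

Lemma mor_collapse2 t : mor (Cell (collapse2 t)) (gs (minputs t)) (gs (moutputs t)).
Proof.
rewrite collapse2E; apply: mor_vcomp (mor_Tau (composable_moutputs t)).
by apply: mor_vcomp (mor_under t); case: (inverse_Tau (composable_minputs t)).
Qed.

Lemma Tau_natural t : vcomp (Tau (minputs t)) (Cell (collapse2 t)) =
  vcomp (Cell (munder t)) (Tau (moutputs t)).
Proof.
rewrite collapse2E -[vcomp (vcomp (Tau' _) _) _]vcompA.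
apply: (vcomp_invl hX (inverse_sym (inverse_Tau (composable_minputs t)))).
exact: mor_vcomp (mor_under t) (mor_Tau (composable_moutputs t)).
Qed.

(** [Tau] is multiplicative for concatenation, so conjugation by it commutes with
    whiskering. *)
Lemma Tau_natural_cat G1 t G2 : composable (unfold (G1 ++ minputs t ++ G2)) ->
  vcomp (Tau (G1 ++ minputs t ++ G2)) (whisk (gs G1) (Cell (collapse2 t)) (gs G2)) =
  vcomp (whisk (unfold G1) (Cell (munder t)) (unfold G2))
    (Tau (G1 ++ moutputs t ++ G2)).
Proof.
move=> cG.
have cG' : composable (unfold (G1 ++ moutputs t ++ G2)).
  move: cG; rewrite !unfold_cat.
  by move/(composable_mor (unfold G1) (unfold G2) (mor_under t)).
have c1 : composable (unfold G1) by move: cG; rewrite unfold_cat => /composable_catl.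
have ci : composable (unfold (minputs t ++ G2)).
  by move: cG; rewrite unfold_cat => /composable_catr.
have co : composable (unfold (moutputs t ++ G2)).
  by move: cG'; rewrite unfold_cat => /composable_catr.
have c2 : composable (unfold G2) by move: ci; rewrite unfold_cat => /composable_catr.
have right : vcomp (Tau (minputs t ++ G2)) (whisk [::] (Cell (collapse2 t)) (gs G2)) =
    vcomp (whisk [::] (Cell (munder t)) (unfold G2)) (Tau (moutputs t ++ G2)).
  rewrite !Tau_cat // -vcompA -(interchange hX (mor_collapse2 t) (mor_Tau c2)).
  by rewrite vcompA -(whisk_vcomp hX) Tau_natural (whisk_vcomp hX) -vcompA.
rewrite [Tau (G1 ++ minputs t ++ G2)]Tau_cat //.
rewrite [Tau (G1 ++ moutputs t ++ G2)]Tau_cat //.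
have eW p (K1 K2 : seq (cell1 X)) : whisk K1 p K2 = whisk K1 (whisk [::] p K2) [::].
  by rewrite (whisk_whisk hX) !cats0.
rewrite [whisk (gs G1) _ (gs G2)]eW -vcompA -(whisk_vcomp hX) right.
rewrite (whisk_vcomp hX) vcompA [whisk (unfold G1) _ _]eW vcompA.
have Hq : mor (whisk [::] (Cell (munder t)) (unfold G2))
    (unfold (minputs t ++ G2)) (unfold (moutputs t ++ G2)).
  by rewrite !unfold_cat; apply: mor_whisk_r => //;
    [exact: hX | rewrite -unfold_cat | exact: mor_under].
by rewrite (interchange hX (mor_Tau c1) Hq).
Qed.

(** A merge is a composite of two whiskerings, and [Tau_natural_cat] applies to
    each of them. *)
Lemma collapse_mrg D1 L D2 G1 G2 t s r : @is_mrg MX D1 L D2 G1 G2 t s r ->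
  is_mrg (gs D1) (gs L) (gs D2) (gs G1) (gs G2) (collapse2 t) (collapse2 s)
    (collapse2 r).
Proof.
move=> H; have [h er] := H; have [ot is_ neL l1 l2] := h.
have [ir or] := is_mrg_boundary H.
have [iT oT] := mor_collapse2 t; have [iS oS] := mor_collapse2 s.
apply/(mrg_vcompE hX).
  split; rewrite -?map_cat ?oT ?iS ?[moutputs t]ot ?[minputs s]is_ //.
  - by case: (L) neL.
  - by case: l1 => ->; [left | right].
  - by case: l2 => ->; [left | right].
have e : G1 ++ moutputs t ++ G2 = D1 ++ minputs s ++ D2.
  by rewrite [moutputs t]ot [minputs s]is_; case: l1 l2 => -> [] ->;
    rewrite /= ?cats0 -?catA ?cats0.
have Hu := proj1 (MM_is_mrg h ir or) H.
have ci := composable_minputs r; have co := composable_moutputs r.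
rewrite [minputs r]ir in ci; rewrite [moutputs r]or in co.
have cm : composable (unfold (D1 ++ minputs s ++ D2)).
  by rewrite -e; move: ci; rewrite !unfold_cat => /(composable_mor _ _ (mor_under t)).
have Hgt : mor (whisk (gs G1) (Cell (collapse2 t)) (gs G2))
    (gs (minputs r)) (gs (D1 ++ minputs s ++ D2)).
  rewrite [minputs r]ir -e !map_cat; apply: whisk_mor (mor_collapse2 t) _;
    first exact: hX.
  rewrite -!map_cat; exact: mor_sym_composable (mor_Tau ci).
have Hgs : mor (whisk (gs D1) (Cell (collapse2 s)) (gs D2))
    (gs (D1 ++ minputs s ++ D2)) (gs (moutputs r)).
  rewrite [moutputs r]or !map_cat; apply: whisk_mor (mor_collapse2 s) _;
    first exact: hX.
  rewrite -!map_cat; exact: mor_sym_composable (mor_Tau cm).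
have iTau := inverse_Tau (composable_minputs r).
rewrite -[LHS](vcomp_invl hX iTau (mor_vcomp Hgt Hgs)).
rewrite -[RHS](vcomp_invl hX iTau (mor_collapse2 r)).
congr vcomp; rewrite Tau_natural vcompA [minputs r]ir (Tau_natural_cat ci) e -vcompA.
by rewrite (Tau_natural_cat cm) vcompA (mrg_vcomp hX Hu) [moutputs r]or.
Qed.

Lemma collapse_src A : src (collapse1 A) = msrc A.
Proof.
have [//|t _ [[it ot] _ _ _]] := inverse_cell (inverse_tau A).
by have := boundary t; rewrite it ot => -[].
Qed.

Lemma collapse_tgt A : tgt (collapse1 A) = mtgt A.
Proof.
have [//|t _ [[it ot] _ _ _]] := inverse_cell (inverse_tau A).
by have := boundary t; rewrite it ot => -[].
Qed.

Definition collapse : morphism MX X :=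
  @Morphism MX X id collapse1 collapse2 collapse_src collapse_tgt
    (fun t => proj1 (mor_collapse2 t)) (fun t => proj2 (mor_collapse2 t))
    collapse_mrg.

Lemma collapse2_zeta (t : cell2 X) : collapse2 (zeta2 t) = t.
Proof.
have TauZ G : composable G -> Tau (map (@zeta1 X) G) = idc G.
  elim: G => [|a G IH] cG //=.
  rewrite unfold_zeta1 IH; last exact: (composable_catr (G := [:: a]) cG).
  rewrite collapse1_zeta tau_zeta !(whisk_idc hX) cats0.
  exact: (vcomp_idl hX (mor_idc hX cG)).
have := Tau_natural (zeta2 t); rewrite /= !TauZ; last 2 first.
- exact: composable_outputs.
- exact: composable_inputs.
have H := mor_collapse2 (zeta2 t).
have gz G : gs (map (@zeta1 X) G) = G.
  by rewrite -map_comp -[RHS]map_id; apply: eq_map => a; apply: collapse1_zeta.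
have {}H : mor (Cell (collapse2 (zeta2 t))) (inputs t) (outputs t).
  by rewrite /= !gz in H.
have Ht : mor (Cell t) (inputs t) (outputs t) by [].
by rewrite (vcomp_idl hX H) (vcomp_idr hX Ht) => -[].
Qed.

Lemma collapse_inverse t (Q : xcell MX) As Bs :
  @inverse MX (Cell (t : cell2 MX)) Q As Bs ->
  exists q, inverse (Cell (collapse2 t)) q (gs As) (gs Bs).
Proof.
move=> iQ; have [[it ot] HQ _ _] := iQ.
have iU := proj1 (MM_inverse hX (P := Cell (t : cell2 MX)) (conj it ot) HQ) iQ.
rewrite /= -it -ot in iU *.
exists (vcomp (Tau' (moutputs t)) (vcomp (under Q) (Tau (minputs t)))).
rewrite collapse2E.
apply: (inverse_vcomp hX _ (inverse_Tau (composable_moutputs t))).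
exact: (inverse_vcomp hX (inverse_sym (inverse_Tau (composable_minputs t))) iU).
Qed.

Lemma isomorphic_Tau As : composable (unfold As) -> isomorphic (unfold As) (gs As).
Proof. by move=> cA; exists (Tau As), (Tau' As); apply: inverse_Tau. Qed.

Lemma collapse_isomorphic As Bs :
  isomorphic (X := MX) As Bs -> isomorphic (gs As) (gs Bs).
Proof.
move=> i; have cA := isomorphic_composable i.
have cB := isomorphic_composable (isomorphic_sym i).
move/composable_unfold: cA => /isomorphic_Tau iA.
move/composable_unfold: cB => /isomorphic_Tau iB.
apply: (isomorphic_trans hX (isomorphic_sym iA)).
by apply: (isomorphic_trans hX _ iB); apply/(MM_isomorphic hX).
Qed.

(** [A] and its collapse are isomorphic in [X], and [collapse1 (zeta1 a)] is
    [a]. *)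
Lemma collapse_divisible A : divisible (X := MX) A -> divisible (collapse1 A).
Proof.
case=> /(MM_cancel_l hX) cl /(MM_cancel_r hX) cr H1 H2 H3 H4.
have iA : isomorphic (unfold [:: A]) [:: collapse1 A].
  by apply: (@isomorphic_Tau [:: A]); rewrite unfold1; apply: mcomposable.
have cz a b : [:: collapse1 (zeta1 a); b] = [:: a; b] by rewrite collapse1_zeta.
have cz' a b : [:: b; collapse1 (zeta1 a)] = [:: b; a] by rewrite collapse1_zeta.
have cz1 a : [:: collapse1 (zeta1 a)] = [:: a] by rewrite collapse1_zeta.
split.
- exact: (cancel_l_iso hX iA).
- exact: (cancel_r_iso hX iA).
- move=> a; rewrite collapse_src => /(H1 (zeta1 a))[U /collapse_isomorphic/=].
  by rewrite cz1; exists (collapse1 U).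
- move=> a; rewrite collapse_tgt => /(H2 (zeta1 a))[U /collapse_isomorphic/=].
  by rewrite cz'; exists (collapse1 U).
- move=> a; rewrite collapse_tgt => /(H3 (zeta1 a))[U /collapse_isomorphic/=].
  by rewrite cz1; exists (collapse1 U).
- move=> a; rewrite collapse_src => /(H4 (zeta1 a))[U /collapse_isomorphic/=].
  by rewrite cz; exists (collapse1 U).
Qed.

Lemma collapse_strong : strong collapse.
Proof.
split.
- move=> A t Hu; have Ht := idc_unit Hu.
  have [it ot _ _] := Hu.
  have neg : [:: collapse1 A] <> [::] by [].
  have iA := inverse_Tau (composable_minputs t); rewrite [minputs t]it in iA.
  have cg : composable [:: collapse1 A] by case: iA => _ /mor_composable.
  have [u Hu' uE] := idcP hX neg cg.
  suff: Cell (collapse2 t) = Cell u by rewrite /=; case=> ->.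
  rewrite collapse2E -uE [minputs t]it [moutputs t]ot.
  have := under_idc hX (As := [:: A]) (I : @composable MX [:: A]).
  rewrite Ht /= => ->.
  have [HT HT' _ <-] := iA.
  by rewrite (vcomp_idr hX HT').
- by move=> A /(tensor_universalP hM)/collapse_divisible/(tensor_universalP hX).
- by move=> A /(par_universalP hM)/collapse_divisible/(par_universalP hX).
- move=> A B C t /(is_tensorP hM)[Q /collapse_inverse iQ].
  exact/(is_tensorP hX).
- move=> A B C t /(is_parP hM)[Q /collapse_inverse iQ].
  exact/(is_parP hX).
Qed.
End Collapse.

(** * Unitors *)

Section Unit.
Variable X : merge_bicategory.
Hypothesis hX : unital X.
Variables (e : cell1 X) (u u' : xcell X).
Hypothesis cl : cancel_l [:: e].
Hypothesis cr : cancel_r [:: e].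
Hypothesis hu : inverse u u' [:: e; e] [:: e].
Implicit Types (G D : seq (cell1 X)) (p q : xcell X).

(** Solutions of (e l) = (u G) and (r e) = (G u), and their inverses; they exist
    and are unique because whiskering by [e] is bijective. *)
Definition lunit G : xcell X := epsilon (inhabits Undef) (fun p =>
  mor p (e :: G) G /\ whisk [:: e] p [::] = whisk [::] u G).
Definition lunit' G : xcell X := epsilon (inhabits Undef) (fun p =>
  mor p G (e :: G) /\ whisk [:: e] p [::] = whisk [::] u' G).
Definition runit G : xcell X := epsilon (inhabits Undef) (fun p =>
  mor p (G ++ [:: e]) G /\ whisk [::] p [:: e] = whisk G u [::]).
Definition runit' G : xcell X := epsilon (inhabits Undef) (fun p =>
  mor p G (G ++ [:: e]) /\ whisk [::] p [:: e] = whisk G u' [::]).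

Let Hu : mor u [:: e; e] [:: e]. Proof. by case: hu. Qed.
Let Hu' : mor u' [:: e] [:: e; e]. Proof. by case: hu. Qed.

Lemma whiskC K1 p K2 : whisk K1 (whisk [::] p K2) [::] =
  whisk [::] (whisk K1 p [::]) K2.
Proof. by rewrite !(whisk_whisk hX) !cats0. Qed.

Lemma composable_eel G : composable (e :: G) -> composable [:: e, e & G].
Proof. exact: (proj2 (composable_mor [::] G Hu)). Qed.

Lemma composable_eer G : composable (G ++ [:: e]) -> composable (G ++ [:: e; e]).
Proof. by have := proj2 (composable_mor G [::] Hu); rewrite !cats0. Qed.

Lemma lunitP G : G <> [::] -> composable (e :: G) ->
  mor (lunit G) (e :: G) G /\ whisk [:: e] (lunit G) [::] = whisk [::] u G.
Proof.
move=> neG cG; apply: (epsilon_spec (inhabits Undef) (fun p =>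
  mor p (e :: G) G /\ whisk [:: e] p [::] = whisk [::] u G)).
have neG' : e :: G <> [::] by [].
have Hs := mor_whisk_r hX (composable_eel cG : composable ([:: e; e] ++ G)) Hu.
by have [r [? _]] := cl neG' neG Hs; exists r.
Qed.

Lemma lunitP_inv G : G <> [::] -> composable (e :: G) ->
  mor (lunit' G) G (e :: G) /\ whisk [:: e] (lunit' G) [::] = whisk [::] u' G.
Proof.
move=> neG cG; apply: (epsilon_spec (inhabits Undef) (fun p =>
  mor p G (e :: G) /\ whisk [:: e] p [::] = whisk [::] u' G)).
have neG' : e :: G <> [::] by [].
have Hs := mor_whisk_r hX (cG : composable ([:: e] ++ G)) Hu'.
by have [r [? _]] := cl neG neG' Hs; exists r.
Qed.

Lemma runitP G : G <> [::] -> composable (G ++ [:: e]) ->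
  mor (runit G) (G ++ [:: e]) G /\ whisk [::] (runit G) [:: e] = whisk G u [::].
Proof.
move=> neG cG; apply: (epsilon_spec (inhabits Undef) (fun p =>
  mor p (G ++ [:: e]) G /\ whisk [::] p [:: e] = whisk G u [::])).
have neG' : G ++ [:: e] <> [::] by case: (G).
have := mor_whisk_l hX (composable_eer cG) Hu.
by rewrite -[[:: e; e]]/([:: e] ++ [:: e]) catA => /(cr neG' neG)[r [? _]]; exists r.
Qed.

Lemma runitP_inv G : G <> [::] -> composable (G ++ [:: e]) ->
  mor (runit' G) G (G ++ [:: e]) /\ whisk [::] (runit' G) [:: e] = whisk G u' [::].
Proof.
move=> neG cG; apply: (epsilon_spec (inhabits Undef) (fun p =>
  mor p G (G ++ [:: e]) /\ whisk [::] p [:: e] = whisk G u' [::])).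
have neG' : G ++ [:: e] <> [::] by case: (G).
have := mor_whisk_l hX cG Hu'.
by rewrite -[[:: e; e]]/([:: e] ++ [:: e]) catA => /(cr neG neG')[r [? _]]; exists r.
Qed.

Lemma inverse_lunit G : G <> [::] -> composable (e :: G) ->
  inverse (lunit G) (lunit' G) (e :: G) G.
Proof.
move=> neG cG; have [Hl el] := lunitP neG cG; have [Hl' el'] := lunitP_inv neG cG.
have cG' := composable_catr (G := [:: e]) cG; have ceG := composable_eel cG.
have [_ _ e1 e2] := hu.
split=> //.
- apply: (cancel_l_inj hX cl _ ceG (mor_vcomp Hl Hl') (mor_idc hX cG)) => //.
  by rewrite (whisk_vcomp hX) el el' -(whisk_vcomp hX) e1 !(whisk_idc hX) cats0.
- apply: (cancel_l_inj hX cl neG cG (mor_vcomp Hl' Hl) (mor_idc hX cG')).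
  by rewrite (whisk_vcomp hX) el el' -(whisk_vcomp hX) e2 !(whisk_idc hX) cats0.
Qed.

Lemma inverse_runit G : G <> [::] -> composable (G ++ [:: e]) ->
  inverse (runit G) (runit' G) (G ++ [:: e]) G.
Proof.
move=> neG cG; have [Hl el] := runitP neG cG; have [Hl' el'] := runitP_inv neG cG.
have cG' := composable_catl cG; have ceG := composable_eer cG.
have neG' : G ++ [:: e] <> [::] by case: (G).
have [_ _ e1 e2] := hu.
split=> //.
- apply: (cancel_r_inj hX cr neG' _ (mor_vcomp Hl Hl') (mor_idc hX cG));
    first by rewrite -catA.
  by rewrite (whisk_vcomp hX) el el' -(whisk_vcomp hX) e1 !(whisk_idc hX) cats0 -catA.
- apply: (cancel_r_inj hX cr neG cG (mor_vcomp Hl' Hl) (mor_idc hX cG')).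
  by rewrite (whisk_vcomp hX) el el' -(whisk_vcomp hX) e2 !(whisk_idc hX) cats0.
Qed.

Lemma lunit_natural p G D : mor p G D -> G <> [::] -> composable (e :: G) ->
  vcomp (whisk [:: e] p [::]) (lunit D) = vcomp (lunit G) p.
Proof.
move=> Hp neG cG; have neD : D <> [::] by apply/(mor_ne Hp).
have cD : composable (e :: D).
  by have := proj1 (composable_mor [:: e] [::] Hp); rewrite !cats0; apply.
have [Hl el] := lunitP neG cG; have [Hd ed] := lunitP neD cD.
have Hw : mor (whisk [:: e] p [::]) (e :: G) (e :: D) :=
  mor_whisk_l hX (E := [:: e]) cG Hp.
apply: (cancel_l_inj hX cl _ (composable_eel cG)
  (mor_vcomp Hw Hd) (mor_vcomp Hl Hp)) => //.
by rewrite !(whisk_vcomp hX) el ed (whisk_whisk hX) (interchange hX Hu Hp).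
Qed.

Lemma runit_natural p G D : mor p G D -> G <> [::] -> composable (G ++ [:: e]) ->
  vcomp (whisk [::] p [:: e]) (runit D) = vcomp (runit G) p.
Proof.
move=> Hp neG cG; have neD : D <> [::] by apply/(mor_ne Hp).
have cD : composable (D ++ [:: e]) := proj1 (composable_mor [::] [:: e] Hp) cG.
have [Hl el] := runitP neG cG; have [Hd ed] := runitP neD cD.
have neG' : G ++ [:: e] <> [::] by case: (G).
apply: (cancel_r_inj hX cr neG' _ (mor_vcomp (mor_whisk_r hX cG Hp) Hd)
  (mor_vcomp Hl Hp)); first by rewrite -catA; apply: composable_eer.
by rewrite !(whisk_vcomp hX) el ed (whisk_whisk hX) -(interchange hX Hp Hu).
Qed.

Lemma lunit'_cat G D : G <> [::] -> composable (e :: G ++ D) ->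
  lunit' (G ++ D) = whisk [::] (lunit' G) D.
Proof.
move=> neG cGD; have cG : composable (e :: G) := composable_catl (G := e :: G) cGD.
have neGD : G ++ D <> [::] by case: (G) neG.
have cGD' := composable_catr (G := [:: e]) cGD.
have [Hl el] := lunitP_inv neGD cGD; have [Hg eg] := lunitP_inv neG cG.
apply: (cancel_l_inj hX cl neGD cGD Hl (mor_whisk_r hX cGD' Hg)).
by rewrite el whiskC eg (whisk_whisk hX).
Qed.

Lemma runit_cat G D : D <> [::] -> composable (G ++ D ++ [:: e]) ->
  runit (G ++ D) = whisk G (runit D) [::].
Proof.
move=> neD cGD; have cD := composable_catr cGD.
have neGD : G ++ D <> [::] by case: (G).
have cGD' : composable ((G ++ D) ++ [:: e]) by rewrite -catA.
have [Hl el] := runitP neGD cGD'; have [Hg eg] := runitP neD cD.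
have neGD' : (G ++ D) ++ [:: e] <> [::] by case: (G ++ D).
have Hw := mor_whisk_l hX cGD Hg; rewrite catA in Hw.
apply: (cancel_r_inj hX cr neGD' _ Hl Hw); first by rewrite -catA;
  apply: composable_eer.
by rewrite el -whiskC eg (whisk_whisk hX).
Qed.

(** The invertible cell (G u D) is both (r e D) and (G e l).  Followed by (r D)
    or by (G l) it gives the same cell, by interchange of r and l. *)
Lemma triangle G D : G <> [::] -> D <> [::] -> composable (G ++ e :: D) ->
  whisk [::] (runit G) D = whisk G (lunit D) [::].
Proof.
move=> neG neD cGD; have cD := composable_catr cGD.
have cG : composable (G ++ [:: e]).
  by apply: (@composable_catl _ _ D); rewrite -catA.
have [Hr er] := runitP neG cG; have [Hl el] := lunitP neD cD.
have cGeD : composable (G ++ [:: e; e] ++ D).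
  exact: (proj2 (composable_mor G D Hu)).
have iu := inverse_whisk hX hu cGeD.
have H1 : mor (whisk [::] (runit G) D) (G ++ [:: e] ++ D) (G ++ D).
  by rewrite catA; apply: mor_whisk_r => //; rewrite -catA.
have H2 := mor_whisk_l hX cGD Hl.
rewrite -[LHS](vcomp_invl hX iu H1) -[RHS](vcomp_invl hX iu H2); congr vcomp.
have -> : vcomp (whisk G u D) (whisk G (lunit D) [::]) =
    vcomp (whisk [::] (runit G) ([:: e] ++ D)) (whisk G (lunit D) [::]).
  congr vcomp; have -> : whisk [::] (runit G) ([:: e] ++ D) =
    whisk [::] (whisk [::] (runit G) [:: e]) D.
    by rewrite (whisk_whisk hX).
  by rewrite er (whisk_whisk hX).
rewrite (interchange hX Hr Hl); congr vcomp.
have -> : whisk (G ++ [:: e]) (lunit D) [::] =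
    whisk G (whisk [:: e] (lunit D) [::]) [::].
  by rewrite (whisk_whisk hX).
by rewrite el (whisk_whisk hX) !cats0.
Qed.
End Unit.

(** * Moving a unit across a sequence *)

Section Swap.
Variable X : merge_bicategory.
Hypothesis hX : unital X.
Variables (e : cell0 X -> cell1 X) (u u' : cell0 X -> xcell X).
Hypothesis cl : forall x, cancel_l [:: e x].
Hypothesis cr : forall x, cancel_r [:: e x].
Hypothesis hu : forall x, inverse (u x) (u' x) [:: e x; e x] [:: e x].
Implicit Types (G D : seq (cell1 X)) (p q : xcell X) (x y z : cell0 X).

Definition between x y G : Prop :=
  [/\ G <> [::], composable (e x :: G) & composable (G ++ [:: e y])].

Definition swap x y G : xcell X :=
  vcomp (runit (e y) (u y) G) (lunit' (e x) (u' x) G).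

Lemma inverse_swap x y G : between x y G ->
  exists q, inverse (swap x y G) q (G ++ [:: e y]) (e x :: G).
Proof.
move=> [neG cx cy].
have il := inverse_lunit hX (@cl x) (hu x) neG cx.
have ir := inverse_runit hX (@cr y) (hu y) neG cy.
by eexists; apply: (inverse_vcomp hX ir (inverse_sym il)).
Qed.

Lemma mor_swap x y G : between x y G -> mor (swap x y G) (G ++ [:: e y]) (e x :: G).
Proof. by case/inverse_swap => q []. Qed.

Lemma between_mor p G D x y : mor p G D -> between x y G -> between x y D.
Proof.
move=> Hp [neG cx cy]; split.
- exact/(mor_ne Hp).
- by have := proj1 (composable_mor [:: e x] [::] Hp); rewrite !cats0; apply.
- exact: (proj1 (composable_mor [::] [:: e y] Hp) cy).
Qed.

Lemma swap_natural p G D x y : mor p G D -> between x y G ->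
  vcomp (whisk [::] p [:: e y]) (swap x y D) =
  vcomp (swap x y G) (whisk [:: e x] p [::]).
Proof.
move=> Hp bG; have [neD dx dy] := between_mor Hp bG; have [neG cx cy] := bG.
have il := inverse_lunit hX (@cl x) (hu x) neG cx.
have id := inverse_lunit hX (@cl x) (hu x) neD dx.
rewrite /swap vcompA (runit_natural hX (@cr y) (hu y) Hp neG cy) -!vcompA;
  congr vcomp.
have Hw : mor (whisk [:: e x] p [::]) (e x :: G) (e x :: D) :=
  mor_whisk_l hX (E := [:: e x]) cx Hp.
have [Hl Hl' _ _] := il; have [Hd Hd' _ _] := id.
rewrite -[LHS](vcomp_invl hX il (mor_vcomp Hp Hd')).
rewrite -[RHS](vcomp_invl hX il (mor_vcomp Hl' Hw)).
congr vcomp; rewrite vcompA -(lunit_natural hX (@cl x) (hu x) Hp neG cx).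
rewrite (vcomp_invr hX id Hw) vcompA.
by case: il => _ _ -> _; rewrite (vcomp_idl hX Hw).
Qed.

(** Between the two swaps, the unit on [y] is introduced before [D] and removed
    after [G]; this is the identity by the triangle identity. *)
Lemma swap_cat x y z G D : between x y G -> between y z D ->
  composable (G ++ e y :: D) ->
  swap x z (G ++ D) = vcomp (whisk G (swap y z D) [::]) (whisk [::] (swap x y G) D).
Proof.
move=> [neG cxG cGy] [neD cyD cDz] cGyD.
have Hl := proj1 (lunitP hX (@cl y) (hu y) neD cyD).
have cGD : composable (G ++ D).
  have := proj1 (composable_mor G [::] Hl); rewrite !cats0; exact.
have cxGD : composable (e x :: G ++ D) := composable_glue (G := [:: e x]) neG cxG cGD.
have cGDz := composable_glue neD cGD cDz.
rewrite /swap (lunit'_cat hX (@cl x) (hu x) neG cxGD).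
rewrite (runit_cat hX (@cr z) (hu z) neD cGDz) !(whisk_vcomp hX) -!vcompA;
  congr vcomp.
rewrite vcompA (triangle hX (@cl y) (@cr y) (hu y) neG neD cGyD) -(whisk_vcomp hX).
have [_ _ _ ->] := inverse_lunit hX (@cl y) (hu y) neD cyD.
have Hl' := proj1 (lunitP_inv hX (@cl x) (hu x) neG cxG).
rewrite (whisk_idc hX) cats0.
by rewrite (vcomp_idl hX (mor_whisk_r hX cGD Hl')).
Qed.
End Swap.

(** * The equivalence *)

Section Equivalence.
Variable X : merge_bicategory.
Hypothesis hRep : representable X.
Local Notation MX := (MM X).
Local Notation hR := (proj1 hRep).
Local Notation hX := (proj1 hR).
Local Notation hM := (MM_unital hX).
Local Notation g := (collapse hR).
Local Notation g1 := (collapse1 hR).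
Local Notation Tau := (Tau hR).
Local Notation tau := (tau hR).

Lemma unit_exists (x : cell0 X) : exists d : cell1 X * (xcell X * xcell X),
  weak_unit x d.1 /\ inverse d.2.1 d.2.2 [:: d.1; d.1] [:: d.1].
Proof.
have [[e /(tensor_unitP hX) He] _] := proj2 hRep x.
have [se te _ H _] := He; have [p [q ip]] := H e se.
by exists (e, (p, q)).
Qed.

Definition unit_data x := constructive_indefinite_description _ (unit_exists x).
Definition unit1 x : cell1 X := (proj1_sig (unit_data x)).1.
Definition mult x : xcell X := (proj1_sig (unit_data x)).2.1.
Definition mult' x : xcell X := (proj1_sig (unit_data x)).2.2.

Lemma unit1P x : weak_unit x (unit1 x).
Proof. by case: (proj2_sig (unit_data x)). Qed.

Lemma inverse_mult x : inverse (mult x) (mult' x) [:: unit1 x; unit1 x] [:: unit1 x].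
Proof. by case: (proj2_sig (unit_data x)). Qed.

Lemma src_unit1 x : src (unit1 x) = x. Proof. by case: (unit1P x). Qed.
Lemma tgt_unit1 x : tgt (unit1 x) = x. Proof. by case: (unit1P x). Qed.
Lemma unit1_divisible x : divisible (unit1 x). Proof. by case: (unit1P x). Qed.
Lemma unit1_cancel_l x : cancel_l [:: unit1 x].
Proof. by case: (unit1_divisible x). Qed.
Lemma unit1_cancel_r x : cancel_r [:: unit1 x].
Proof. by case: (unit1_divisible x). Qed.

Local Notation swap := (swap unit1 mult mult').
Local Notation between := (between unit1).
Local Notation inverse_swap := (inverse_swap hX unit1_cancel_l unit1_cancel_r
  inverse_mult).
Local Notation mor_swap := (mor_swap hX unit1_cancel_l unit1_cancel_r inverse_mult).
Local Notation swap_natural := (swap_natural hX unit1_cancel_l unit1_cancel_r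
  inverse_mult).
Local Notation swap_cat := (swap_cat hX unit1_cancel_l unit1_cancel_r inverse_mult).

Lemma between_seq (a : cell1 X) G : composable (a :: G) ->
  between (src a) (tgt (last a G)) (a :: G).
Proof.
move=> cG; split=> //; first by split; rewrite ?tgt_unit1.
by rewrite /= chain_catE src_unit1.
Qed.

Lemma sigma_exists (a : cell1 X) : exists t, Cell t = swap (src a) (tgt a) [:: a].
Proof.
have [] := mor_cell (mor_swap (between_seq (I : composable [:: a]))) => // t et.
by exists t.
Qed.

(** The composite of [zeta] and [collapse] is the identity on the nose, so that
    [swap] itself has the type of a transformation. *)
Definition sigma (a : cell1 X) : cell2 X :=
  proj1_sig (constructive_indefinite_description _ (sigma_exists a)).

Lemma sigmaE a : Cell (sigma a) = swap (src a) (tgt a) [:: a].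
Proof. exact: proj2_sig (constructive_indefinite_description _ (sigma_exists a)). Qed.

Lemma mor_sigma a : mor (Cell (sigma a)) [:: a; unit1 (tgt a)] [:: unit1 (src a); a].
Proof.
by rewrite sigmaE; apply: (mor_swap (between_seq (I : composable [:: a]))).
Qed.

Lemma map_collapse_zeta (G : seq (cell1 X)) :
  map (map1 (comp_morphism g (zeta X))) G = G.
Proof. by rewrite -[RHS]map_id; apply: eq_map => a; apply: collapse1_zeta. Qed.

Lemma sigma_pastes (a : cell1 X) G : composable (a :: G) -> exists q,
  pastes_to (id_morphism X) (comp_morphism g (zeta X)) unit1 sigma (a :: G) q /\
  Cell q = swap (src a) (tgt (last a G)) (a :: G).
Proof.
elim: G a => [|b G IH] a cG; first by exists (sigma a); rewrite sigmaE.
have [q [Hq eq]] := IH b (proj2 cG).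
have ba := between_seq (I : composable [:: a]); have bG := between_seq (proj2 cG).
have baG := between_seq cG.
have tab : tgt a = src b := proj1 cG.
have [//|r er] := mor_cell (mor_swap baG).
exists r; split=> //; exists q; split=> //.
have [iq oq] : mor (Cell q) ((b :: G) ++ [:: unit1 (tgt (last b G))])
    (unit1 (src b) :: b :: G) by rewrite eq; apply: mor_swap.
have [ia oa] := mor_sigma a.
rewrite map_collapse_zeta; apply/(mrg_vcompE hX).
  by split; rewrite ?oq ?ia ?tab //=; [right | left].
have b1 : between (src a) (src b) [:: a] by rewrite -tab.
have c1 : composable ([:: a] ++ unit1 (src b) :: b :: G).
  by move: cG => [_ cG]; split=> /=; rewrite ?src_unit1 ?tgt_unit1.
by rewrite eq sigmaE -er /= tab; apply/esym/(swap_cat b1 bG c1).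
Qed.

Lemma sigma_natural p : exists r,
  composite_fs (id_morphism X) (comp_morphism g (zeta X)) unit1 sigma p r /\
  composite_sg (id_morphism X) (comp_morphism g (zeta X)) unit1 sigma p r.
Proof.
have := boundary p; case ep: (inputs p) => [|a G]; case op: (outputs p) => [|b D] //=.
case=> cG cD sab tab.
have [q [Hq eq]] := sigma_pastes (cG : composable (a :: G)).
have [q' [Hq' eq']] := sigma_pastes (cD : composable (b :: D)).
have ba := between_seq (cG : composable (a :: G)).
have bb := between_seq (cD : composable (b :: D)).
have Hp : mor (Cell p) (a :: G) (b :: D) by [].
have [iq oq] : mor (Cell q) ((a :: G) ++ [:: unit1 (tgt (last a G))])
    (unit1 (src a) :: a :: G) by rewrite eq; apply: mor_swap.
have [iq' oq'] : mor (Cell q') ((b :: D) ++ [:: unit1 (tgt (last b D))])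
    (unit1 (src b) :: b :: D) by rewrite eq'; apply: mor_swap.
have h : mergeable [:: unit1 (src a)] (a :: G) [::] [::] [::] q p.
  by split; rewrite ?cats0 ?oq ?ep //; left.
have E : vcomp (whisk [::] (Cell p) [:: unit1 (tgt (last b D))]) (Cell q') =
    vcomp (Cell q) (whisk [:: unit1 (src a)] (Cell p) [::]).
  by rewrite eq eq' -tab -sab; apply: swap_natural Hp ba.
have Hr : is_mrg [:: unit1 (src a)] (a :: G) [::] [::] [::] q p (mrg h) by exists h.
exists (mrg h); split.
  exists b, D, q'; split=> //; rewrite map_id; apply/(mrg_vcompE hX).
    by split; rewrite ?cats0 ?op ?iq' //; right.
  by rewrite (whisk_nil hX) E -(mrg_vcomp hX Hr) (whisk_nil hX).
exists a, G, q; split=> //; rewrite map_collapse_zeta /= collapse2_zeta; exact: Hr.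
Qed.

Definition sigma_oplax : oplax (id_morphism X) (comp_morphism g (zeta X)).
Proof.
refine (@Oplax _ _ (id_morphism X) (comp_morphism g (zeta X)) unit1 sigma
  src_unit1 tgt_unit1 (fun a => proj1 (mor_sigma a)) _ sigma_natural).
by move=> a; rewrite /= collapse1_zeta; exact: (proj2 (mor_sigma a)).
Defined.

Lemma sigma_equivalence : pseudonatural_equivalence sigma_oplax.
Proof.
split=> [x|a]; first exact/(universal1P hX)/unit1_divisible.
have [q iq] := inverse_swap (between_seq (I : composable [:: a])).
by rewrite [swap _ _ _](esym (sigmaE a)) in iq; apply: (inverse_universal2 hX iq).
Qed.

(** Move the unit across [As], then collapse [As]. *)
Definition eta x y (As : seq (mcell1 X)) : xcell X :=
  vcomp (swap x y (unfold As)) (whisk [:: unit1 x] (Tau As) [::]).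

Lemma inverse_eta x y As : between x y (unfold As) ->
  exists q, inverse (eta x y As) q (unfold As ++ [:: unit1 y]) (unit1 x :: map g1 As).
Proof.
move=> bA; have [neA cx cy] := bA; have [q iq] := inverse_swap bA.
have cA := composable_catl cy.
have iT : inverse
    (whisk [:: unit1 x] (Tau As) [::]) (whisk [:: unit1 x] (Tau' hR As) [::])
    (unit1 x :: unfold As) (unit1 x :: map g1 As).
  have := inverse_whisk (K1 := [:: unit1 x]) (K2 := [::]) hX (inverse_Tau hR cA).
  by rewrite !cats0; apply.
by eexists; apply: (inverse_vcomp hX iq iT).
Qed.

Lemma mor_eta x y As : between x y (unfold As) ->
  mor (eta x y As) (unfold As ++ [:: unit1 y]) (unit1 x :: map g1 As).
Proof. by move=> bA; have [q [H _ _ _]] := inverse_eta bA. Qed.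

Lemma eta1_seq x y A :
  eta x y [:: A] = vcomp (swap x y (mseq A)) (whisk [:: unit1 x] (tau A) [::]).
Proof.
rewrite /eta unfold1 /=; congr (vcomp _ (whisk _ _ _)).
have [H _ _ _] := inverse_tau hR A.
(* The empty tail contributes an identity. *)
rewrite (whisk_nil hX) -[Empty]/(idc [::]) (whisk_idc hX).
exact: (vcomp_idr hX H).
Qed.

(** By interchange, collapsing the tail commutes with moving the unit across the
    head. *)
Lemma eta_cons x y z A As : between x y (mseq A) -> between y z (unfold As) ->
  composable (mseq A ++ unit1 y :: unfold As) ->
  eta x z (A :: As) = vcomp (whisk (mseq A) (eta y z As) [::])
    (whisk [::] (eta x y [:: A]) (map g1 As)).
Proof.
rewrite eta1_seq => bA bAs cAs; have [_ _ cy] := bAs.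
have HT := mor_Tau hR (composable_catl cy).
have HS := mor_swap bA; have [Ht _ _ _] := inverse_tau hR A.
rewrite [eta y z As]/eta (whisk_vcomp hX) [whisk [::] (vcomp _ _) _](whisk_vcomp hX).
rewrite -!vcompA [vcomp (whisk _ (whisk [:: unit1 y] _ _) _) _]vcompA.
have -> : whisk (mseq A) (whisk [:: unit1 y] (Tau As) [::]) [::] =
    whisk (mseq A ++ [:: unit1 y]) (Tau As) [::] by rewrite (whisk_whisk hX).
rewrite -(interchange hX HS HT) -vcompA vcompA -(swap_cat bA bAs cAs) /eta;
  congr vcomp.
have -> : whisk (unit1 x :: mseq A) (Tau As) [::] =
    whisk [:: unit1 x] (whisk (mseq A) (Tau As) [::]) [::].
  by rewrite (whisk_whisk hX).
have -> : whisk [::] (whisk [:: unit1 x] (tau A) [::]) (map g1 As) =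
    whisk [:: unit1 x] (whisk [::] (tau A) (map g1 As)) [::].
  by rewrite !(whisk_whisk hX) !cats0.
by rewrite -(whisk_vcomp hX) -(interchange hX Ht HT).
Qed.

Lemma eta_natural x y (t : mcell2 X) : between x y (unfold (minputs t)) ->
  vcomp (whisk [::] (Cell (munder t)) [:: unit1 y]) (eta x y (moutputs t)) =
  vcomp (eta x y (minputs t)) (whisk [:: unit1 x] (Cell (collapse2 hR t)) [::]).
Proof.
move=> bt; rewrite /eta vcompA (swap_natural (mor_under t) bt) -!vcompA.
by rewrite -!(whisk_vcomp hX) (Tau_natural hR t).
Qed.

Lemma between_mseq A As : @composable MX (A :: As) ->
  between (msrc A) (mtgt (last A As)) (unfold (A :: As)).
Proof.
move=> /composable_unfold cA; have := between_seq (cA : composable (mhead A :: _)).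
by rewrite unfold_last.
Qed.

Local Notation f := (comp_morphism (zeta X) g).
Local Notation s0 := (fun x => zeta1 (unit1 x) : cell1 MX).

Lemma unfold_map_f As : unfold (map (map1 f) As) = map g1 As.
Proof. by rewrite (map_comp (@zeta1 X) g1) unfold_zeta1. Qed.

Lemma eta_lift (As : seq (mcell1 X)) x y : between x y (unfold As) ->
  exists2 t : cell2 MX, mor (Cell t) (As ++ [:: s0 y]) (s0 x :: map (map1 f) As) &
    Cell (munder t) = eta x y As.
Proof.
move=> bA; have [neA _ _] := bA.
have [|P HP eP] := @under_lift X (eta x y As)
  (As ++ [:: s0 y]) (s0 x :: map (map1 f) As).
  by rewrite unfold_cat; have := mor_eta bA; rewrite -(unfold_map_f As).
have [|t et] := mor_cell HP; first by case: (As).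
by subst P; exists t.
Qed.

Lemma eta1_exists A : exists t : cell2 MX,
  mor (Cell t) [:: A; s0 (mtgt A)] [:: s0 (msrc A); map1 f A] /\
  Cell (munder t) = eta (msrc A) (mtgt A) [:: A].
Proof.
have [t Ht et] := eta_lift (between_mseq (I : @composable MX [:: A])).
by exists t.
Qed.

Definition eta1 A : cell2 MX :=
  proj1_sig (constructive_indefinite_description _ (eta1_exists A)).

Lemma mor_eta1 A : mor (Cell (eta1 A)) [:: A; s0 (mtgt A)] [:: s0 (msrc A); map1 f A].
Proof.
by case: (proj2_sig (constructive_indefinite_description _ (eta1_exists A))).
Qed.

Lemma eta1E A : Cell (munder (eta1 A)) = eta (msrc A) (mtgt A) [:: A].
Proof.
by case: (proj2_sig (constructive_indefinite_description _ (eta1_exists A))).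
Qed.

Lemma eta_pastes A As : @composable MX (A :: As) -> exists q : cell2 MX,
  [/\ pastes_to (id_morphism MX) f s0 eta1 (A :: As) q,
    mor (Cell q) ((A :: As) ++ [:: s0 (mtgt (last A As))])
      (s0 (msrc A) :: map (map1 f) (A :: As)) &
    Cell (munder q) = eta (msrc A) (mtgt (last A As)) (A :: As)].
Proof.
elim: As A => [|B As IH] A cA.
  by exists (eta1 A); split; [by [] | exact: mor_eta1 | exact: eta1E].
have [q [Hq [iq oq] eq]] := IH B (proj2 cA).
have bA := between_mseq (I : @composable MX [:: A]).
have bB := between_mseq (proj2 cA).
have bAB := between_mseq cA.
have tab : mtgt A = msrc B := proj1 cA.
have [r [ir or] er] := eta_lift bAB.
exists r; split=> //; exists q; split=> //.
have [ia oa] := mor_eta1 A.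
have h : @mergeable MX [::] [:: s0 (mtgt A)] (map (map1 f) (B :: As))
    [:: A] [::] q (eta1 A).
  by split; rewrite ?cats0 ?oq ?ia //= ?tab //; [right | left].
apply/(MM_is_mrg h).
- by rewrite [minputs r]ir [minputs q]iq cats0.
- by rewrite [moutputs r]or [moutputs _]oa.
apply/(mrg_vcompE hX (munder r) (munder_mergeable h)).
rewrite eq eta1E er unfold1 unfold_map_f; apply/esym.
rewrite [msrc B]/= -tab in bB *.
rewrite unfold1 in bA.
apply: eta_cons => //.
have [_ _ cAy] := bA; have [_ cyB _] := bB.
exact: (composable_glue (D := [:: unit1 (mtgt A)]) _ cAy cyB).
Qed.

Lemma eta_oplax_natural (p : cell2 MX) : exists r,
  composite_fs (id_morphism MX) f s0 eta1 p r /\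
  composite_sg (id_morphism MX) f s0 eta1 p r.
Proof.
have := boundary p; case ep: (inputs p) => [|A As];
  case op: (outputs p) => [|B Bs] //=.
case=> cA cB sAB tAB.
have [q [Hq [iq oq] eq]] := eta_pastes (cA : @composable MX (A :: As)).
have [q' [Hq' [iq' oq'] eq']] := eta_pastes (cB : @composable MX (B :: Bs)).
have bA := between_mseq (cA : @composable MX (A :: As)).
have h : @mergeable MX [:: s0 (msrc A)] (map (map1 f) (A :: As)) [::] [::] [::]
    q (map2 f p).
  by split; rewrite ?cats0 ?oq ?(map_inputs f p) ?ep //; left.
have h' : @mergeable MX [::] (B :: Bs) [::] [::] [:: s0 (mtgt (last B Bs))] p q'.
  by split; rewrite ?cats0 ?op ?iq' //; right.
have [r er] : exists r, mrg h = r by exists (mrg h).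
have Hr : is_mrg [:: s0 (msrc A)] (map (map1 f) (A :: As)) [::] [::] [::]
    q (map2 f p) r by exists h.
have [ir or] := is_mrg_boundary Hr.
exists r; split.
  exists B, Bs, q'; split=> //; rewrite map_id; apply/(MM_is_mrg h').
  - by rewrite [minputs r]ir iq [minputs p]ep /= cats0 -tAB.
  - by rewrite [moutputs r]or (map_outputs f p) op [moutputs q']oq' /= cats0 -sAB.
  apply/(mrg_vcompE hX (munder r) (munder_mergeable h')).
  have := mrg_vcomp hX (proj1 (MM_is_mrg h ir or) Hr).
  rewrite !(whisk_nil hX) => <-; rewrite eq eq' -[unfold [:: s0 _]]/([:: unit1 _]) /=.
  have := eta_natural (x := msrc A) (y := mtgt (last A As)) (t := p).
  by rewrite [minputs p]ep [moutputs p]op sAB tAB => /(_ _)->; rewrite -?sAB -?tAB.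
exists A, As, q; split=> //; exact: Hr.
Qed.

Definition eta_oplax : oplax (id_morphism MX) f :=
  @Oplax _ _ (id_morphism MX) f s0 eta1 src_unit1 tgt_unit1
    (fun A => proj1 (mor_eta1 A)) (fun A => proj2 (mor_eta1 A)) eta_oplax_natural.

Lemma eta_equivalence : pseudonatural_equivalence eta_oplax.
Proof.
split=> [x|A].
  exact/(universal1P hM)/(zeta_divisible hX)/unit1_divisible.
have bA := between_mseq (I : @composable MX [:: A]).
have [q iq] := inverse_eta bA.
have [|Q iQ _] := @inverse_lift X hX (Cell (eta1 A)) q _ _ (mor_eta1 A).
  by rewrite /= eta1E unfold2 -unfold1.
exact: (inverse_universal2 hM iQ).
Qed.

End Equivalence.

Theorem lemma6p11 (X : merge_bicategory) (hX : unital X) :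
  (one_representable (MM X) /\
   exists T : tensor_family (MM X), strictly_associative T) /\
  strong (zeta X) /\
  (representable X -> is_equivalence (zeta X)).
Proof.
split; first split.
- exact: MM_one_representable.
- by exists (mcat_family hX); apply: mcat_family_assoc.
split=> [|hRep]; first exact: zeta_strong.
split.
- exact: hRep.
- exact: MM_representable.
- exact: zeta_strong.
exists (collapse (proj1 hRep)); split; first exact: collapse_strong.
- by exists (sigma_oplax hRep); apply: sigma_equivalence.
- by exists (eta_oplax hRep); apply: eta_equivalence.
Qed.
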